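(* Let $s\ge0$ and $r\in[1,\infty]$, and let $r'$ be the conjugate exponent of $r$. Let $W:\mathbb{R}\to\mathbb{R}$ be a continuous path whose occupation measures $\mu_I(A)=\mathrm{Leb}(\{t\in I:W_t\in A\})$ are absolutely continuous with respect to Lebesgue measure $dz$ for all intervals $I$, and whose local time satisfies $\frac{d\mu_{[0,\cdot]}}{dz}(\cdot)\in C^\gamma_t(\mathbb{R};\mathcal{F}L^{\rho,\infty}(\mathbb{R}))$ (Hölder continuous of exponent $\gamma$ in time) for some $\gamma>\frac12$ and $\rho>\frac1{r'}$. Consider on $\mathbb{T}$ the periodic Wick-ordered cubic modulated NLS equation, for complex-valued $u$, $$\partial_tu+\frac{dW}{dt}\,i\partial_x^2u\pm i\big(|u|^2-2\|u\|_{L^2}^2\big)u=0,\qquad u|_{t=0}=u_0,$$ for either choice of sign. Then this equation is locally well-posed in $\mathcal{F}L^{s,r}(\mathbb{T})$. More precisely, for any $R>0$ there exists $T(R)\sim\langle R\rangle^{-\frac2\gamma}>0$ such that, with $T=T(R)$, for any $u_0\in\mathcal{F}L^{s,r}(\mathbb{T})$ with $\|u_0\|_{\mathcal{F}L^{s,r}}\le R$ there exists a unique mild solution $u\in C([0,T);\mathcal{F}L^{s,r}(\mathbb{T}))\cap X^{s,r}_T$ on $[0,T)$. Moreover, the flow map $u_0\in\mathcal{F}L^{s,r}(\mathbb{T})\mapsto u\in C([0,T);\mathcal{F}L^{s,r}(\mathbb{T}))\cap X^{s,r}_T$ is locally Lipschitz continuous.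
   Context: **Fourier-Lebesgue spaces.** $\|u\|_{\mathcal{F}L^{s,r}(\mathcal{M})}=\|\langle\xi\rangle^s\widehat u(\xi)\|_{L^r(\widehat{\mathcal{M}})}$, with $\langle\xi\rangle=(1+|\xi|^2)^{1/2}$, where $\widehat{\mathbb{T}}=\mathbb{Z}$ and $\widehat{\mathbb{R}}=\mathbb{R}$. **Modulation.** The occupation measure of $W$ on a time interval $I$ is $\mu_I(A)=\mathrm{Leb}(\{t\in I:W_t\in A\})$, $A\subset\mathbb{R}$ Borel. It is assumed that $\mu_I\ll dz$ for all intervals $I$, with density (local time) $\frac{d\mu_I}{dz}$ (for $t<0$, $[0,t]$ is understood as the interval between $t$ and $0$). **Nonlinearity.** The Wick-ordered nonlinearity is written on the Fourier side (the $L^2$ norm being normalized so that $\|u\|_{L^2}^2=\sum_n|\widehat u_n|^2$) as $$\big(|u|^2-2\|u\|_{L^2}^2\big)u=\sum_{n_0\in\mathbb{Z}}e^{in_0x}\Big\{\sum_{\substack{n_1-n_2+n_3=n_0\\ n_2\ne n_1,n_3}}\widehat u_{n_1}\overline{\widehat u_{n_2}}\widehat u_{n_3}-|\widehat u_{n_0}|^2\widehat u_{n_0}\Big\},$$ and it is through this expression that it is understood for data outside $L^2(\mathbb{T})$. **Mild solution.** With $\mathcal{L}=i\partial_x^2$ and $\mathcal{N}(u)=\pm i(|u|^2-2\|u\|_{L^2}^2)u$, a mild solution is a function satisfying $$u(t)=e^{-(W_t-W_0)\mathcal{L}}u_0-\int_0^te^{-(W_t-W_\tau)\mathcal{L}}\mathcal{N}(u(\tau))\,d\tau.$$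 **The space $X^{s,r}_T$.** For $I=[a,b)$ let $\mathcal{Z}(I)$ be the set of finite non-decreasing sequences $\{t_k\}_{k=0}^K$ with $t_0=a$, $t_K=b$. A $U^2(I)\mathcal{F}L^{s,r}$-atom is a function $A(t)=\sum_{k=1}^K\mathbf{1}_{[t_{k-1},t_k)}(t)\phi_k$ with $\{t_k\}\in\mathcal{Z}(I)$, $\phi_k\in\mathcal{F}L^{s,r}(\mathbb{T})$, $\sum_{k=1}^K\|\phi_k\|_{\mathcal{F}L^{s,r}}^2\le1$. $U^2(I)\mathcal{F}L^{s,r}$ is the space of $u=\sum_{j\ge0}\lambda_jA_j$ with $\{\lambda_j\}\in\ell^1$ and $A_j$ atoms, with norm the infimum of $\sum_j|\lambda_j|$ over all such representations. Then $X^{s,r}_T=\{u:e^{W_t\mathcal{L}}u\in U^2([0,T))\mathcal{F}L^{s,r}(\mathbb{T})\}$ with $\|u\|_{X^{s,r}_T}=\|e^{W_t\mathcal{L}}u\|_{U^2([0,T))\mathcal{F}L^{s,r}}$. $A\sim B$ means $C^{-1}B\le A\le CB$ for a constant $C>0$ independent of $R$.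
   Formalization: For r=∞, C([0,T);FL^{s,∞}) is taken with the weak-* topology, since norm continuity fails for general data; norm continuity is kept for data in the closure of trigonometric polynomials. The frequency sum in the Duhamel term is taken after the time integral, and Hölder in time is local. *)

(* Defs.v *)
From HB Require Import structures.
From mathcomp Require Import all_boot all_order all_algebra.
From mathcomp Require Import all_classical all_reals all_analysis.
From mathcomp Require Import complex.

Set Implicit Arguments.
Unset Strict Implicit.
Unset Printing Implicit Defensive.

Import Order.TTheory GRing.Theory Num.Theory.
Import numFieldNormedType.Exports Normc.

Local Open Scope classical_set_scope.
Local Open Scope complex_scope.
Local Open Scope ring_scope.

HB.instance Definition _ := isPointed.Build int 0.
HB.instance Definition _ := @isMeasurable.Build default_measure_display
  int discrete_measurable discrete_measurable0
  discrete_measurableC discrete_measurableU.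

Section Preliminaries.
Variable R : realType.

Definition japanese (x : R) : R := Num.sqrt (1 + x ^+ 2).

Definition expi (x : R) : R[i] := cos x +i* sin x.

Definition cintegral (D : set R) (f : R -> R[i]) : R[i] :=
  (\int[lebesgue_measure]_(x in D) complex.Re (f x)) +i*
  (\int[lebesgue_measure]_(x in D) complex.Im (f x)).

(* Unordered summation. In C the existence of the sum S is equivalent to
   absolute summability of the family f over D. *)
Definition has_csum (I : choiceType) (D : set I) (f : I -> R[i]) (S : R[i]) :=
  forall e : R, 0 < e -> exists2 A, fsets D A &
    forall B, fsets D B -> A `<=` B -> normc (\sum_(i \in B) f i - S) < e.

End Preliminaries.

Section LocalTime.
Variable R : realType.
Local Notation leb := (@lebesgue_measure R).

Definition fourier (f : R -> R) (xi : R) : R[i] :=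
  cintegral setT (fun z => (f z)%:C * expi (- (xi * z))).

Definition FLR_norm (rho : R) (p : \bar R) (f : R -> R) : \bar R :=
  Lnorm leb p (fun xi => (japanese xi `^ rho * normc (fourier f xi))%:E).

Definition occupation (W : R -> R) (I : set R) (A : set R) : \bar R :=
  leb (I `&` W @^-1` A).

Definition is_density (mu : set R -> \bar R) (f : R -> R) : Prop :=
  [/\ measurable_fun setT f, (forall z, 0 <= f z) &
      forall A, measurable A -> mu A = (\int[leb]_(z in A) (f z)%:E)%E].

Definition between0 (t : R) : set R := `[Num.min 0 t, Num.max 0 t].

(* [L t] is a version of the density of the occupation measure of the interval
   between 0 and t; since the occupation measure of a set of length h has
   mass h, it is unique up to null sets and integrable. *)
Definition is_local_time (W : R -> R) (L : R -> R -> R) : Prop :=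
  forall t, is_density (occupation W (between0 t)) (L t).

(* Hoelder continuity is on compact time intervals: the Fourier transform of
   [L t - L t'] at 0 is |t| - |t'|, so with gamma < 1 no local time is
   Hoelder continuous uniformly on the whole line, nor is it bounded there. *)
Definition holder_FLR (gamma rho : R) (p : \bar R) (L : R -> R -> R) : Prop :=
  (forall t, (FLR_norm rho p (L t) < +oo)%E) /\
  forall M : R, exists C : R, forall t t',
    t \in `[- M, M] -> t' \in `[- M, M] ->
    (FLR_norm rho p (fun z => L t z - L t' z)%R
       <= (C * `|t - t'| `^ gamma)%:E)%E.

End LocalTime.

Section Torus.
Variable R : realType.

(* A periodic distribution is given by its Fourier coefficients. *)
Definition coefs := int -> R[i].

Implicit Types (u v : coefs) (U V : R -> coefs).

Definition FLT_norm (s : R) (r : \bar R) u : \bar R :=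
  Lnorm (@counting int R) r
    (fun n => (japanese n%:~R `^ s * normc (u n))%:E).

Definition in_FLT s r u : Prop := (FLT_norm s r u < +oo)%E.

(* Membership in the closure of the trigonometric polynomials; this holds for
   every element of FL^{s,r} unless r = +oo. *)
Definition in_FLT_closure s r u : Prop :=
  forall e : R, 0 < e -> exists2 v, finite_set [set n | v n != 0] &
    (FLT_norm s r (fun n => u n - v n)%R < e%:E)%E.

Definition strongly_continuous s r (T : R) U : Prop :=
  forall t, t \in `[0, T[ ->
    FLT_norm s r (fun n => U t' n - U t n)
      @[t' --> within `[0, T[%classic (nbhs t)] --> 0%E.

(* FL^{s,+oo} is the dual of FL^{-s,1}. *)
Definition weak_star_continuous s (T : R) U : Prop :=
  forall v, in_FLT (- s) 1%E v -> forall t, t \in `[0, T[ ->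
    forall e : R, 0 < e ->
    \forall t' \near within `[0, T[%classic (nbhs t),
      exists2 S, has_csum setT (fun n => (U t' n - U t n) * v n) S &
                 normc S < e.

(* C([0,T); FL^{s,r}). For r = +oo the group e^{x L} is not strongly
   continuous on FL^{s,r}, only weak-* continuous, and C refers to the weak-*
   topology. *)
Definition in_C s r (T : R) U : Prop :=
  (forall t, t \in `[0, T[ -> in_FLT s r (U t)) /\
  (if r == +oo%E then weak_star_continuous s T U
   else strongly_continuous s r T U).

Definition C_norm s r (T : R) U : \bar R :=
  ereal_sup [set FLT_norm s r (U t) | t in `[0, T[%classic].

(* The group e^{x L}, L = i d^2/dx^2, has Fourier multiplier e^{-i x n^2}. *)
Definition expL (x : R) u : coefs := fun n => expi (- (x * n%:~R ^+ 2)) * u n.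

Definition U2_atom s r (a b : R) U : Prop :=
  exists (K : nat) (tt : nat -> R) (phi : nat -> coefs),
    [/\ tt 0%N = a /\ tt K = b,
        (forall k, (k < K)%N -> tt k <= tt k.+1),
        (forall k, (k < K)%N -> in_FLT s r (phi k)),
        (\sum_(k < K) FLT_norm s r (phi k) ^+ 2 <= 1)%E &
        U = fun t n => \sum_(k < K) (\1_(`[tt k, tt k.+1[%classic) t)%:C * phi k n].

Definition l1_norm (lam : nat -> R[i]) : \bar R :=
  (\sum_(0 <= j <oo) (normc (lam j))%:E)%E.

Definition U2_representation s r (a b : R) U (lam : nat -> R[i])
    (A : nat -> R -> coefs) : Prop :=
  [/\ (forall j, U2_atom s r a b (A j)),
      (l1_norm lam < +oo)%E &
      forall t, t \in `[a, b[ ->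
        FLT_norm s r (fun n => U t n - \sum_(j < J) lam j * A j t n)
          @[J --> \oo] --> 0%E].

Definition in_U2 s r (a b : R) U : Prop :=
  exists lam A, U2_representation s r a b U lam A.

Definition U2_norm s r (a b : R) U : \bar R :=
  ereal_inf [set l1_norm lam | lam in
    [set lam | exists A, U2_representation s r a b U lam A]].

Definition in_X (W : R -> R) s r (T : R) U : Prop :=
  in_U2 s r 0 T (fun t => expL (W t) (U t)).

Definition X_norm (W : R -> R) s r (T : R) U : \bar R :=
  U2_norm s r 0 T (fun t => expL (W t) (U t)).

Definition nonresonant (n0 : int) : set (int * int * int) :=
  [set k | [/\ k.1.1 - k.1.2 + k.2 = n0, k.1.2 != k.1.1 & k.1.2 != k.2]].

(* The nonresonant and resonant products whose sum over k, respectively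
   difference, make up the Wick-ordered cubic nonlinearity. *)
Definition trilinear u (k : int * int * int) : R[i] :=
  u k.1.1 * conjc (u k.1.2) * u k.2.

Definition resonant u (n : int) : R[i] := trilinear u (n, n, n).

(* The n-th Fourier coefficient of the integral over [0,t] of
   e^{-(W_t - W_tau) L} F(tau). *)
Definition duhamel (W : R -> R) (t : R) (n : int) (F : R -> R[i]) : R[i] :=
  cintegral `[0, t]
    (fun tau => expi ((W t - W tau) * n%:~R ^+ 2) * F tau).

(* The sign of the nonlinearity is (-1)^sgn. The frequency sum of the
   nonlinearity is taken after the time integration: for general data in
   FL^{s,r} (say s = 0 and r = +oo) the sum at a fixed time diverges, whereas
   the sum of the time integrals converges absolutely for U in X^{s,r}_T. *)
Definition mild_solution (sgn : bool) (W : R -> R) (T : R) (u0 : coefs) U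
    : Prop :=
  forall t, t \in `[0, T[ -> forall n : int, exists2 S,
    has_csum (nonresonant n)
      (fun k => duhamel W t n (fun tau => trilinear (U tau) k)) S &
    U t n = expL (- (W t - W 0)) u0 n
            - (-1) ^+ sgn * (0 +i* 1) * (S - duhamel W t n (fun tau => resonant (U tau) n)).

Definition solution (sgn : bool) (W : R -> R) s r (T : R) (u0 : coefs) U
    : Prop :=
  [/\ in_C s r T U, in_X W s r T U & mild_solution sgn W T u0 U].

Definition CX_dist (W : R -> R) s r (T : R) U V : \bar R :=
  (C_norm s r T (fun t n => U t n - V t n)%R
   + X_norm W s r T (fun t n => U t n - V t n)%R)%E.

(* Local Lipschitz continuity of Phi on the set B of initial data. *)
Definition locally_lipschitz_flow (W : R -> R) s r (T : R) (B : set coefs)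
    (Phi : coefs -> R -> coefs) : Prop :=
  forall u0, B u0 -> exists d C : R, 0 < d /\
    forall v0 w0, B v0 -> B w0 ->
      (FLT_norm s r (fun n => v0 n - u0 n)%R < d%:E)%E ->
      (FLT_norm s r (fun n => w0 n - u0 n)%R < d%:E)%E ->
      (CX_dist W s r T (Phi v0) (Phi w0)
         <= C%:E * FLT_norm s r (fun n => v0 n - w0 n)%R)%E.

End Torus.

(* Main.v *)
Require Import Defs.
From mathcomp Require Import all_boot all_order all_algebra.
From mathcomp Require Import all_classical all_reals all_analysis.
From mathcomp Require Import complex finmap ring lra.
From mathcomp Require Import measurable_realfun ess_sup_inf.

Set Implicit Arguments.
Unset Strict Implicit.
Unset Printing Implicit Defensive.

Import Order.TTheory GRing.Theory Num.Theory.
Import numFieldNormedType.Exports Normc.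

Local Open Scope classical_set_scope.
Local Open Scope complex_scope.
Local Open Scope ring_scope.

(** The idea is to pass to the interaction picture w(t) = e^{W_t L} u(t), in which
    the mild equation reads w(t) = e^{W_0 L} u_0 minus the time integral of the
    nonlinearity, and a triple (n1, n2, n3) of frequencies contributes with the
    oscillating factor e^{i xi W_t}, where xi is its resonance function
    n1^2 - n2^2 + n3^2 - (n1 - n2 + n3)^2 ([mild_wickint]).

    Averaging along W makes these factors small. The integral of e^{i xi W_t} over
    [x, y) is a value of the Fourier transform of the local time of [x, y), so the
    assumption on the local time says that it is at most
    C (y - x)^gamma <xi>^{-rho} ([osc_bound]). The resonance function factorizes as
    -2 (n1 - n2)(n3 - n2), and for nonresonant triples the decay <xi>^{-rho} is
    bounded by a product of decays in two independent frequencies. As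
    rho > 1/r', it is l^{r'}-summable over the triples with a given output, and
    Hoelder's inequality gives a trilinear bound on FL^{s,r} ([FLle_trisum]).

    Suppose now that w is a step function. Cutting [x, y) at its jumps expresses the
    Duhamel integral through oscillatory integrals over subintervals. For an atom
    of U^2 the values are square summable, and gamma > 1/2 allows Cauchy-Schwarz to
    sum the powers (length)^gamma of the pieces against them
    ([square_summable_cut]). By linearity and limits, the Duhamel integral over
    [x, y) is bounded by C (y - x)^gamma times the cube of the U^2 norm of w
    ([absint_step], [absint_le], [FLle_wickint]). Thus the Picard map sends U^2
    into the functions that are Hoelder continuous of exponent gamma with values in
    FL^{s,r}. Conversely, again because gamma > 1/2, such functions belong to U^2:
    along dyadic times their increments form atoms with geometrically decreasing
    coefficients ([hoelder_U2]).

    The two facts close the argument. On [0, T) the Picard map is a contraction of a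
    ball of Hoelder functions if M^2 T^gamma is small, that is, for T of order
    <M>^{-2/gamma} ([picard_diff_hoelder], [picard_solution]). Any other solution in
    X is a fixed point as well, possibly a large one; the difference of the two is
    controlled on short intervals, and stepping through [0, T) gives uniqueness
    ([fixed_unique]). The same difference estimate gives the Lipschitz bound
    ([fixed_points_diff], [constructed_lipschitz]).

    It remains to undo the passage to the interaction picture, where the group
    e^{x L} matters for the continuity in time of u(t) = e^{-W_t L} w(t). On the
    closure of the trigonometric polynomials, which is the whole space if r is
    finite, the group is strongly continuous. For r infinite and general data the
    bounded function u is weak-* continuous. The Duhamel integral preserves the
    closure, since w can be approximated by step functions with finitely many
    frequencies ([closure_wickint]), so that for data in the closure the solution is
    strongly continuous for every r. *)

(** * Complex moduli and limits *)

Lemma eq_ler {d} {T : porderType d} (x y : T) : x = y -> (x <= y)%O.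
Proof. by move=> ->. Qed.

Section ComplexModulus.
Variable R : realType.
Implicit Types (z w : R[i]) (x : R).

Lemma normc_ge0 z : 0 <= normc z.
Proof. by case: z => a b /=; rewrite sqrtr_ge0. Qed.

Lemma normc_conj z : normc (conjc z) = normc z.
Proof. by case: z => a b /=; rewrite sqrrN. Qed.

Lemma normc_real x : normc x%:C = `|x|.
Proof. by rewrite /= expr0n addr0 sqrtr_sqr. Qed.

Lemma normc_opp z : normc (- z) = normc z.
Proof. exact: normcN. Qed.

Lemma normc_sub z w : normc (z - w) = normc (w - z).
Proof. by rewrite -normc_opp opprB. Qed.

Lemma normc_triangle z w : normc (z + w) <= normc z + normc w.
Proof. exact: le_normcD. Qed.

Lemma normc_subl z w : normc z - normc w <= normc (z - w).
Proof. by rewrite lerBlDr (le_trans _ (normc_triangle _ _))// subrK. Qed.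

Lemma normc_mul z w : normc (z * w) = normc z * normc w.
Proof. exact: normcM. Qed.

Lemma normc_sum (I : Type) (F : seq I) (P : pred I) (f : I -> R[i]) :
  normc (\sum_(k <- F | P k) f k) <= \sum_(k <- F | P k) normc (f k).
Proof.
elim/big_rec2 : _ => [|k y z _ IH]; first by rewrite normc0.
by rewrite (le_trans (normc_triangle _ _))// lerD2l.
Qed.

Lemma Re_le_normc z : `|complex.Re z| <= normc z.
Proof.
case: z => a b /=; rewrite -sqrtr_sqr ler_sqrt ?lerDl ?sqr_ge0//.
by rewrite addr_ge0 ?sqr_ge0.
Qed.

Lemma Im_le_normc z : `|complex.Im z| <= normc z.
Proof.
case: z => a b /=; rewrite -sqrtr_sqr ler_sqrt ?lerDr ?sqr_ge0//.
by rewrite addr_ge0 ?sqr_ge0.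
Qed.

Lemma normc_le_ReIm z : normc z <= `|complex.Re z| + `|complex.Im z|.
Proof.
case: z => a b /=.
rewrite -(@ger0_norm _ (`|a| + `|b|)) ?addr_ge0// -sqrtr_sqr.
rewrite ler_sqrt ?sqr_ge0// sqrrD !real_normK ?num_real//.
by rewrite -addrA lerD2l addrC lerDl mulrn_wge0// mulr_ge0.
Qed.

Lemma ReB z w : complex.Re (z - w) = complex.Re z - complex.Re w.
Proof. by case: z w => ? ? []. Qed.

Lemma ImB z w : complex.Im (z - w) = complex.Im z - complex.Im w.
Proof. by case: z w => ? ? []. Qed.

Lemma expiD x y : expi (x + y) = expi x * expi y :> R[i].
Proof.
by rewrite /expi cosD sinD; apply/eqP; rewrite eq_complex/= eqxx/= addrC mulrC.
Qed.

Lemma expi0 : expi 0 = 1 :> R[i].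
Proof. by rewrite /expi cos0 sin0. Qed.

Lemma normc_expi x : normc (expi x) = 1.
Proof. by rewrite /= cos2Dsin2 sqrtr1. Qed.

Lemma conj_expi x : conjc (expi x) = expi (- x).
Proof. by rewrite /expi cosN sinN. Qed.

Lemma normc_expiM x z : normc (expi x * z) = normc z.
Proof. by rewrite normc_mul normc_expi mul1r. Qed.

(** The real-valued modulus, rather than the topology of C, carries the limit, so
    that estimates of real sequences apply directly. *)
Definition ccvg (u : nat -> R[i]) z := (normc (u j - z)) @[j --> \oo] --> (0 : R).

Lemma ccvg_squeeze (u : nat -> R[i]) z (b : nat -> R) :
  (forall j, normc (u j - z) <= b j) -> b @ \oo --> (0 : R) -> ccvg u z.
Proof.
move=> ub b0; apply: (@squeeze_cvgr _ _ _ _ (fun=> 0) b) => //; last exact: cvg_cst.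
by near=> j; rewrite normc_ge0 ub.
Unshelve. all: by end_near. Qed.

Lemma ccvg_cst z : ccvg (fun=> z) z.
Proof. by rewrite /ccvg subrr normc0; exact: cvg_cst. Qed.

Lemma ccvgD (u v : nat -> R[i]) z w : ccvg u z -> ccvg v w ->
  ccvg (fun j => u j + v j) (z + w).
Proof.
move=> uz vw.
apply: (@ccvg_squeeze _ _ (fun j => normc (u j - z) + normc (v j - w))).
  by move=> j; rewrite opprD addrACA normc_triangle.
by rewrite -(addr0 (0 : R)); exact: cvgD.
Qed.

Lemma ccvgB (u v : nat -> R[i]) z w : ccvg u z -> ccvg v w ->
  ccvg (fun j => u j - v j) (z - w).
Proof.
move=> uz vw; apply: ccvgD => //.
by apply: cvg_trans vw; apply: near_eq_cvg; near=> j; rewrite -opprD normc_opp.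
Unshelve. all: by end_near. Qed.

Lemma ccvg_conj (u : nat -> R[i]) z : ccvg u z ->
  ccvg (fun j => conjc (u j)) (conjc z).
Proof.
move=> uz; apply: (@ccvg_squeeze _ _ (fun j => normc (u j - z))) => // j.
by rewrite -[normc (u j - z)]normc_conj raddfB.
Qed.

Lemma ccvg_norm (u : nat -> R[i]) z : ccvg u z -> (normc (u j)) @[j --> \oo] --> normc z.
Proof.
move=> uz; apply/cvgrPdist_le => e e0.
move/cvgrPdist_le : uz => /(_ _ e0); apply: filterS => j.
rewrite sub0r normrN ger0_norm ?normc_ge0// => uze.
rewrite ler_norml; have := normc_subl (u j) z; have := normc_subl z (u j).
by rewrite (normc_sub z); lra.
Qed.

Lemma ccvgM (u v : nat -> R[i]) z w : ccvg u z -> ccvg v w ->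
  ccvg (fun j => u j * v j) (z * w).
Proof.
move=> uz vw.
apply: (@ccvg_squeeze _ _ (fun j => normc (u j - z) * normc (v j) + normc z * normc (v j - w))).
  move=> j; rewrite -!normc_mul (le_trans _ (normc_triangle _ _))//.
  by apply: eq_ler; congr normc; ring.
rewrite [X in _ --> X](_ : _ = 0 * normc w + normc z * 0); last by rewrite mul0r mulr0 addr0.
by apply: cvgD; [apply: cvgM => //; exact: ccvg_norm|apply: cvgM => //; exact: cvg_cst].
Qed.

Lemma ccvg_unique (u : nat -> R[i]) z w : ccvg u z -> ccvg u w -> z = w.
Proof.
move=> uz uw; apply/eqP; rewrite -subr_eq0; apply/eqP/eq0_normc.
have := ccvgB uz uw.
under eq_fun do rewrite subrr.
move=> /ccvg_norm; rewrite normc0 => h.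
by apply: (cvg_unique _ h) => //; exact: cvg_cst.
Qed.

Lemma ccvg_ReIm (u : nat -> R[i]) z :
  (complex.Re (u j)) @[j --> \oo] --> complex.Re z ->
  (complex.Im (u j)) @[j --> \oo] --> complex.Im z -> ccvg u z.
Proof.
move=> uR uI.
apply: (@ccvg_squeeze _ _ (fun j => `|complex.Re (u j) - complex.Re z| +
                                    `|complex.Im (u j) - complex.Im z|)).
  by move=> j; rewrite (le_trans (normc_le_ReIm _))// ReB ImB.
rewrite -(addr0 (0 : R)); apply: cvgD.
  by move/subr_cvg0 : uR => /cvg_norm; rewrite normr0.
by move/subr_cvg0 : uI => /cvg_norm; rewrite normr0.
Qed.

Lemma ccvg_Re (u : nat -> R[i]) z : ccvg u z ->
  (complex.Re (u j)) @[j --> \oo] --> complex.Re z.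
Proof.
move=> uz; apply/subr_cvg0.
apply: norm_cvg0.
apply: (@squeeze_cvgr _ _ _ _ (fun=> 0) (fun j => normc (u j - z))) => //; last exact: cvg_cst.
near=> j; rewrite normr_ge0/=.
by rewrite -ReB Re_le_normc.
Unshelve. all: by end_near. Qed.

Lemma ccvg_Im (u : nat -> R[i]) z : ccvg u z ->
  (complex.Im (u j)) @[j --> \oo] --> complex.Im z.
Proof.
move=> uz; apply/subr_cvg0.
apply: norm_cvg0.
apply: (@squeeze_cvgr _ _ _ _ (fun=> 0) (fun j => normc (u j - z))) => //; last exact: cvg_cst.
near=> j; rewrite normr_ge0/=.
by rewrite -ImB Im_le_normc.
Unshelve. all: by end_near. Qed.

(** Completeness of C in the form used for Picard iterates. *)
Lemma ccvg_geometric (u : nat -> R[i]) (b : R) :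
  (forall j, normc (u j.+1 - u j) <= b * 2^-1 ^+ j) -> exists z, ccvg u z.
Proof.
move=> ub.
have b0 : 0 <= b by have := ub 0%N; rewrite expr0 mulr1; exact/le_trans/normc_ge0.
have cau (f : nat -> R) : (forall j, `|f j.+1 - f j| <= b * 2^-1 ^+ j) -> cvgn f.
  move=> fb; have /funext -> := eq_sum_telescope f.
  apply: is_cvgD; first exact: is_cvg_cst.
  apply: normed_cvg; apply: (series_le_cvg (v_ := geometric b 2^-1)).
  - by move=> j; exact: normr_ge0.
  - by move=> j; rewrite /= mulr_ge0// exprn_ge0// invr_ge0.
  - exact: fb.
  by apply: is_cvg_geometric_series; rewrite ger0_norm ?invr_ge0// invf_lt1 ?ltr1n.
have cR : cvgn (fun j => complex.Re (u j)).
  by apply: cau => j; apply: le_trans (ub j); rewrite -ReB Re_le_normc.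
have cI : cvgn (fun j => complex.Im (u j)).
  by apply: cau => j; apply: le_trans (ub j); rewrite -ImB Im_le_normc.
by exists (limn (fun j => complex.Re (u j)) +i* limn (fun j => complex.Im (u j))); apply: ccvg_ReIm.
Qed.

End ComplexModulus.

(** * Unordered sums *)

Section UnorderedSums.
Variables (R : realType) (I : choiceType).
Implicit Types (D A B : set I) (f g : I -> R[i]).

(** Absolute summability with an explicit bound, the form in which the trilinear
    estimate delivers it. *)
Definition csummable D f (M : R) := forall B, fsets D B ->
  \sum_(k <- fset_set B) normc (f k) <= M.

Definition csum D f : R[i] := xget 0 [set S | has_csum D f S].

Lemma fsetsU D A B : fsets D A -> fsets D B -> fsets D (A `|` B).
Proof.
by move=> [fA AD] [fB BD]; split; [rewrite finite_setU|move=> x []; [exact: AD|exact: BD]].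
Qed.

Lemma has_csum_unique D f S S' : has_csum D f S -> has_csum D f S' -> S = S'.
Proof.
move=> h h'; apply/eqP; rewrite -subr_eq0; apply/eqP/eq0_normc.
apply/eqP; rewrite eq_le normc_ge0 andbT leNgt; apply/negP => e0.
have [A fA hA] := h _ (divr_gt0 e0 (ltr0Sn _ 1)).
have [A' fA' hA'] := h' _ (divr_gt0 e0 (ltr0Sn _ 1)).
have fAA := fsetsU fA fA'.
have := normc_triangle (S - \sum_(i \in A `|` A') f i) (\sum_(i \in A `|` A') f i - S').
rewrite addrA subrK normc_sub.
have := hA _ fAA (@subsetUl _ _ _); have := hA' _ fAA (@subsetUr _ _ _).
by rewrite (normc_sub S S'); lra.
Qed.

Lemma csumE D f S : has_csum D f S -> csum D f = S.
Proof.
by move=> h; rewrite /csum; case: xgetP => [x -> xS|/(_ S)//]; exact: has_csum_unique xS h.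
Qed.

Lemma has_csumD D f g S S' : has_csum D f S -> has_csum D g S' ->
  has_csum D (fun k => f k + g k) (S + S').
Proof.
move=> h h' e e0.
have [A fA hA] := h _ (divr_gt0 e0 (ltr0Sn _ 1)).
have [A' fA' hA'] := h' _ (divr_gt0 e0 (ltr0Sn _ 1)).
exists (A `|` A'); first exact: fsetsU.
move=> B fB AB; have [finB _] := fB.
rewrite fsbig_split//= opprD addrACA.
rewrite (le_lt_trans (normc_triangle _ _))//.
have := hA _ fB (fun x Ax => AB x (or_introl Ax)).
have := hA' _ fB (fun x Ax => AB x (or_intror Ax)).
by lra.
Qed.

Lemma has_csumZ D (c : R[i]) f S : has_csum D f S ->
  has_csum D (fun k => c * f k) (c * S).
Proof.
move=> h e e0.
have c0 : 0 < normc c + 1 by rewrite ltr_wpDl// normc_ge0.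
have [A fA hA] := h _ (divr_gt0 e0 c0).
exists A => // B fB AB; have [finB _] := fB.
rewrite -fsbig_distrr//= -mulrBr normc_mul.
have := hA _ fB AB; rewrite ltr_pdivlMr// => hh.
apply: le_lt_trans hh; rewrite mulrC ler_wpM2l ?normc_ge0//.
by rewrite lerDl.
Qed.

Lemma eq_has_csum D f g S : (forall k, D k -> f k = g k) ->
  has_csum D f S -> has_csum D g S.
Proof.
move=> fg h e /h [A fA hA]; exists A => // B fB AB.
rewrite (eq_fsbigr f); first exact: hA.
by move=> k /set_mem Bk; rewrite fg//; case: fB => _ BD; exact: BD.
Qed.

(** The supremum of the finite sums is the sum, by monotonicity. *)
Lemma has_csum_ge0 D (f : I -> R) (M : R) : (forall k, 0 <= f k) ->
  (forall B, fsets D B -> \sum_(k <- fset_set B) f k <= M) ->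
  exists S : R[i], has_csum D (fun k => (f k)%:C) S.
Proof.
move=> f0 fM.
pose E := [set \sum_(k <- fset_set B) f k | B in fsets D].
have Eub : ubound E M by move=> _ [B /fM ? <-].
have E0 : E !=set0 by exists (\sum_(k <- fset_set set0) f k); exists set0 => //; exact: fsets_set0.
have hE : has_sup E by split => //; exists M.
exists (sup E)%:C => e e0.
have [_ [A fA <-] hA] := sup_adherent e0 hE.
exists A => // B fB AB; have [finB _] := fB; have [finA _] := fA.
rewrite fsbig_finite//=.
have -> : \sum_(k <- fset_set B) (f k)%:C = (\sum_(k <- fset_set B) f k)%:C.
  by rewrite (raddf_sum (real_complex R)).
rewrite -raddfB normc_real.
have h1 : \sum_(k <- fset_set B) f k <= sup E by apply: ub_le_sup; [exists M|exists B].
have h2 : \sum_(k <- fset_set A) f k <= \sum_(k <- fset_set B) f k.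
  rewrite -!fsbig_finite//= [leRHS](fsbigID A)//=.
  rewrite (_ : B `&` A = A) ?lerDl; last by apply/setIidPr.
  rewrite fsbig_finite; last exact: finite_setIl.
  by apply: sumr_ge0.
by rewrite ltr_norml; apply/andP; split; lra.
Qed.

(** The positive and negative parts of the real and imaginary parts are four
    nonnegative families dominated by the moduli. *)
Lemma csumP D f (M : R) : csummable D f M -> has_csum D f (csum D f).
Proof.
move=> fM.
suff [S hS] : exists S, has_csum D f S by rewrite (csumE hS).
have sub (g : I -> R) : (forall k, 0 <= g k <= normc (f k)) ->
    exists S : R[i], has_csum D (fun k => (g k)%:C) S.
  move=> g0; apply: (@has_csum_ge0 _ _ M) => [k|B /fM]; first by case/andP: (g0 k).
  by apply: le_trans; apply: ler_sum => k _; case/andP: (g0 k).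
have pn (x y : R) : `|x| <= y -> (0 <= Num.max 0 x <= y) /\ (0 <= Num.max 0 (- x) <= y).
  by rewrite ler_norml => /andP[? ?]; rewrite !le_max !ge_max lexx; split; apply/andP; split; lra.
have [S1 h1] := sub _ (fun k => proj1 (pn _ _ (Re_le_normc (f k)))).
have [S2 h2] := sub _ (fun k => proj2 (pn _ _ (Re_le_normc (f k)))).
have [S3 h3] := sub _ (fun k => proj1 (pn _ _ (Im_le_normc (f k)))).
have [S4 h4] := sub _ (fun k => proj2 (pn _ _ (Im_le_normc (f k)))).
eexists; apply: eq_has_csum; last exact: (has_csumD (has_csumD h1 (has_csumZ (-1) h2))
  (has_csumZ (0 +i* 1) (has_csumD h3 (has_csumZ (-1) h4)))).
move=> k _ /=; rewrite [RHS]complexE !mulN1r -!raddfB/= /real_complex_def.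
have e (x : R) : Num.max 0 x - Num.max 0 (- x) = x.
  case: (leP 0 x) => x0.
    by rewrite max_l ?subr0// oppr_le0.
  by rewrite max_r ?sub0r ?opprK// oppr_ge0 ltW.
by rewrite !e.
Qed.

End UnorderedSums.

Lemma cvg_sum0 (R : realType) (J : Type) (F : seq J) (f : J -> nat -> R) :
  (forall i, f i j @[j --> \oo] --> (0 : R)) ->
  (\sum_(i <- F) f i j) @[j --> \oo] --> (0 : R).
Proof.
move=> f0; elim: F => [|i F IH].
  rewrite (_ : (fun j => _) = fun=> 0); first exact: cvg_cst.
  by apply/funext => j; rewrite big_nil.
rewrite (_ : (fun j => _) = (fun j => f i j + \sum_(i <- F) f i j)); last first.
  by apply/funext => j; rewrite big_cons.
by rewrite -[X in _ --> X]addr0; apply: cvgD; [exact: f0|exact: IH].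
Qed.

Section Exhaustion.
Variables (R : realType) (I : countType).

(** Along this increasing exhaustion by finite lists, unordered sums over a
    countable type are limits of sequences. *)
Definition exhaustion (j : nat) : seq I := undup (pmap (@choice.unpickle I) (iota 0 j)).

Lemma exhaustion_uniq j : uniq (exhaustion j). Proof. exact: undup_uniq. Qed.

Lemma mem_exhaustion (k : I) j : (choice.pickle k < j)%N -> k \in exhaustion j.
Proof.
move=> kj; rewrite mem_undup mem_pmap; apply/mapP; exists (choice.pickle k).
  by rewrite mem_iota.
by rewrite choice.pickleK.
Qed.

Lemma exhaustion_mono j j' : (j <= j')%N -> {subset exhaustion j <= exhaustion j'}.
Proof.
by move=> jj' k; rewrite /exhaustion -(subnKC jj') iotaD pmap_cat !mem_undup mem_cat => ->.
Qed.

Lemma exhaustion_cofinal (A : set I) : finite_set A ->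
  \forall j \near \oo, A `<=` [set` exhaustion j].
Proof.
move=> finA.
exists (\max_(k <- fset_set A) (choice.pickle k).+1)%N => // j /= Aj k Ak.
apply: mem_exhaustion; apply: leq_trans Aj.
by apply: (@leq_bigmax_seq _ _ xpredT (fun k => (choice.pickle k).+1)) => //; rewrite in_fset_set//; exact/mem_set.
Qed.

Lemma ccvg_csum (D : set I) (f : I -> R[i]) S : has_csum D f S ->
  ccvg (fun j => \sum_(k <- exhaustion j | k \in D) f k) S.
Proof.
move=> h; apply/cvgrPdist_lt => e e0.
have [A [finA AD] hA] := h _ e0.
apply: filterS (exhaustion_cofinal finA) => j Aj.
rewrite sub0r normrN ger0_norm ?normc_ge0//.
have -> : \sum_(k <- exhaustion j | k \in D) f k = \sum_(k \in D `&` [set` exhaustion j]) f k.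
  by rewrite fsbig_mkcondl -fsbig_seq ?exhaustion_uniq// big_mkcond.
apply: hA; first by split; [apply: finite_setIr; exact: finite_seq|move=> x []].
by move=> k Ak; split; [exact: AD|exact: Aj].
Qed.

End Exhaustion.

(** * Fourier-Lebesgue norms of sequences *)

Section CountingIntegral.
Variable R : realType.
Implicit Types (g : int -> R).

Lemma counting_set1 (n : int) : @counting int R [set n] = 1%E.
Proof. by rewrite /counting asboolT// fset_set1 cardfs1. Qed.

Lemma measurable_int (d : measure_display) (T : measurableType d) (g : int -> T) :
  measurable_fun setT g.
Proof. by []. Qed.

Lemma integral_counting_seq g (F : seq int) : (forall n, 0 <= g n) -> uniq F ->
  (\int[@counting int R]_n ((g n) * \1_[set` F] n)%:E)%E = (\sum_(n <- F) g n)%:E.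
Proof.
move=> g0 uF.
transitivity (\int[@counting int R]_n (\sum_(m <- F) (g m * \1_[set m] n)%:E))%E.
  apply: eq_integral => n _; rewrite sumEFin; congr EFin.
  rewrite indicE; case: (boolP (n \in F)) => nF.
    rewrite mem_set// mulr1 (bigD1_seq n)//= indicE mem_set// mulr1 big1 ?addr0// => m mn.
    by rewrite indicE memNset ?mulr0// => /= nm; rewrite nm eqxx in mn.
  rewrite memNset ?mulr0; last exact/negP.
  rewrite big_seq big1// => m mF; rewrite indicE memNset ?mulr0// => /= nm.
  by rewrite nm mF in nF.
rewrite ge0_integral_sum//=; last by move=> m n _; rewrite lee_fin mulr_ge0// indicE.
rewrite -sumEFin; apply: eq_bigr => m _.
under eq_integral do rewrite EFinM.
rewrite ge0_integralZl_EFin//.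
rewrite integral_indic// setIT [X in (_ * X)%E](_ : _ = 1%E) ?mule1//.
exact: counting_set1.
Qed.

(** Monotone convergence along an exhaustion of Z. *)
Lemma integral_counting_le g (M : R) : (forall n, 0 <= g n) ->
  (\int[@counting int R]_n (g n)%:E <= M%:E)%E <->
  forall F : seq int, uniq F -> \sum_(n <- F) g n <= M.
Proof.
move=> g0; split => [h F uF|h].
  rewrite -lee_fin -integral_counting_seq//; apply: le_trans h.
  apply: ge0_le_integral => //= n _; rewrite lee_fin.
  - by rewrite mulr_ge0// indicE.
  - by rewrite indicE; case: (_ \in _); rewrite ?mulr1// mulr0.
pose gJ J n : \bar R := (g n * \1_[set` exhaustion int J] n)%:E.
have nd n : nondecreasing_seq (gJ ^~ n).
  move=> J J' JJ; rewrite lee_fin !indicE ler_wpM2l// ler_nat.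
  by case: (boolP (n \in _)) => // /set_mem/= nJ; rewrite mem_set//; exact: (exhaustion_mono JJ).
have lim n : limn (gJ ^~ n) = (g n)%:E.
  apply/cvg_lim => //; apply: cvg_near_cst.
  have := exhaustion_cofinal (finite_set1 n); apply: filterS => J hJ.
  by rewrite /gJ indicE mem_set ?mulr1//; exact: hJ.
rewrite (_ : (\int[_]_n _)%E = (\int[@counting int R]_n (limn (gJ ^~ n)))%E); last first.
  by apply: eq_integral => n _; rewrite lim.
rewrite monotone_convergence//.
- apply: lime_le.
    apply: ereal_nondecreasing_is_cvgn => J J' JJ; apply: ge0_le_integral => //= n _.
    + by rewrite lee_fin mulr_ge0// indicE.
    exact: nd.
  by apply: nearW => J; rewrite integral_counting_seq ?exhaustion_uniq// lee_fin h// exhaustion_uniq.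
by move=> J n _; rewrite lee_fin mulr_ge0// indicE.
Qed.

End CountingIntegral.

Section FourierLebesgue.
Variables (R : realType) (s : R) (r : \bar R).
Hypotheses (hs : 0 <= s) (hr : (1 <= r)%E).
Implicit Types (u v : coefs R) (n : int) (B : R).

Definition weight n : R := japanese n%:~R `^ s.
Definition wmod u n := weight n * normc (u n).
(** Real upper bounds in place of the norm itself, which may be infinite, keep
    the estimates below within real arithmetic. *)
Definition FLle u B := (FLT_norm s r u <= B%:E)%E.

Lemma japanese_ge1 (x : R) : 1 <= japanese x.
Proof. by rewrite -sqrtr1 ler_sqrt ?addr_ge0 ?sqr_ge0// lerDl sqr_ge0. Qed.

Lemma japanese_ge_abs (x : R) : `|x| <= japanese x.
Proof. by rewrite -sqrtr_sqr ler_sqrt ?addr_ge0 ?sqr_ge0// lerDr. Qed.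

(** Peetre's inequality. *)
Lemma japanese_peetre (x y : R) : japanese (x + y) <= 2 * (japanese x * japanese y).
Proof.
have jj (z : R) : 0 <= japanese z by rewrite (le_trans ler01 (japanese_ge1 z)).
rewrite -(@ler_pXn2r _ 2)// ?nnegrE ?mulr_ge0//.
rewrite !exprMn !sqr_sqrtr ?addr_ge0 ?sqr_ge0//.
have := sqr_ge0 (x - y); have := sqr_ge0 (x * y); have := sqr_ge0 x; have := sqr_ge0 y.
nra.
Qed.

Lemma weight_ge1 n : 1 <= weight n.
Proof. by rewrite /weight -[leLHS](powRr0 (japanese n%:~R)); exact: (ler_powR (japanese_ge1 _) hs). Qed.

Lemma weight_tri (n1 n2 n3 : int) :
  weight (n1 - n2 + n3) <= 4 `^ s * (weight n1 * weight n2 * weight n3).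
Proof.
have jj (z : R) : 0 <= japanese z by rewrite (le_trans ler01 (japanese_ge1 z)).
rewrite /weight -!powRM ?mulr_ge0//; apply: ge0_ler_powR => //; rewrite ?nnegrE ?mulr_ge0//.
rewrite intrD rmorphB/=.
apply: le_trans (japanese_peetre _ _) _.
have := japanese_peetre (n1%:~R : R) (- n2%:~R).
have -> : japanese (- n2%:~R : R) = japanese n2%:~R by rewrite /japanese sqrrN.
move=> h.
have := ler_wpM2r (jj n3%:~R) h.
by rewrite !mulrA; lra.
Qed.

Lemma wmod_ge0 u n : 0 <= wmod u n.
Proof. by rewrite mulr_ge0 ?powR_ge0 ?normc_ge0. Qed.

Lemma normc_le_wmod u n : normc (u n) <= wmod u n.
Proof. by rewrite ler_peMl ?normc_ge0// weight_ge1. Qed.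

Lemma FLT_norm_ge0 u : (0 <= FLT_norm s r u)%E.
Proof. exact: Lnorm_ge0. Qed.

Lemma FLle_ge0 u B : FLle u B -> 0 <= B.
Proof. by move=> h; rewrite -lee_fin (le_trans (FLT_norm_ge0 u)). Qed.

Lemma counting_set1_le n (A : set int) : A n -> (1 <= @counting int R A)%E.
Proof.
move=> An; rewrite -(counting_set1 R n).
by apply: (@le_measure _ _ _ (@counting int R)); [exact/mem_set|exact/mem_set|move=> m ->].
Qed.

Lemma counting_setT_gt0 : (0 < @counting int R setT)%E.
Proof. exact: lt_le_trans (@counting_set1_le 0 _ I). Qed.

Lemma exponent_cases : (exists2 p : R, 1 <= p & r = p%:E) \/ r = +oo%E.
Proof. by case: r hr => [p p1| _|//]; [left; exists p|right]. Qed.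

(** Testing finitely many coefficients at a time reduces norm bounds to
    inequalities between finite sums. *)
Lemma FLleP_fin (p : R) u B : 1 <= p -> r = p%:E -> 0 <= B ->
  FLle u B <-> forall F, uniq F -> \sum_(n <- F) wmod u n `^ p <= B `^ p.
Proof.
move=> p1 rp B0.
have p0 : 0 < p by exact: lt_le_trans p1.
rewrite -integral_counting_le; last by move=> n; exact: powR_ge0.
have e : (\int[@counting int R]_n (wmod u n `^ p)%:E)%E = (FLT_norm s r u `^ p)%E.
  rewrite rp; have := @poweR_Lnorm _ _ _ (@counting int R) (fun n => (wmod u n)%:E) p.
  rewrite gt_eqF// => /(_ isT); rewrite /FLT_norm => ->.
  by apply: eq_integral => n _; rewrite abse_EFin poweR_EFin ger0_norm// wmod_ge0.
rewrite e -poweR_EFin /FLle; split => h.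
  have := @gt0_ler_poweR R p (ltW p0) _ _ _ _ h.
  by apply; rewrite in_itv/= leey ?FLT_norm_ge0 ?lee_fin ?B0.
have q0 : 0 <= p^-1 by rewrite invr_ge0 ltW.
have := @gt0_ler_poweR R p^-1 q0 _ _ _ _ h.
rewrite !in_itv/= !leey !andbT !poweR_ge0 lee_fin powR_ge0 => /(_ isT isT).
by rewrite -poweRrM mulfV ?gt_eqF// poweRe1 ?FLT_norm_ge0// -powRrM mulfV ?gt_eqF// powRr1.
Qed.

Lemma FLleP_oo u B : r = +oo%E -> FLle u B <-> forall n, wmod u n <= B.
Proof.
move=> rp; rewrite /FLle /FLT_norm rp unlock counting_setT_gt0.
split => [/ess_supP h n|h].
  case: h => N [mN N0 hN].
  have nN : ~ N n by move=> /counting_set1_le; rewrite N0 lee_fin ler10.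
  move: (contra_not (@hN n) nN); rewrite /= not_notE lee_fin ger0_norm//.
  exact: wmod_ge0.
by apply/ess_supP/nearW => n /=; rewrite lee_fin ger0_norm; [exact: h|exact: wmod_ge0].
Qed.

Lemma FLle_wmod_mono u v B : (forall n, wmod u n <= wmod v n) -> FLle v B -> FLle u B.
Proof.
move=> uv vB; have B0 := FLle_ge0 vB.
case: exponent_cases => [[p p1 rp]|rp].
  apply/(FLleP_fin _ p1 rp B0) => F uF.
  apply: le_trans (proj1 (FLleP_fin _ p1 rp B0) vB F uF); apply: ler_sum => n _.
  by apply: ge0_ler_powR; rewrite ?nnegrE ?wmod_ge0// (le_trans ler01).
by apply/(FLleP_oo _ _ rp) => n; exact: le_trans (uv n) (proj1 (FLleP_oo _ _ rp) vB n).
Qed.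

Lemma FLle_mono u v B : (forall n, normc (u n) <= normc (v n)) -> FLle v B -> FLle u B.
Proof. by move=> uv; apply: FLle_wmod_mono => n; rewrite ler_wpM2l// powR_ge0. Qed.

Lemma FLle_le u B B' : B <= B' -> FLle u B -> FLle u B'.
Proof. by move=> BB h; rewrite /FLle (le_trans h)// lee_fin. Qed.

Lemma FLle_coord u B n : FLle u B -> normc (u n) <= B.
Proof.
move=> uB; have B0 := FLle_ge0 uB; apply: le_trans (normc_le_wmod u n) _.
case: exponent_cases => [[p p1 rp]|rp]; last exact: (proj1 (FLleP_oo _ _ rp) uB n).
have := proj1 (FLleP_fin _ p1 rp B0) uB [:: n] isT; rewrite big_seq1 => h.
rewrite leNgt; apply/negP => /(gt0_ltr_powR (lt_le_trans ltr01 p1)).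
by rewrite !nnegrE wmod_ge0 B0 => /(_ isT isT); rewrite ltNge h.
Qed.

Lemma FLle_add u v A B : FLle u A -> FLle v B -> FLle (fun n => u n + v n) (A + B).
Proof.
move=> uA vB.
pose x : coefs R := fun n => (normc (u n) + normc (v n))%:C.
apply: (@FLle_mono _ x).
  by move=> n; rewrite normc_real ger0_norm ?addr_ge0 ?normc_ge0// normc_triangle.
rewrite /FLle EFinD; apply: le_trans (leeD uA vB).
have := @eminkowski _ _ _ (@counting int R) (wmod u) (wmod v) r.
move=> /(_ (measurable_int _) (measurable_int _) hr).
apply: le_trans; apply: eq_ler.
apply: eq_Lnorm => n /=; congr EFin.
by rewrite expr0n addr0 sqrtr_sqr ger0_norm ?addr_ge0 ?normc_ge0// mulrDr.
Qed.

Lemma FLle_scale (c : R[i]) u B : FLle u B -> FLle (fun n => c * u n) (normc c * B).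
Proof.
move=> uB; have B0 := FLle_ge0 uB; have c0 := normc_ge0 c.
have e n : wmod (fun n => c * u n) n = normc c * wmod u n.
  by rewrite /wmod normc_mul mulrCA.
case: exponent_cases => [[p p1 rp]|rp].
  apply/(FLleP_fin _ p1 rp (mulr_ge0 c0 B0)) => F uF.
  under eq_bigr do rewrite e powRM// ?wmod_ge0//.
  rewrite -mulr_sumr powRM// ler_wpM2l ?powR_ge0//.
  exact: (proj1 (FLleP_fin _ p1 rp B0) uB F uF).
by apply/(FLleP_oo _ _ rp) => n; rewrite e ler_wpM2l//; exact: (proj1 (FLleP_oo _ _ rp) uB n).
Qed.

Lemma FLle0 : FLle (fun=> 0) 0.
Proof.
have e n : wmod (fun=> 0) n = 0 by rewrite /wmod normc0 mulr0.
case: exponent_cases => [[p p1 rp]|rp]; last by apply/(FLleP_oo _ _ rp) => n; rewrite e.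
apply/(FLleP_fin _ p1 rp (lexx _)) => F uF.
by rewrite big1 ?powR_ge0// => n _; rewrite e powR0// gt_eqF// (lt_le_trans _ p1).
Qed.

Lemma FLle_opp u B : FLle u B -> FLle (fun n => - u n) B.
Proof. by apply: FLle_mono => n; rewrite normc_opp. Qed.

Lemma FLle_sub u v A B : FLle u A -> FLle v B -> FLle (fun n => u n - v n) (A + B).
Proof. by move=> uA vB; apply: FLle_add => //; exact: FLle_opp. Qed.

Lemma FLle_sum (I : Type) (l : seq I) (P : pred I) (f : I -> coefs R) (b : I -> R) :
  (forall i, P i -> FLle (f i) (b i)) ->
  FLle (fun n => \sum_(i <- l | P i) f i n) (\sum_(i <- l | P i) b i).
Proof.
move=> fb; elim: l => [|i l IH].
  by rewrite big_nil; apply: FLle_mono FLle0 => n; rewrite big_nil.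
rewrite big_cons; case: ifPn => Pi.
  apply: FLle_mono (FLle_add (fb i Pi) IH) => n.
  by rewrite big_cons Pi.
by apply: FLle_mono IH => n; rewrite big_cons (negbTE Pi).
Qed.

Definition restr (F : seq int) u : coefs R := fun n => if n \in F then u n else 0.

(** Norm bounds need only be checked on truncations, where coefficientwise
    convergence implies convergence in norm. *)
Lemma FLle_restr u B : 0 <= B -> (forall F, uniq F -> FLle (restr F u) B) -> FLle u B.
Proof.
move=> B0 h.
have e F n : n \in F -> wmod (restr F u) n = wmod u n by rewrite /wmod /restr => ->.
case: exponent_cases => [[p p1 rp]|rp].
  apply/(FLleP_fin _ p1 rp B0) => F uF.
  apply: le_trans (proj1 (FLleP_fin _ p1 rp B0) (h F uF) F uF).
  by rewrite big_seq [leRHS]big_seq; apply: ler_sum => n nF; rewrite e.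
apply/(FLleP_oo _ _ rp) => n.
by have := proj1 (FLleP_oo _ _ rp) (h [:: n] isT) n; rewrite e// inE.
Qed.

Lemma FLle_single u n : FLle (restr [:: n] u) (wmod u n).
Proof.
have w0 := wmod_ge0 u n.
have e m : wmod (restr [:: n] u) m = if m == n then wmod u n else 0.
  by rewrite /wmod /restr inE; case: eqP => [->//|_]; rewrite normc0 mulr0.
case: exponent_cases => [[p p1 rp]|rp].
  apply/(FLleP_fin _ p1 rp w0) => F uF.
  have [nF|nF] := boolP (n \in F); last first.
    rewrite big_seq big1 ?powR_ge0// => m mF; rewrite e ifF ?powR0//.
      by rewrite gt_eqF// (lt_le_trans _ p1).
    by apply/negP => /eqP mn; rewrite -mn mF in nF.
  rewrite (bigD1_seq n)//= e eqxx big1 ?addr0// => m mn.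
  by rewrite e (negbTE mn) powR0// gt_eqF// (lt_le_trans _ p1).
by apply/(FLleP_oo _ _ rp) => m; rewrite e; case: ifP.
Qed.

Lemma FLle_fin_sum u (F : seq int) : uniq F -> FLle (restr F u) (\sum_(n <- F) wmod u n).
Proof.
move=> uF; apply: FLle_mono (FLle_sum F (fun n _ => FLle_single u n)) => m.
rewrite /restr; case: ifPn => mF; last by rewrite normc0 normc_ge0.
rewrite (bigD1_seq m)//= inE eqxx big1 ?addr0// => n nm.
by rewrite inE eq_sym (negbTE nm).
Qed.

(** Fatou's lemma: balls are closed for coefficientwise convergence. *)
Lemma FLle_lim (uj : nat -> coefs R) u B :
  (forall j, FLle (uj j) B) -> (forall n, ccvg (fun j => uj j n) (u n)) -> FLle u B.
Proof.
move=> ujB uju; have B0 := FLle_ge0 (ujB 0%N).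
apply: FLle_restr => // F uF.
rewrite /FLle; apply/lee_addgt0Pr => e e0.
have h : (\sum_(n <- F) wmod (fun n => uj j n - u n) n) @[j --> \oo] --> (0 : R).
  apply: (@cvg_sum0 R int F (fun n j => wmod (fun m => uj j m - u m) n)) => n; rewrite -(mulr0 (weight n)); apply: cvgM; first exact: cvg_cst.
  exact: uju.
move/cvgrPdist_lt : h => /(_ e e0) [J _ hJ].
have := hJ J (leqnn _); rewrite /= sub0r normrN ger0_norm; last first.
  by apply: sumr_ge0 => n _; exact: wmod_ge0.
move=> hJe; rewrite -EFinD -/(FLle _ _).
have h1 : FLle (restr F (uj J)) B.
  by apply: FLle_mono (ujB J) => n; rewrite /restr; case: ifP; rewrite ?normc0 ?normc_ge0.
apply: FLle_mono (FLle_sub h1 (FLle_le (ltW hJe) (FLle_fin_sum (fun n => uj J n - u n) uF))) => n.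
by rewrite /restr; case: ifP => _; rewrite ?subr0// opprB addrC subrK.
Qed.

End FourierLebesgue.

(** * The trilinear estimate in frequency *)

Section FiniteSums.
Variable R : realType.

Lemma ler_sum_inj (I J : eqType) (F : seq I) (P : pred I) (h : I -> J) (G : seq J)
    (f : J -> R) : uniq F -> uniq G -> (forall j, 0 <= f j) ->
  (forall i i', P i -> P i' -> i \in F -> i' \in F -> h i = h i' -> i = i') ->
  (forall i, P i -> i \in F -> h i \in G) ->
  \sum_(i <- F | P i) f (h i) <= \sum_(j <- G) f j.
Proof.
move=> uF uG f0 inj sub.
rewrite -big_filter -(big_map h xpredT f).
have um : uniq [seq h i | i <- F & P i].
  rewrite map_inj_in_uniq ?filter_uniq// => i i'; rewrite !mem_filter.
  by move=> /andP[Pi iF] /andP[Pi' iF']; exact: inj.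
have sm : {subset [seq h i | i <- F & P i] <= G}.
  by move=> j /mapP[x]; rewrite mem_filter => /andP[Px xF] ->; exact: sub.
have pm : perm_eq [seq h i | i <- F & P i] [seq j <- G | j \in [seq h i | i <- F & P i]].
  apply: uniq_perm => //; first exact: filter_uniq.
  by move=> j; rewrite mem_filter andb_idr//; exact: sm.
rewrite (perm_big _ pm)/=.
rewrite big_filter big_mkcond/=; apply: ler_sum => j _.
by case: ifP.
Qed.

(** Young's inequality applied after division by the bounds S and Y; since Y may
    vanish, the estimate is first proved for positive Z in its place. *)
Lemma finite_hoelder (I : Type) (F : seq I) (P : pred I) (m x : I -> R) (p q S Y : R) :
  0 < p -> 0 < q -> p^-1 + q^-1 = 1 -> 0 < S -> 0 <= Y ->
  (forall i, 0 <= m i) -> (forall i, 0 <= x i) ->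
  \sum_(i <- F | P i) m i `^ q <= S `^ q -> \sum_(i <- F | P i) x i `^ p <= Y `^ p ->
  \sum_(i <- F | P i) m i * x i <= S * Y.
Proof.
move=> p0 q0 pq S0 Y0 m0 x0 mS xY.
suff pos Z : 0 < Z -> \sum_(i <- F | P i) x i `^ p <= Z `^ p ->
    \sum_(i <- F | P i) m i * x i <= S * Z.
  move: Y0; rewrite le_eqVlt => /predU1P[Y0|Y0]; last exact: pos.
  rewrite -Y0 mulr0; apply/ler_addgt0Pl => e e0.
  rewrite addr0 -(divfK (lt0r_neq0 S0) e) mulrC; apply: pos; first exact: divr_gt0.
  by apply: le_trans xY _; rewrite -Y0 powR0 ?powR_ge0// gt_eqF.
move=> Z0 xZ.
have -> : \sum_(i <- F | P i) m i * x i =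
    S * Z * \sum_(i <- F | P i) (x i / Z) * (m i / S).
  rewrite mulr_sumr; apply: eq_bigr => i _.
  by field; rewrite !gt_eqF.
rewrite ger_pMr ?mulr_gt0//.
have norm (t y w : R) : 0 <= t -> 0 < y -> (t / y) `^ w = t `^ w / y `^ w.
  by move=> t0 y0; rewrite powRM ?invr_ge0 ?(ltW y0)// -powR_inv1 ?(ltW y0)// -powRrM mulN1r powRN.
apply: (@le_trans _ _ (\sum_(i <- F | P i) ((x i / Z) `^ p / p + (m i / S) `^ q / q))).
  by apply: ler_sum => i _; apply: conjugate_powR; rewrite ?divr_ge0 ?(ltW Z0) ?(ltW S0).
rewrite big_split/= -!mulr_suml -pq.
under eq_bigr do rewrite norm//.
under [X in _ + X / _]eq_bigr do rewrite norm//.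
rewrite -!mulr_suml; apply: lerD; rewrite -[leRHS]mul1r ler_wpM2r ?invr_ge0 ?(ltW p0) ?(ltW q0)//.
  by rewrite ler_pdivrMr ?powR_gt0// mul1r.
by rewrite ler_pdivrMr ?powR_gt0// mul1r.
Qed.

(** Convergence of the sum of (1+|a|)^-sigma over the integers, by
    grouping dyadic blocks. *)
Lemma sum_powR_nat (sigma : R) : 1 < sigma ->
  exists S : R, forall J : nat, \sum_(0 <= m < 2 ^ J) (1 + m%:R) `^ (- sigma) <= S.
Proof.
move=> s1; pose th : R := 2 `^ (1 - sigma).
have th0 : 0 <= th by exact: powR_ge0.
have th1 : th < 1.
  rewrite /th -opprB powRN invf_lt1 ?powR_gt0//.
  have : 1 `^ (sigma - 1) < 2 `^ (sigma - 1).
    by apply: gt0_ltr_powR; rewrite ?subr_gt0 ?nnegrE// ltr1n.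
  by rewrite powR1.
exists (1 + (1 - th)^-1) => J.
have bl j : \sum_(0 <= m < 2 ^ j) (1 + m%:R) `^ (- sigma) <= 1 + \sum_(0 <= i < j) th ^+ i.
  elim: j => [|j IH].
    by rewrite expn0 big_nat1 addr0 powR1 big_geq// addr0.
  rewrite (big_cat_nat _ (n := 2 ^ j))//=; last by rewrite leq_exp2l.
  rewrite big_nat_recr//= addrA; apply: lerD => //.
  apply: (@le_trans _ _ (\sum_(2 ^ j <= m < 2 ^ j.+1) (2 ^+ j) `^ (- sigma))).
    apply: ler_sum_nat => m /andP[jm _].
    rewrite !powRN lef_pV2 ?posrE ?powR_gt0 ?exprn_gt0 ?ltr_pwDl//.
    apply: ge0_ler_powR; rewrite ?nnegrE ?exprn_ge0 ?addr_ge0//; first by lra.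
    by rewrite -natrX (le_trans _ (ler_wpDl _ (lexx _)))// ler_nat.
  rewrite sumr_const_nat expnS mul2n -addnn addnK.
  rewrite /th -(@powR_mulrn _ (2 `^ _)) ?powR_ge0// -powRrM mulrBl mul1r.
  rewrite -[leLHS]mulr_natr natrX -!powR_mulrn// -powRrM mulrC -powRD; last by rewrite pnatr_eq0 implybT.
  by rewrite mulrN mulrC.
apply: le_trans (bl J) _; rewrite lerD2l.
have : (1 - th) * \sum_(0 <= i < J) th ^+ i = 1 - th ^+ J.
  by rewrite big_mkord -[1 - th]opprB mulNr -subrX1 opprB.
move=> e; rewrite -[leRHS]mul1r ler_pdivlMr ?subr_gt0// mulrC e.
by rewrite gerBl exprn_ge0.
Qed.

(** Comparable to the Japanese bracket, and easier to sum over dyadic blocks. *)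
Definition bracket (a : int) : R := 1 + `|a|%N%:R.

Lemma bracket_ge1 a : 1 <= bracket a. Proof. by rewrite lerDl. Qed.

Lemma sum_bracket (sigma : R) : 1 < sigma ->
  exists2 S : R, 0 < S & forall F : seq int, uniq F ->
    \sum_(a <- F) bracket a `^ (- sigma) <= S.
Proof.
move=> /sum_powR_nat[S0 hS0].
have S00 : 0 <= S0.
  by apply: le_trans (hS0 0%N); apply: sumr_ge0 => m _; exact: powR_ge0.
exists (S0 + S0 + 1) => [|F uF]; first by rewrite ltr_wpDl// addr_ge0.
pose N := \max_(a <- F) `|a|%N.
have part (P : pred int) : (forall a a', P a -> P a' -> `|a|%N = `|a'|%N -> a = a') ->
    \sum_(a <- F | P a) bracket a `^ (- sigma) <= S0.
  move=> inj; apply: le_trans (hS0 N).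
  rewrite /index_iota subn0.
  apply: (@ler_sum_inj _ _ F P absz (iota 0 (2 ^ N)) (fun m => (1 + m%:R) `^ (- sigma))) => //.
  - exact: iota_uniq.
  - by move=> a a' Pa Pa' _ _; exact: inj.
  - move=> a Pa aF; rewrite mem_iota/= add0n; apply: leq_ltn_trans (ltn_expl N (ltnSn 1)).
    exact: (@leq_bigmax_seq _ _ xpredT (fun a => `|a|%N)).
rewrite (bigID (fun a : int => 0 <= a))/= ler_wpDr//.
apply: lerD; apply: part => a a'; first by case: a a' => [a|a] [a'|a'] //= _ _ ->.
by case: a a' => [a|a] [a'|a'] //= _ _ [->].
Qed.

End FiniteSums.

Section Trilinear.
Variables (R : realType) (s : R) (r : \bar R) (rho : R).
Hypotheses (hs : 0 <= s) (hr : (1 <= r)%E)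
  (hrho : ((hoelder_conjugate r)^-1 < rho%:E)%E).
Implicit Types (n : int) (k : int * int * int).

(** The frequency with which the triple oscillates in W_t once the linear
    evolution is removed from the four factors. *)
Definition phase k : R := k.1.1%:~R ^+ 2 - k.1.2%:~R ^+ 2 + k.2%:~R ^+ 2
  - (k.1.1 - k.1.2 + k.2)%:~R ^+ 2.

(** The triples that feed frequency n in the Wick-ordered nonlinearity: the
    nonresonant ones, and (n, n, n), for which the phase vanishes. *)
Definition interacts n k := (k.1.1 - k.1.2 + k.2 == n) &&
  ((k.1.2 != k.1.1) && (k.1.2 != k.2) || (k.1.2 == k.1.1) && (k.1.2 == k.2)).

Definition decay k : R := japanese (phase k) `^ (- rho).

Lemma decay_ge0 k : 0 <= decay k. Proof. exact: powR_ge0. Qed.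

(** The condition rho > 1/r' without extended-real conjugate exponents. *)
Lemma rho_conj : (r = +oo%E /\ 1 < rho) \/
  exists2 p : R, 1 <= p & r = p%:E /\ 1 - p^-1 < rho.
Proof.
have [[p p1 rp]|rp] := exponent_cases hr; [right|left].
  exists p => //; split => //.
  have p0 : p != 0 by rewrite gt_eqF// (lt_le_trans _ p1).
  have := @hoelder_conjugate_eq1 R r; rewrite rp ltNyr eqe => /(_ isT p0) e.
  rewrite -lte_fin; apply: le_lt_trans hrho; rewrite rp.
  move: e; rewrite inver (negbTE p0).
  case: ((hoelder_conjugate p%:E)^-1)%E => [x| |] //=; rewrite -?EFinD ?lee_fin ?leey//.
  by move=> [] <-; rewrite addrAC subrr add0r.
split => //; move: hrho; rewrite rp hoelder_conjugatey inve1 lte_fin.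
by [].
Qed.

Lemma rho_gt0 : 0 < rho.
Proof.
have [[_]|[p p1 [_]]] := rho_conj; first exact: lt_trans.
apply: le_lt_trans; rewrite subr_ge0 invf_le1// (lt_le_trans _ p1)//.
Qed.

Lemma phaseE k : phase k = - 2 * (k.1.1 - k.1.2)%:~R * (k.2 - k.1.2)%:~R.
Proof. by rewrite /phase !intrD !rmorphN/=; ring. Qed.

(** The resonance function factorizes, so that the decay of the local time in
    frequency is a product of decays in two independent frequencies. *)
Lemma decay_le n k : interacts n k ->
  decay k <= 2 `^ rho * (bracket R (k.1.1 - k.1.2) `^ (- rho) * bracket R (k.2 - k.1.2) `^ (- rho)).
Proof.
have r0 := rho_gt0; move=> /andP[_ hk].
set a := k.1.1 - k.1.2; set b := k.2 - k.1.2.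
have ab1 : 1 <= bracket R a by exact: bracket_ge1.
have bb1 : 1 <= bracket R b by exact: bracket_ge1.
rewrite -powRM ?(le_trans ler01)// /decay !powRN.
have h : bracket R a * bracket R b <= 2 * japanese (phase k).
  have [j1 ja] := (japanese_ge1 (phase k), japanese_ge_abs (phase k)).
  case/orP: hk => /andP[]; last first.
    move=> /eqP e1 /eqP e2; rewrite /a /b -e1 -e2 !subrr /bracket/=.
    by rewrite addr0 mulr1; lra.
  move=> e1 e2.
  have a0 : (1 <= `|a|%N)%N by rewrite absz_gt0 subr_eq0 eq_sym.
  have b0 : (1 <= `|b|%N)%N by rewrite absz_gt0 subr_eq0 eq_sym.
  have : `|phase k| = 2 * `|a|%N%:R * `|b|%N%:R.
    rewrite phaseE !normrM normrN normr_nat -/a -/b.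
    by rewrite !natr_absz -!intr_norm.
  rewrite /bracket; move: a0 b0; rewrite -(@ler_nat R) -(@ler_nat R 1).
  nra.
have j0 : 0 < japanese (phase k) by rewrite (lt_le_trans ltr01)// japanese_ge1.
have B0 : 0 < bracket R a * bracket R b by rewrite mulr_gt0// (lt_le_trans ltr01).
rewrite ler_pdivlMr ?powR_gt0// mulrC ler_pdivrMr ?powR_gt0//.
rewrite -powRM// ?(ltW j0)//; apply: ge0_ler_powR; rewrite ?nnegrE ?mulr_ge0 ?(ltW r0) ?(ltW j0) ?(ltW B0)//; exact: le_trans ler01 _.
Qed.

Lemma decay_le1 k : decay k <= 1.
Proof.
rewrite /decay -(powRr0 (japanese (phase k))).
by apply: (ler_powR (japanese_ge1 _)); rewrite oppr_le0 ltW// rho_gt0.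
Qed.

(** A triple with a given output is determined by the two differences
    n1 - n2 and n3 - n2, so that the sum is at most a product of two sums over Z,
    which converge because rho q > 1. *)
Lemma sum_decay (q : R) : 0 <= q -> 1 < rho * q ->
  exists2 S : R, 0 < S & forall n (F : seq (int * int * int)), uniq F ->
    \sum_(k <- F | interacts n k) decay k `^ q <= S `^ q.
Proof.
move=> q0 rq; have [S S0 hS] := sum_bracket rq.
have q1 : 0 < q by rewrite lt_neqAle q0 andbT; apply: contraTneq rq => <-; rewrite mulr0 ltr10.
exists (2 `^ rho * (S * S) `^ q^-1); first by rewrite mulr_gt0// powR_gt0// mulr_gt0.
move=> n F uF; rewrite powRM ?powR_ge0// -(powRrM (S * S)) mulVf ?gt_eqF// powRr1; last by rewrite mulr_ge0// ltW.
pose t a : R := bracket R a `^ (- (rho * q)).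
pose h (k : int * int * int) := (k.1.1 - k.1.2, k.2 - k.1.2).
apply: (@le_trans _ _ (\sum_(k <- F | interacts n k) (2 `^ rho) `^ q * (t (h k).1 * t (h k).2))).
  apply: ler_sum => k nk.
  apply: (@le_trans _ _ ((2 `^ rho * (bracket R (h k).1 `^ (- rho) * bracket R (h k).2 `^ (- rho))) `^ q)).
    apply: ge0_ler_powR; rewrite ?nnegrE ?decay_ge0 ?mulr_ge0 ?powR_ge0//.
    exact: decay_le nk.
  by rewrite !powRM ?mulr_ge0 ?powR_ge0// -!powRrM !mulNr.
rewrite -mulr_sumr ler_wpM2l ?powR_ge0//.
pose A := undup [seq (h k).1 | k <- F]; pose B := undup [seq (h k).2 | k <- F].
apply: (@le_trans _ _ (\sum_(x <- [seq (a, b) | a <- A, b <- B]) t x.1 * t x.2)).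
  apply: (@ler_sum_inj _ _ _ F (interacts n) h _ (fun x => t x.1 * t x.2)) => //.
  - by apply: allpairs_uniq; rewrite ?undup_uniq// => -[? ?] [? ?] _ _ [-> ->].
  - by move=> x; rewrite mulr_ge0// powR_ge0.
  - move=> [[a b] c] [[a' b'] c'] /andP[/eqP/= e _] /andP[/eqP/= e' _] _ _ [].
    move=> /= h1 h2; have hb : b = b'.
      have : n - (a - b) - (c - b) = b by rewrite -e; ring.
      by rewrite h1 h2 -e' => <-; ring.
    by move: h1 h2; rewrite hb => /addIr -> /addIr ->.
  - move=> k _ kF; apply/allpairsP; exists (h k).
    by rewrite !mem_undup; split => //; [apply: (map_f (fun k => (h k).1))|apply: (map_f (fun k => (h k).2))].
rewrite big_allpairs/=.
under eq_bigr do rewrite -mulr_sumr.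
rewrite -mulr_suml; apply: ler_pM; rewrite ?hS ?undup_uniq// sumr_ge0// => a _; exact: powR_ge0.
Qed.

(** Each triple feeds a single frequency. *)
Lemma sum_unique_output (X : seq int) (F : seq (int * int * int)) (x : int * int * int -> R) :
  uniq X -> (forall k, 0 <= x k) ->
  \sum_(n <- X) \sum_(k <- F | interacts n k) x k <= \sum_(k <- F) x k.
Proof.
move=> uX x0; under eq_bigr do rewrite big_mkcond/=.
rewrite exchange_big/=; apply: ler_sum => k _.
pose nk := k.1.1 - k.1.2 + k.2.
apply: (@le_trans _ _ (\sum_(n <- X) if n == nk then x k else 0)).
  apply: ler_sum => n _; rewrite /interacts eq_sym -/nk; case: eqP => //= _.
  by case: ifP.
rewrite -big_mkcond/=; have [kX|kX] := boolP (nk \in X).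
  by rewrite -big_filter filter_pred1_uniq// big_seq1.
by rewrite big_seq_cond big1// => n /andP[nX /eqP e]; rewrite -e nX in kX.
Qed.

Lemma sum_triple_product (F : seq (int * int * int)) (f g h : int -> R) (A B D : R) :
  uniq F -> (forall n, 0 <= f n) -> (forall n, 0 <= g n) -> (forall n, 0 <= h n) ->
  (forall X, uniq X -> \sum_(n <- X) f n <= A) ->
  (forall X, uniq X -> \sum_(n <- X) g n <= B) ->
  (forall X, uniq X -> \sum_(n <- X) h n <= D) ->
  \sum_(k <- F) f k.1.1 * g k.1.2 * h k.2 <= A * B * D.
Proof.
move=> uF f0 g0 h0 fA gB hD.
pose X1 := undup [seq k.1.1 | k : int * int * int <- F].
pose X2 := undup [seq k.1.2 | k : int * int * int <- F].
pose X3 := undup [seq k.2 | k : int * int * int <- F].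
apply: (@le_trans _ _ (\sum_(x <- [seq (ab, c) | ab <- [seq (a, b) | a <- X1, b <- X2], c <- X3])
   f x.1.1 * g x.1.2 * h x.2)).
  apply: (@ler_sum_inj _ _ _ F xpredT id _ (fun x => f x.1.1 * g x.1.2 * h x.2)) => //.
  - apply: allpairs_uniq; [|exact: undup_uniq|by move=> [? ?] [? ?] _ _ [-> ->]].
    by apply: allpairs_uniq; rewrite ?undup_uniq// => -[? ?] [? ?] _ _ [-> ->].
  - by move=> x; rewrite !mulr_ge0.
  - move=> [[a b] c] _ kF; apply/allpairsP; exists ((a, b), c) => /=; split => //.
      apply/allpairsP; exists (a, b); rewrite !mem_undup; split => //.
        exact: (map_f (fun k : int * int * int => k.1.1) kF).
      exact: (map_f (fun k : int * int * int => k.1.2) kF).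
    by rewrite mem_undup; exact: (map_f (fun k : int * int * int => k.2) kF).
rewrite !big_allpairs/=.
under eq_bigr do under eq_bigr do rewrite -mulr_sumr.
under eq_bigr do rewrite -mulr_suml -mulr_sumr.
rewrite -!mulr_suml; apply: ler_pM; rewrite ?hD ?undup_uniq ?mulr_ge0 ?sumr_ge0//.
by apply: ler_pM; rewrite ?fA ?gB ?undup_uniq ?sumr_ge0.
Qed.

(** The trilinear form with all moduli inside, over a finite set F of triples:
    bounds uniform in F then imply absolute convergence of the full sum. *)
Definition trisum (F : seq (int * int * int)) (f g h : coefs R) : coefs R := fun n =>
  (\sum_(k <- F | interacts n k)
     decay k * (normc (f k.1.1) * normc (g k.1.2) * normc (h k.2)))%:C.

Lemma wmod_trisum F f g h n : wmod s (trisum F f g h) n <=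
  4 `^ s * \sum_(k <- F | interacts n k)
     decay k * (wmod s f k.1.1 * wmod s g k.1.2 * wmod s h k.2).
Proof.
rewrite /wmod /trisum normc_real ger0_norm; last first.
  by apply: sumr_ge0 => k _; rewrite !mulr_ge0 ?decay_ge0 ?normc_ge0.
rewrite !mulr_sumr; apply: ler_sum => k /andP[/eqP <- _].
have := weight_tri hs k.1.1 k.1.2 k.2.
set w := weight _ _; set w1 := weight _ _; set w2 := weight _ _; set w3 := weight _ _ => hw.
have -> : 4 `^ s * (decay k * (w1 * normc (f k.1.1) * (w2 * normc (g k.1.2)) * (w3 * normc (h k.2)))) =
  4 `^ s * (w1 * w2 * w3) * (decay k * (normc (f k.1.1) * normc (g k.1.2) * normc (h k.2))).
  by ring.
by rewrite ler_wpM2r// !mulr_ge0 ?decay_ge0 ?normc_ge0.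
Qed.

(** Hoelder's inequality in the two free frequencies: the decay is
    $\ell^{r'}$-summable over the triples with a given output because
    rho > 1/r', and a sum of r-th powers over all triples factorizes. *)
Lemma FLle_trisum : exists2 C : R, 0 <= C &
  forall F f g h A B D, uniq F -> FLle s r f A -> FLle s r g B -> FLle s r h D ->
    FLle s r (trisum F f g h) (C * (A * B * D)).
Proof.
have w0 (u : coefs R) n := wmod_ge0 s u n.
have [[rp rho1]|[p p1 [rp prho]]] := rho_conj.
  have [S S0 hS] := @sum_decay 1 ler01 ltac:(by rewrite mulr1).
  exists (4 `^ s * S) => [|F f g h A B D uF fA gB hD]; first by rewrite mulr_ge0 ?powR_ge0 ?(ltW S0).
  apply/(FLleP_oo _ _ _ rp) => n; apply: le_trans (wmod_trisum _ _ _ _ _) _.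
  rewrite -mulrA ler_wpM2l ?powR_ge0//.
  apply: (@le_trans _ _ (\sum_(k <- F | interacts n k) decay k * (A * B * D))).
    apply: ler_sum => k _; rewrite ler_wpM2l ?decay_ge0//.
    have [[a b] d] := (proj1 (FLleP_oo _ _ _ rp) fA k.1.1, proj1 (FLleP_oo _ _ _ rp) gB k.1.2, proj1 (FLleP_oo _ _ _ rp) hD k.2).
    by apply: ler_pM => //; [exact: mulr_ge0|apply: ler_pM].
  rewrite -mulr_suml ler_wpM2r ?mulr_ge0 ?(FLle_ge0 fA) ?(FLle_ge0 gB) ?(FLle_ge0 hD)//.
  have := hS n F uF; rewrite powRr1 ?(ltW S0)//; apply: le_trans.
  by apply: ler_sum => k _; rewrite powRr1// decay_ge0.
have p0 : 0 < p by exact: lt_le_trans p1.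
have key : exists2 S : R, 0 < S & forall n F (x : int * int * int -> R), uniq F -> (forall k, 0 <= x k) ->
    (\sum_(k <- F | interacts n k) decay k * x k) `^ p <=
    S `^ p * \sum_(k <- F | interacts n k) x k `^ p.
  (* for p = 1 the conjugate exponent is infinite; there decay <= 1 suffices *)
  move: p1; rewrite le_eqVlt => /predU1P[p1|p1].
    exists 1 => // n F x uF x0; rewrite -p1 powR1 mul1r powRr1; last first.
      by apply: sumr_ge0 => k _; rewrite mulr_ge0 ?decay_ge0.
    by apply: ler_sum => k _; rewrite powRr1// ler_piMl// decay_le1.
  pose q := (1 - p^-1)^-1.
  have pq0 : 0 < 1 - p^-1 by rewrite subr_gt0 invf_lt1.
  have q0 : 0 < q by rewrite invr_gt0.
  have [S S0 hS] := @sum_decay q (ltW q0) ltac:(by rewrite ltr_pdivlMr// mul1r).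
  exists S => // n F x uF x0.
  set Y := \sum_(k <- F | interacts n k) x k `^ p.
  have Y0 : 0 <= Y by apply: sumr_ge0 => k _; exact: powR_ge0.
  have YY : (Y `^ p^-1) `^ p = Y by rewrite -powRrM mulVf ?gt_eqF// powRr1.
  rewrite -[X in _ <= _ * X]YY -powRM ?powR_ge0 ?(ltW S0)//.
  apply: ge0_ler_powR; rewrite ?nnegrE ?(ltW p0) ?mulr_ge0 ?powR_ge0 ?(ltW S0)//.
    by apply: sumr_ge0 => k _; rewrite mulr_ge0 ?decay_ge0.
  apply: (@finite_hoelder _ _ _ _ _ _ p q) => //.
  - by rewrite /q invrK addrC subrK.
  - exact: powR_ge0.
  - exact: decay_ge0.
  - exact: hS.
  - by rewrite YY.
have [S S0 hS] := key.
exists (4 `^ s * S) => [|F f g h A B D uF fA gB hD]; first by rewrite mulr_ge0 ?powR_ge0 ?(ltW S0).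
have [[A0 B0] D0] := (FLle_ge0 fA, FLle_ge0 gB, FLle_ge0 hD).
have C0 : 0 <= 4 `^ s * S * (A * B * D) by rewrite !mulr_ge0 ?powR_ge0 ?(ltW S0).
apply/(FLleP_fin _ _ p1 rp C0) => X uX.
pose x k := wmod s f k.1.1 * wmod s g k.1.2 * wmod s h k.2.
have x0 k : 0 <= x k by rewrite /x; apply: mulr_ge0; first apply: mulr_ge0; exact: w0.
apply: (@le_trans _ _ ((4 `^ s * S) `^ p * \sum_(k <- F) x k `^ p)).
  apply: (@le_trans _ _ (\sum_(n <- X) (4 `^ s * S) `^ p * \sum_(k <- F | interacts n k) x k `^ p)).
    apply: ler_sum => n _; rewrite powRM ?powR_ge0 ?(ltW S0)// -mulrA.
    apply: (@le_trans _ _ ((4 `^ s * \sum_(k <- F | interacts n k) decay k * x k) `^ p)).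
      apply: ge0_ler_powR; rewrite ?nnegrE ?(ltW p0)//; last exact: wmod_trisum.
      by rewrite mulr_ge0 ?powR_ge0// sumr_ge0// => k _; rewrite mulr_ge0 ?decay_ge0.
    rewrite powRM ?powR_ge0//; last by rewrite sumr_ge0// => k _; rewrite mulr_ge0 ?decay_ge0.
    by rewrite ler_wpM2l ?powR_ge0// hS.
  rewrite -mulr_sumr ler_wpM2l ?powR_ge0//.
  by apply: sum_unique_output => // k; exact: powR_ge0.
rewrite [leRHS]powRM ?mulr_ge0 ?powR_ge0 ?(ltW S0)// ler_wpM2l ?powR_ge0//.
rewrite !powRM ?mulr_ge0//.
have -> : \sum_(k <- F) x k `^ p =
   \sum_(k <- F) wmod s f k.1.1 `^ p * wmod s g k.1.2 `^ p * wmod s h k.2 `^ p.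
  by apply: eq_bigr => k _; rewrite /x (powRM _ (mulr_ge0 (w0 _ _) (w0 _ _)) (w0 _ _)) (powRM _ (w0 _ _) (w0 _ _)).
apply: (@sum_triple_product F (fun n => wmod s f n `^ p) (fun n => wmod s g n `^ p) (fun n => wmod s h n `^ p)) => //.
- by move=> n; exact: powR_ge0.
- by move=> n; exact: powR_ge0.
- by move=> n; exact: powR_ge0.
- exact: (proj1 (FLleP_fin _ _ p1 rp A0) fA).
- exact: (proj1 (FLleP_fin _ _ p1 rp B0) gB).
- exact: (proj1 (FLleP_fin _ _ p1 rp D0) hD).
Qed.

End Trilinear.

(** * Integrals of bounded complex functions *)

Section ComplexIntegral.
Variable R : realType.
Local Notation leb := (@lebesgue_measure R).
Implicit Types (D : set R) (f g : R -> R[i]).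

(** Bounded measurable functions are integrable on sets of finite measure and,
    unlike integrable ones, stable under products. *)
Definition bmeas D f := [/\ measurable_fun D (fun x => complex.Re (f x)),
  measurable_fun D (fun x => complex.Im (f x)) &
  exists M, forall x, D x -> normc (f x) <= M].

Lemma eq_bmeas D f g : (forall x, D x -> f x = g x) -> bmeas D f -> bmeas D g.
Proof.
move=> fg [mR mI [M fM]]; split.
- by apply: eq_measurable_fun mR => x /set_mem Dx; rewrite fg.
- by apply: eq_measurable_fun mI => x /set_mem Dx; rewrite fg.
- by exists M => x Dx; rewrite -fg// fM.
Qed.

Lemma bmeasS D D' f : measurable D -> D' `<=` D -> bmeas D f -> bmeas D' f.
Proof.
move=> mD DD [mR mI [M fM]]; split; [exact: measurable_funS mR|exact: measurable_funS mI|].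
by exists M => x /DD; exact: fM.
Qed.

Lemma bmeas_cst D c : bmeas D (fun=> c).
Proof. by split; [exact: measurable_cst|exact: measurable_cst|exists (normc c)]. Qed.

Lemma bmeasD D f g : bmeas D f -> bmeas D g -> bmeas D (fun x => f x + g x).
Proof.
move=> [fR fI [M fM]] [gR gI [M' gM]]; split.
- rewrite (_ : (fun x => _) = (fun x => complex.Re (f x)) \+ (fun x => complex.Re (g x))).
    exact: measurable_funD.
  by apply/funext => x /=; case: (f x) (g x) => ? ? [].
- rewrite (_ : (fun x => _) = (fun x => complex.Im (f x)) \+ (fun x => complex.Im (g x))).
    exact: measurable_funD.
  by apply/funext => x /=; case: (f x) (g x) => ? ? [].
- by exists (M + M') => x Dx; rewrite (le_trans (normc_triangle _ _))// lerD ?fM ?gM.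
Qed.

Lemma bmeasM D f g : bmeas D f -> bmeas D g -> bmeas D (fun x => f x * g x).
Proof.
move=> [fR fI [M fM]] [gR gI [M' gM]]; split.
- rewrite (_ : (fun x => _) = ((fun x => complex.Re (f x)) \* (fun x => complex.Re (g x)))
      \- ((fun x => complex.Im (f x)) \* (fun x => complex.Im (g x)))).
    by apply: measurable_funB; exact: measurable_funM.
  by apply/funext => x /=; case: (f x) (g x) => ? ? [].
- rewrite (_ : (fun x => _) = ((fun x => complex.Re (f x)) \* (fun x => complex.Im (g x)))
      \+ ((fun x => complex.Im (f x)) \* (fun x => complex.Re (g x)))).
    by apply: measurable_funD; exact: measurable_funM.
  by apply/funext => x /=; case: (f x) (g x) => ? ? [].
- exists (M * M') => x Dx; rewrite normc_mul.
  by apply: ler_pM; rewrite ?normc_ge0 ?fM ?gM.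
Qed.

Lemma bmeas_sum D (I : Type) (l : seq I) (f : I -> R -> R[i]) :
  (forall i, bmeas D (f i)) -> bmeas D (fun x => \sum_(i <- l) f i x).
Proof.
move=> hf; elim: l => [|i l IH].
  by apply: eq_bmeas (bmeas_cst D 0) => x _; rewrite big_nil.
by apply: eq_bmeas (bmeasD (hf i) IH) => x _; rewrite big_cons.
Qed.

Lemma bmeas_conj D f : bmeas D f -> bmeas D (fun x => conjc (f x)).
Proof.
move=> [fR fI [M fM]]; split.
- by rewrite (_ : (fun x => _) = (fun x => complex.Re (f x)))//; apply/funext => x; case: (f x).
- rewrite (_ : (fun x => _) = \- (fun x => complex.Im (f x))); last by apply/funext => x /=; case: (f x).
  exact: measurable_funN.
- by exists M => x Dx; rewrite normc_conj fM.
Qed.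

Lemma bmeas_indic D (A : set R) : measurable A -> bmeas D (fun x => (\1_A x : R)%:C).
Proof.
move=> mA; split => [/=|/=|]; [exact: measurable_indic|exact: measurable_cst|].
by exists 1 => x _; rewrite normc_real indicE; case: (_ \in _); rewrite ?normr1 ?normr0.
Qed.

Lemma bmeas_expi D (th : R -> R) : continuous th -> bmeas D (fun x => expi (th x)).
Proof.
move=> cth; split => [/=|/=|].
- apply: measurable_funTS; apply: continuous_measurable_fun => x.
  by apply: continuous_comp; [exact: cth|exact: continuous_cos].
- apply: measurable_funTS; apply: continuous_measurable_fun => x.
  by apply: continuous_comp; [exact: cth|exact: continuous_sin].
- by exists 1 => x _; rewrite normc_expi.
Qed.

Lemma bmeas_lim D (fj : nat -> R -> R[i]) f M : measurable D -> (forall j, bmeas D (fj j)) ->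
  (forall x, D x -> ccvg (fj ^~ x) (f x)) -> (forall x, D x -> normc (f x) <= M) -> bmeas D f.
Proof.
move=> mD mf fjf fM; split; last by exists M.
- apply: (measurable_fun_cvg (h := fun j x => complex.Re (fj j x))) => //.
    by move=> j; case: (mf j).
  by move=> x Dx; apply: ccvg_Re; exact: fjf.
- apply: (measurable_fun_cvg (h := fun j x => complex.Im (fj j x))) => //.
    by move=> j; case: (mf j).
  by move=> x Dx; apply: ccvg_Im; exact: fjf.
Qed.

Section FiniteDomain.
Variable D : set R.
Hypotheses (mD : measurable D) (fD : (leb D < +oo)%E).

Lemma bounded_integrable (h : R -> R) M : measurable_fun D h ->
  (forall x, D x -> `|h x| <= M) -> leb.-integrable D (EFin \o h).
Proof.
move=> mh hM; apply: measurable_bounded_integrable => //.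
exists M; split; first exact: num_real.
by move=> y My x Dx /=; rewrite (le_trans (hM x Dx))// ltW.
Qed.

Lemma bmeas_integrable f : bmeas D f ->
  leb.-integrable D (EFin \o (fun x => complex.Re (f x))) /\
  leb.-integrable D (EFin \o (fun x => complex.Im (f x))).
Proof.
move=> [fR fI [M fM]]; split; apply: (@bounded_integrable _ M) => // x Dx.
- by rewrite (le_trans (Re_le_normc _))// fM.
- by rewrite (le_trans (Im_le_normc _))// fM.
Qed.

Lemma eq_cintegral f g : (forall x, D x -> f x = g x) -> cintegral D f = cintegral D g.
Proof.
by move=> fg; rewrite /cintegral; congr (_ +i* _); apply: eq_Rintegral => x /set_mem Dx; rewrite fg.
Qed.

Lemma cintegralD f g : bmeas D f -> bmeas D g ->
  cintegral D (fun x => f x + g x) = cintegral D f + cintegral D g.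
Proof.
move=> /bmeas_integrable[fR fI] /bmeas_integrable[gR gI].
rewrite /cintegral -[RHS]/(_ +i* _); congr (_ +i* _).
  rewrite -RintegralD//; apply: eq_Rintegral => x _.
  by case: (f x) (g x) => ? ? [].
rewrite -RintegralD//; apply: eq_Rintegral => x _.
by case: (f x) (g x) => ? ? [].
Qed.

Lemma cintegralZ (c : R[i]) f : bmeas D f ->
  cintegral D (fun x => c * f x) = c * cintegral D f.
Proof.
move=> /bmeas_integrable[fR fI]; case: c => a b.
rewrite /cintegral -[RHS]/(_ +i* _).
have h (c : R) (g : R -> R) : leb.-integrable D (EFin \o g) ->
    leb.-integrable D (EFin \o (fun x => c * g x)).
  move=> ig; rewrite (_ : _ \o _ = (fun x => c%:E * (EFin \o g) x)%E); last by apply/funext.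
  exact: integrableZl.
congr (_ +i* _); rewrite -!RintegralZl//.
  rewrite -RintegralB//; [|exact: h|exact: h].
  by apply: eq_Rintegral => x _; case: (f x).
rewrite -RintegralD//; [|exact: h|exact: h].
by apply: eq_Rintegral => x _; case: (f x).
Qed.

Lemma cintegral_sum (I : Type) (l : seq I) (f : I -> R -> R[i]) :
  (forall i, bmeas D (f i)) ->
  cintegral D (fun x => \sum_(i <- l) f i x) = \sum_(i <- l) cintegral D (f i).
Proof.
move=> hf; elim: l => [|i l IH].
  rewrite big_nil; transitivity (0 * cintegral D (fun=> 0)); last by rewrite mul0r.
  rewrite -cintegralZ; last exact: bmeas_cst.
  by apply: eq_cintegral => x _; rewrite big_nil mul0r.
rewrite big_cons -IH -cintegralD//; last exact: bmeas_sum.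
by apply: eq_cintegral => x _; rewrite big_cons.
Qed.

(** Bounded convergence. *)
Lemma cintegral_cvg (fj : nat -> R -> R[i]) f M : (forall j, bmeas D (fj j)) ->
  (forall j x, D x -> normc (fj j x) <= M) ->
  (forall x, D x -> ccvg (fj ^~ x) (f x)) ->
  ccvg (fun j => cintegral D (fj j)) (cintegral D f).
Proof.
move=> mf fM fjf.
have gen (gj : nat -> R -> R) (g : R -> R) : (forall j, measurable_fun D (gj j)) ->
    (forall j x, D x -> `|gj j x| <= M) ->
    (forall x, D x -> gj j x @[j --> \oo] --> g x) ->
    (\int[leb]_(x in D) gj j x) @[j --> \oo] --> \int[leb]_(x in D) g x.
  move=> mg gM gg.
  have gle x : D x -> `|g x| <= M.
    move=> Dx; apply: (cvgr_to_le (cvg_norm (gg x Dx))).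
    by apply: nearW => j; exact: gM.
  have ig : leb.-integrable D (EFin \o g).
    by apply: (bounded_integrable (M := M)) => //; exact: (measurable_fun_cvg (h := gj)).
  apply: fine_cvg; rewrite fineK; last exact: integrable_fin_num.
  apply: (@dominated_cvg _ _ _ leb D mD (fun j => EFin \o gj j) (EFin \o g) (cst M%:E)) => //.
  - by move=> j; apply/measurable_EFinP; exact: mg.
  - by move=> x Dx; apply: cvg_EFin; [exact: nearW|exact: gg].
  - by apply: (bounded_integrable (h := cst M) (M := `|M|)) => //; exact: measurable_cst.
apply: ccvg_ReIm => /=; apply: gen.
- by move=> j; case: (mf j).
- by move=> j x Dx; rewrite (le_trans (Re_le_normc _))// fM.
- by move=> x Dx; apply: ccvg_Re; exact: fjf.
- by move=> j; case: (mf j).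
- by move=> j x Dx; rewrite (le_trans (Im_le_normc _))// fM.
- by move=> x Dx; apply: ccvg_Im; exact: fjf.
Qed.

End FiniteDomain.

Lemma leb_itv_lty (b1 b2 : bool) (x y : R) : (leb [set` Interval (BSide b1 x) (BSide b2 y)] < +oo)%E.
Proof. by rewrite lebesgue_measure_itv/=; case: ifPn => // _; rewrite -EFinB ltry. Qed.

Lemma cintegral_split f (x y z : R) : x <= y -> y <= z -> bmeas `[x, z[ f ->
  cintegral `[x, z[ f = cintegral `[x, y[ f + cintegral `[y, z[ f.
Proof.
move=> xy yz fm.
have e : `[x, z[%classic = `[x, y[%classic `|` `[y, z[%classic.
  by rewrite -itv_bndbnd_setU// bnd_simp.
have [iR iI] := bmeas_integrable (measurable_itv _) (leb_itv_lty _ _ _ _) fm.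
have dis : [disjoint `[x, y[%classic & `[y, z[%classic].
  apply/disj_setPS => t []/=; rewrite !in_itv/= => /andP[_ ty] /andP[yt _].
  by move: ty; rewrite ltNge yt.
rewrite /cintegral -[RHS]/(_ +i* _) e; congr (_ +i* _).
  by rewrite Rintegral_setU// -e.
by rewrite Rintegral_setU// -e.
Qed.

Lemma cintegral_closed f (x y : R) : bmeas `[x, y] f ->
  cintegral `[x, y] f = cintegral `[x, y[ f.
Proof.
move=> fm; have fm' : bmeas `[x, y[ f.
  by apply: bmeasS fm => // t /=; rewrite !in_itv/= => /andP[-> /ltW ->].
have [iR iI] := bmeas_integrable (measurable_itv _) (leb_itv_lty _ _ _ _) fm'.
by rewrite /cintegral; congr (_ +i* _); rewrite Rintegral_itv_bndo_bndc.
Qed.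

(** Projection onto the interval [x, y], used to intersect time intervals. *)
Definition clamp (x y z : R) := Num.max x (Num.min y z).

Lemma clamp_itv (x y p q : R) :
  `[x, y[%classic `&` `[p, q[%classic = `[clamp x y p, clamp x y q[%classic.
Proof.
apply/seteqP; split => t /=; rewrite !in_itv/= /clamp ge_max lt_max ge_min lt_min.
  by move=> [/andP[-> ->] /andP[-> ->]]; rewrite !orbT.
rewrite (leNgt y t) (ltNge t x).
by case: (x <= t); case: (t < y); case: (p <= t); case: (t < q).
Qed.

Lemma cintegral_indic f (x y p q : R) :
  cintegral `[x, y[ (fun t => f t * (\1_(`[p, q[%classic) t : R)%:C) =
  cintegral `[clamp x y p, clamp x y q[ f.
Proof.
rewrite -clamp_itv /cintegral; congr (_ +i* _); rewrite Rintegral_mkcondr;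
  apply: eq_Rintegral => t _; rewrite patchE indicE; case: ifP => _ /=;
  by case: (f t) => a b /=; rewrite ?mulr1 ?mulr0 ?subr0 ?addr0 ?add0r.
Qed.

End ComplexIntegral.

(** * Local times and oscillatory integrals *)

Import HBSimple HBNNSimple.

Section Occupation.
Variables (R : realType) (W : R -> R).
Hypothesis cW : continuous W.
Local Notation leb := (@lebesgue_measure R).

Section Density.
Variables (D : set R) (l : R -> R).
Hypotheses (mD : measurable D) (hl : is_density (occupation W D) l).

Let mW : measurable_fun setT W.
Proof. exact: continuous_measurable_fun. Qed.

Let ml : measurable_fun setT l. Proof. by case: hl. Qed.
Let l0 z : 0 <= l z. Proof. by case: hl. Qed.

(** The density is known on preimages of sets under W, hence on the level sets of
    a simple function. *)
Lemma occupation_nnsfun (h : {nnsfun R >-> R}) :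
  (\int[leb]_(x in D) (h (W x))%:E = \int[leb]_z (h z * l z)%:E)%E.
Proof.
have mh r : measurable (h @^-1` [set r]) by exact: measurable_sfunP.
have mI r : measurable_fun (setT : set R) (\1_(h @^-1` [set r]) : R -> R).
  by apply: measurable_indic; exact: mh.
have mhW r : measurable (W @^-1` (h @^-1` [set r])).
  by rewrite -(setTI (W @^-1` _)); exact: mW.
transitivity (\sum_(r \in range h) (r%:E * occupation W D (h @^-1` [set r])))%E.
  transitivity (\int[leb]_(x in D) \sum_(r \in range h) (r * \1_(h @^-1` [set r]) (W x))%:E)%E.
    by apply: eq_integral => x _; rewrite (fimfunE h (W x)) -fsumEFin.
  have e r : (fun x => (r * \1_(h @^-1` [set r]) (W x))%:E) =
             (fun x => r%:E * (\1_(W @^-1` (h @^-1` [set r])) x)%:E)%E.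
    by apply/funext => x; rewrite -EFinM !indicE; congr (_ * _)%:E; congr (_%:R); apply/idP/idP; rewrite !inE.
  rewrite ge0_integral_fsum//=.
  - apply: eq_fsbigr => r /set_mem[t _ <-]; rewrite e ge0_integralZl_EFin//.
    + by rewrite (integral_indic leb mD (mhW (h t))) /occupation setIC.
    + by apply/measurable_EFinP; apply: measurable_indic; exact: mhW.
  - by move=> r; rewrite e; apply: measurable_funeM; apply/measurable_EFinP; apply: measurable_indic; exact: mhW.
  - by move=> r x _; rewrite EFinM; exact: nnfun_muleindic_ge0.
transitivity (\int[leb]_z \sum_(r \in range h) ((r * \1_(h @^-1` [set r]) z)%:E * (l z)%:E))%E; last first.
  apply: eq_integral => z _.
  rewrite -ge0_mule_fsuml => [|r]; last by rewrite EFinM; exact: nnfun_muleindic_ge0.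
  by rewrite fsumEFin// -(fimfunE h z) -EFinM.
rewrite ge0_integral_fsum//=.
- apply: eq_fsbigr => r /set_mem[t _ <-].
  under [RHS]eq_integral do rewrite EFinM -muleA.
  rewrite ge0_integralZl_EFin//.
  + congr (_ * _)%E; case: hl => _ _ -> //.
    rewrite [LHS]integral_mkcond; congr integral; apply/funext => z.
    by rewrite -EFinM patchE indicE; case: ifP => _; rewrite ?mul1r ?mul0r.
  + by move=> z _; rewrite -EFinM lee_fin mulr_ge0// indicE.
  + by apply: emeasurable_funM; apply/measurable_EFinP; [exact: mI|exact: ml].
- move=> r; apply: emeasurable_funM; apply/measurable_EFinP; last exact: ml.
  by apply: measurable_funM; [exact: measurable_cst|exact: mI].
- by move=> r z _; rewrite EFinM mule_ge0 ?lee_fin//; exact: nnfun_muleindic_ge0.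
Qed.

(** Change of variables along W, by monotone approximation with simple
    functions. *)
Lemma occupation_integral (f : R -> R) : measurable_fun setT f -> (forall z, 0 <= f z) ->
  (\int[leb]_(x in D) (f (W x))%:E = \int[leb]_z (f z * l z)%:E)%E.
Proof.
move=> mf f0.
have mEf : measurable_fun (setT : set R) (EFin \o f) by exact/measurable_EFinP.
pose h := nnsfun_approx measurableT mEf.
have mh n : measurable_fun (setT : set R) (h n) by exact: measurable_funPT.
have hf z : (h n z)%:E @[n --> \oo] --> (f z)%:E.
  by apply: (cvg_nnsfun_approx measurableT mEf) => // x _; rewrite lee_fin.
have nd z : nondecreasing_seq (fun n => (h n z)%:E).
  by move=> m n mn; rewrite lee_fin; exact/lefP/nd_nnsfun_approx.
have c1 : (\int[leb]_(x in D) (h n (W x))%:E)%E @[n --> \oo] --> (\int[leb]_(x in D) (f (W x))%:E)%E.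
  rewrite (_ : (\int[leb]_(x in D) (f (W x))%:E)%E =
    (\int[leb]_(x in D) limn (fun n => (h n (W x))%:E))%E); last first.
    by apply: eq_integral => x _; apply/esym/cvg_lim => //; exact: hf.
  apply: (@cvg_monotone_convergence _ _ _ leb D mD (fun n x => (h n (W x))%:E)) => //.
  - move=> n; apply/measurable_EFinP; apply: measurable_funTS.
    by apply: measurableT_comp.
  - by move=> n x _; rewrite lee_fin.
have c2 : (\int[leb]_z (h n z * l z)%:E)%E @[n --> \oo] --> (\int[leb]_z (f z * l z)%:E)%E.
  rewrite (_ : (\int[leb]_z (f z * l z)%:E)%E =
    (\int[leb]_z limn (fun n => (h n z * l z)%:E))%E); last first.
    apply: eq_integral => x _; apply/esym/cvg_lim => //.
    under eq_fun do rewrite EFinM.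
    by rewrite EFinM; apply: cvgeZr => //; exact: hf.
  apply: (@cvg_monotone_convergence _ _ _ leb setT measurableT (fun n x => (h n x * l x)%:E)) => //.
  - by move=> n; apply/measurable_EFinP; apply: measurable_funM; [exact: mh|exact: ml].
  - by move=> n x _; rewrite lee_fin mulr_ge0.
  - by move=> x _ m n mn; rewrite lee_fin ler_wpM2r// -lee_fin; exact: nd.
rewrite (_ : (fun n => _) = (fun n => (\int[leb]_z (h n z * l z)%:E)%E)) in c1; last first.
  by apply/funext => n; exact: occupation_nnsfun.
by apply: (cvg_unique _ c1 c2).
Qed.

Hypothesis fD : (leb D < +oo)%E.

Lemma density_integrable : leb.-integrable setT (EFin \o l).
Proof.
apply/integrableP; split; first exact/measurable_EFinP.
have := occupation_integral (measurable_cst (1 : R)) (fun=> ler01).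
under [X in _ = X -> _]eq_integral do rewrite mul1r.
have -> : (\int[leb]_(x in D) (cst 1 (W x))%:E)%E = leb D.
  transitivity (\int[leb]_(x in D) cst 1%E x)%E; first exact: eq_integral.
  by rewrite integral_cst// mul1e.
move=> e.
by under eq_integral do rewrite /= ger0_norm//; rewrite -e.
Qed.

(** Adding 1 to f reduces the identity to nonnegative functions. *)
Lemma occupation_bounded (f : R -> R) : continuous f -> (forall z, `|f z| <= 1) ->
  leb.-integrable setT (EFin \o (fun z => f z * l z)) /\
  \int[leb]_z (f z * l z) = \int[leb]_(x in D) f (W x).
Proof.
move=> cf f1.
have mf : measurable_fun setT f by exact: continuous_measurable_fun.
have ifl : leb.-integrable setT (EFin \o (fun z => f z * l z)).
  apply: le_integrable density_integrable => //.
    by apply/measurable_EFinP; apply: measurable_funM.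
  by move=> z _ /=; rewrite lee_fin normrM ler_piMl// (ger0_norm (l0 z)).
split => //.
have f10 z : 0 <= f z + 1 by have := f1 z; rewrite ler_norml => /andP[]; lra.
have i1 : leb.-integrable D (EFin \o (fun x => f (W x))).
  apply: (bounded_integrable mD fD (M := 1)); last by move=> x _; exact: f1.
  by apply: measurable_funTS; apply: measurableT_comp.
have i2 : leb.-integrable D (EFin \o (fun=> 1)).
  apply: (bounded_integrable mD fD (M := 1)); last by move=> x _; rewrite normr1.
  exact: measurable_cst.
have e1 : \int[leb]_z ((f z + 1) * l z) = \int[leb]_(x in D) (f (W x) + 1).
  rewrite /Rintegral -(occupation_integral (f := fun z => f z + 1))//.
  by apply: measurable_funD.
have e2 : \int[leb]_z (1 * l z) = \int[leb]_(x in D) 1.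
  by rewrite /Rintegral -(occupation_integral (f := fun=> 1)).
move: e1; rewrite RintegralD// -e2.
have -> : \int[leb]_z ((f z + 1) * l z) = \int[leb]_z (f z * l z) + \int[leb]_z (1 * l z).
  rewrite -RintegralD//; first by apply: eq_Rintegral => z _; rewrite mulrDl.
  by under [X in EFin \o X]eq_fun do rewrite mul1r; exact: density_integrable.
by move/addIr.
Qed.

End Density.

Variables (L : R -> R -> R) (gamma rho : R).
Hypotheses (hL : is_local_time W L) (hhol : holder_FLR gamma rho +oo%E L).

Definition osc (xi x y : R) : R[i] := cintegral `[x, y[ (fun t => expi (xi * W t)).

Lemma bmeas_osc (D : set R) (xi : R) : bmeas D (fun t => expi (xi * W t)).
Proof.
by apply: bmeas_expi => t; apply: continuousM; [exact: cst_continuous|exact: cW].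
Qed.

(** The difference of the local times at y and x is the density of the occupation
    measure of [x, y), whose Fourier transform is an oscillatory integral along
    W. *)
Lemma osc_fourier (x y xi : R) : 0 <= x -> x <= y ->
  fourier (fun z => L y z - L x z) xi = osc (- xi) x y.
Proof.
move=> x0 xy; have y0 := le_trans x0 xy.
have b0 t : 0 <= t -> between0 t = `[0, t]%classic.
  by move=> t0; rewrite /between0 min_l ?max_r.
have cc : continuous (fun z => cos (- (xi * z))).
  move=> z; apply: continuous_comp; last exact: continuous_cos.
  by apply: continuousN; apply: continuousM; [exact: cst_continuous|exact: cvg_id].
have cs : continuous (fun z => sin (- (xi * z))).
  move=> z; apply: continuous_comp; last exact: continuous_sin.
  by apply: continuousN; apply: continuousM; [exact: cst_continuous|exact: cvg_id].
have gen (t : R) (f : R -> R) : 0 <= t -> continuous f -> (forall z, `|f z| <= 1) ->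
    leb.-integrable setT (EFin \o (fun z => f z * L t z)) /\
    \int[leb]_z (f z * L t z) = \int[leb]_(x in `[0, t]) f (W x).
  move=> t0 cf f1; have := hL t; rewrite b0// => d.
  by apply: (occupation_bounded (measurable_itv _) d) => //; exact: leb_itv_lty.
have [ixc exc] := gen x _ x0 cc (fun z => cos_max _).
have [iyc eyc] := gen y _ y0 cc (fun z => cos_max _).
have [ixs exs] := gen x _ x0 cs (fun z => sin_max _).
have [iys eys] := gen y _ y0 cs (fun z => sin_max _).
have e : fourier (fun z => L y z - L x z) xi =
    cintegral `[0, y] (fun t => expi (- xi * W t)) - cintegral `[0, x] (fun t => expi (- xi * W t)).
  rewrite /fourier /cintegral -[RHS]/(_ +i* _); congr (_ +i* _).
    under [X in _ = X - _]eq_Rintegral do rewrite /= mulNr.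
    under [X in _ = _ - X]eq_Rintegral do rewrite /= mulNr.
    rewrite -exc -eyc -RintegralB//; apply: eq_Rintegral => z _ /=.
    by rewrite mul0r subr0; ring.
  under [X in _ = X - _]eq_Rintegral do rewrite /= mulNr.
  under [X in _ = _ - X]eq_Rintegral do rewrite /= mulNr.
  rewrite -exs -eys -RintegralB//; apply: eq_Rintegral => z _ /=.
  by rewrite mul0r addr0; ring.
rewrite e !cintegral_closed; try exact: bmeas_osc.
rewrite (cintegral_split x0 xy); last exact: bmeas_osc.
by rewrite addrAC subrr add0r.
Qed.

Lemma osc_continuous (xi : R) (xj : nat -> R) (x y : R) : xj @ \oo --> xi ->
  ccvg (fun j => osc (xj j) x y) (osc xi x y).
Proof.
move=> xjxi; apply: (@cintegral_cvg _ _ (measurable_itv _) (leb_itv_lty _ _ _ _) _ _ 1).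
- by move=> j; exact: bmeas_osc.
- by move=> j t _; rewrite normc_expi.
- move=> t _; have h : (fun j => xj j * W t) @ \oo --> xi * W t.
    by apply: cvgM => //; exact: cvg_cst.
  apply: ccvg_ReIm => /=.
    by apply: continuous_cvg h; exact: continuous_cos.
  by apply: continuous_cvg h; exact: continuous_sin.
Qed.

Lemma japanese_powR_cvg (xi a : R) (xj : nat -> R) : xj @ \oo --> xi ->
  (japanese (xj j) `^ a) @[j --> \oo] --> japanese xi `^ a.
Proof.
move=> h.
have jc : (japanese (xj j)) @[j --> \oo] --> japanese xi.
  have hc : (1 + xj j ^+ 2) @[j --> \oo] --> 1 + xi ^+ 2.
    by apply: cvgD; [exact: cvg_cst|rewrite !expr2; exact: cvgM].
  exact: (cvg_comp (fun j => 1 + xj j ^+ 2) (@Num.sqrt R) hc (@sqrt_continuous R _)).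
have j0 : 0 < japanese xi by rewrite (lt_le_trans ltr01)// japanese_ge1.
have /derivable1_diffP/differentiable_continuous : derivable (@powR R ^~ a) (japanese xi) 1.
  by apply: derivable_powR; rewrite in_itv/= andbT.
exact: (cvg_comp (fun j => japanese (xj j)) (fun z => z `^ a) jc).
Qed.

(** The regularity of the local time as a decay estimate for oscillatory
    integrals: the essential supremum is attained pointwise, because the
    Fourier transform of a finite measure is continuous. *)
Lemma osc_bound : exists2 C : R, 0 <= C & forall x y xi, 0 <= x -> x <= y -> y <= 1 ->
  normc (osc xi x y) <= C * (y - x) `^ gamma * japanese xi `^ (- rho).
Proof.
have [_ /(_ 1)[C hC]] := hhol.
exists `|C| => // x y xi x0 xy y1.
have j0 z : 0 < @japanese R z by rewrite (lt_le_trans ltr01)// japanese_ge1.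
have {}hC : (FLR_norm rho +oo (fun z => L y z - L x z)%R <= (`|C| * (y - x) `^ gamma)%:E)%E.
  apply: le_trans (hC y x _ _) _; rewrite ?in_itv/=; try by apply/andP; split; lra.
  by rewrite lee_fin ger0_norm ?subr_ge0// ler_wpM2r ?powR_ge0// ler_norm.
move: hC; rewrite /FLR_norm unlock.
have -> : (0 < leb setT)%E.
  apply: (@lt_le_trans _ _ (leb `[0, 1]%classic)).
    by rewrite lebesgue_measure_itv/= lte_fin ltr01 oppr0 adde0 lte_fin.
  by apply: (@le_measure _ _ _ leb); [apply/mem_set; exact: measurable_itv|apply/mem_set; exact: measurableT|].
set B := `|C| * _ => /ess_supP[N [mN N0 hN]].
have good z : ~ N z -> japanese z `^ rho * normc (osc (- z) x y) <= B.
  move=> Nz; rewrite -osc_fourier// -lee_fin; apply: contrapT => h.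
  by apply: Nz; apply: hN => h'; apply: h; apply: le_trans h'; exact: lee_abs.
(* a null set contains no interval *)
have near_good (j : nat) : exists z, ~ N z /\ `|z - - xi| < j.+1%:R^-1.
  apply: contrapT => /forallNP h.
  have : (leb `](- xi)%R, (- xi + j.+1%:R^-1)%R[%classic <= leb N)%E.
    apply: (@le_measure _ _ _ leb); [apply/mem_set; exact: measurable_itv|exact/mem_set|].
    move=> z /=; rewrite in_itv/= => /andP[z1 z2].
    apply: contrapT => Nz; apply: (h z); split => //.
    by rewrite gtr0_norm ?subr_gt0// ltrBlDl.
  rewrite N0 lebesgue_measure_itv/= lte_fin ltrDl invr_gt0 ltr0n/=.
  by rewrite -EFinD lee_fin addrAC subrr add0r leNgt invr_gt0 ltr0n.
pose zj j := projT1 (cid (near_good j)).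
have zN j : ~ N (zj j) by rewrite /zj; case: cid => z [].
have zc : zj @ \oo --> - xi.
  apply/cvgrPdist_lt => e e0.
  have := near_infty_natSinv_lt (PosNum e0); apply: filterS => j /= je.
  by rewrite distrC; apply: lt_trans je; rewrite /zj; case: cid => z [].
have h1 : ccvg (fun j => osc (- zj j) x y) (osc xi x y).
  by apply: osc_continuous; rewrite -[X in _ --> X]opprK; exact: cvgN.
have h2 := cvgM (japanese_powR_cvg (a := rho) zc) (ccvg_norm h1).
have : japanese (- xi) `^ rho * normc (osc xi x y) <= B.
  by apply: (cvgr_to_le (h2 _)); apply: nearW => j; exact: good.
have -> : japanese (- xi) = japanese xi by rewrite /japanese sqrrN.
by rewrite powRN ler_pdivlMr ?powR_gt0// mulrC.
Qed.
End Occupation.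

(** * Step functions *)

Lemma mul_conjc (R : realType) (z w : R[i]) : conjc z * conjc w = conjc (z * w).
Proof. by case: z w => a b [c d] /=; apply/eqP; rewrite eq_complex/=; apply/andP; split; apply/eqP; ring. Qed.

Lemma conjc_sum (R : realType) (I : Type) (l : seq I) (f : I -> R[i]) :
  conjc (\sum_(i <- l) f i) = \sum_(i <- l) conjc (f i).
Proof.
elim: l => [|i l IH]; first by rewrite !big_nil conjc0.
by rewrite !big_cons -IH; case: (f i) (\sum_(j <- l) f j) => a b [c d] /=; rewrite opprD.
Qed.

Lemma mul_real_complex (R : realType) (a b : R) : (a * b)%:C = a%:C * b%:C :> R[i].
Proof. by apply/eqP; rewrite eq_complex/= !mul0r !mulr0 subr0 addr0 !eqxx. Qed.

Section Clamp.
Variable R : realType.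
Implicit Types (x y p q t : R).

Lemma clamp_mono x y p q : p <= q -> clamp x y p <= clamp x y q.
Proof.
move=> pq; rewrite /clamp ge_max le_max lexx /= le_max; apply/orP; right.
by rewrite le_min !ge_min lexx pq orbT.
Qed.

Lemma clamp_ge x y p : x <= clamp x y p.
Proof. by rewrite /clamp le_max lexx. Qed.

Lemma clamp_le x y p : x <= y -> clamp x y p <= y.
Proof. by move=> xy; rewrite /clamp ge_max xy ge_min lexx. Qed.

Lemma clamp_len x y p q : x <= y -> p <= q -> 0 <= clamp x y q - clamp x y p <= y - x.
Proof.
move=> xy pq; have := clamp_mono x y pq; have := clamp_ge x y p; have := clamp_le q xy.
by move=> *; apply/andP; split; lra.
Qed.

Lemma clamp_inside t h p q : 0 <= h -> p <= t -> t + h <= q ->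
  clamp t (t + h) q - clamp t (t + h) p = h.
Proof.
move=> h0 pt tq; have pth : p <= t + h by rewrite (le_trans pt)// lerDl.
rewrite /clamp (min_l tq) (min_r pth) (max_l pt) max_r; last by rewrite lerDl.
by rewrite addrAC subrr add0r.
Qed.

End Clamp.

Section StepFunctions.
Variables (R : realType) (s : R) (r : \bar R) (gamma : R).
Hypotheses (hs : 0 <= s) (hr : (1 <= r)%E).
Local Notation FLle := (FLle s r).
Implicit Types (t x y : R) (w : R -> coefs R).

(** The intervals may overlap, so that linear combinations of step functions are
    again step functions, by concatenation of the lists. The field [stbound]
    stands for an upper bound of the norm of each value. *)
Record step := Step {
  stidx : Type;
  stlist : seq stidx;
  stleft : stidx -> R;
  stright : stidx -> R;
  stval : stidx -> coefs R;
  stbound : stidx -> R }.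

Definition step_indic (S : step) (i : stidx S) t : R := \1_(`[stleft i, stright i[%classic) t.

Definition stepfun (S : step) t : coefs R := fun n =>
  \sum_(i <- stlist S) stval i n * (step_indic i t)%:C.

(** The property of a sum of atoms that the trilinear estimate uses: cutting
    any interval along the steps, the total gamma-variation of time weighted
    by the sizes of the values is bounded. *)
Definition step_bounded (S : step) (Lam : R) := [/\
  forall i : stidx S, stleft i <= stright i,
  forall i : stidx S, FLle (stval i) (stbound i) &
  forall x y, x <= y ->
    \sum_(i <- stlist S) stbound i * (clamp x y (stright i) - clamp x y (stleft i)) `^ gamma
      <= Lam * (y - x) `^ gamma].

Lemma step_indic_ge0 S (i : stidx S) t : 0 <= step_indic i t.
Proof. by rewrite /step_indic indicE. Qed.

Lemma stbound_ge0 S Lam (i : stidx S) : step_bounded S Lam -> 0 <= stbound i.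
Proof. by case=> _ /(_ i) /FLle_ge0. Qed.

Lemma step_bounded_ge0 S Lam : step_bounded S Lam -> 0 <= Lam.
Proof.
move=> SL; have [_ _ /(_ 0 1 ler01)] := SL.
rewrite subr0 powR1 mulr1; apply: le_trans; apply: sumr_ge0 => i _.
by rewrite mulr_ge0 ?powR_ge0 ?(stbound_ge0 i SL).
Qed.

(** Testing on a short interval [t, t + h) shows that the values themselves
    are bounded. *)
Lemma step_bounded_FLle S Lam t : step_bounded S Lam -> FLle (stepfun S t) Lam.
Proof.
move=> SL; have [lr vb cut] := SL.
have b0 i := stbound_ge0 i SL.
have [h h0 hh] : exists2 h, 0 < h & forall h', 0 < h' <= h ->
   \sum_(i <- stlist S) stbound i * (step_indic i t * h' `^ gamma) <=
   \sum_(i <- stlist S) stbound i * (clamp t (t + h') (stright i) - clamp t (t + h') (stleft i)) `^ gamma.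
  elim: (stlist S) => [|i l [h h0 IH]].
    by exists 1 => // h' _; rewrite !big_nil.
  have [/andP[pt tq]|ti] := boolP ((stleft i <= t) && (t < stright i)).
    exists (Num.min h (stright i - t)); first by rewrite lt_min h0 subr_gt0.
    move=> h'; rewrite le_min => /andP[h'0 /andP[h'h h'i]].
    rewrite !big_cons; apply: lerD; last by apply: IH; rewrite h'0.
    rewrite clamp_inside ?(ltW h'0)//; last by rewrite addrC -lerBrDr.
    rewrite ler_wpM2l// ler_piMl ?powR_ge0// /step_indic indicE.
    by case: (_ \in _).
  exists h => // h' hh'; rewrite !big_cons; apply: lerD; last exact: IH.
  rewrite /step_indic indicE memNset /= ?in_itv/= ?mul0r ?mulr0 ?mulr_ge0 ?powR_ge0//.
  exact/negP.
have : \sum_(i <- stlist S) stbound i * step_indic i t <= Lam.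
  rewrite -(@ler_pM2r _ (h `^ gamma)) ?powR_gt0// mulr_suml.
  under eq_bigr do rewrite -mulrA.
  apply: le_trans (hh h _) _; first by rewrite h0 lexx.
  apply: le_trans (cut t (t + h) _) _; first by rewrite lerDl ltW.
  by rewrite addrAC subrr add0r.
move=> hL; apply: FLle_le hL _.
have := FLle_sum (s := s) hr (stlist S) (f := fun i n => (step_indic i t)%:C * stval i n)
  (P := xpredT) (b := fun i => stbound i * step_indic i t).
move=> h1; apply: FLle_mono (h1 _) => //.
  move=> n; rewrite /stepfun; apply: eq_ler; congr normc.
  by apply: eq_bigr => i _; rewrite mulrC.
move=> i _; have := FLle_scale hr (step_indic i t)%:C (vb i).
by rewrite normc_real ger0_norm ?step_indic_ge0// mulrC.
Qed.

Lemma bmeas_stepfun D S n : measurable D -> bmeas D (fun t => stepfun S t n).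
Proof.
move=> mD; apply: bmeas_sum => i; apply: bmeasM; first exact: bmeas_cst.
by apply: bmeas_indic; exact: measurable_itv.
Qed.

(** Integrating against a step function splits the interval of integration. *)
Lemma cintegral_step (I : Type) (l : seq I) (p q : I -> R) (c : I -> R[i]) (f : R -> R[i]) x y :
  bmeas `[x, y[ f ->
  cintegral `[x, y[ (fun t => f t * \sum_(i <- l) c i * (\1_(`[p i, q i[%classic) t : R)%:C) =
  \sum_(i <- l) c i * cintegral `[clamp x y (p i), clamp x y (q i)[ f.
Proof.
move=> mf; have mD : measurable `[x, y[%classic by exact: measurable_itv.
have fD := leb_itv_lty true true x y.
have mfi i : bmeas `[x, y[ (fun t => f t * (\1_(`[p i, q i[%classic) t : R)%:C).
  by apply: bmeasM => //; apply: bmeas_indic; exact: measurable_itv.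
under [RHS]eq_bigr do rewrite -cintegral_indic -cintegralZ//.
rewrite -cintegral_sum//; last by move=> i; apply: bmeasM => //; exact: bmeas_cst.
apply: eq_cintegral => t _; rewrite mulr_sumr; apply: eq_bigr => i _.
by rewrite mulrCA.
Qed.

(** Functions approximated coefficientwise by uniformly bounded step functions.
    This is implied by membership in U^2, and it is the only property of U^2
    that the estimates use. *)
Definition approximable (D : set R) w (Lam : R) := exists S : nat -> step,
  (forall j, step_bounded (S j) Lam) /\
  forall t, D t -> forall n, ccvg (fun j => stepfun (S j) t n) (w t n).

Lemma approximable_FLle D w Lam t : approximable D w Lam -> D t -> FLle (w t) Lam.
Proof.
move=> [S [SL Sw]] Dt; apply: (FLle_lim hr (uj := fun j => stepfun (S j) t)).
  by move=> j; exact: step_bounded_FLle.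
by move=> n; exact: Sw.
Qed.

Lemma approximable_ge0 D w Lam : approximable D w Lam -> 0 <= Lam.
Proof. by move=> [S [SL _]]; exact: step_bounded_ge0 (SL 0%N). Qed.

Lemma eq_approximable D w w' Lam : (forall t, D t -> w t =1 w' t) ->
  approximable D w Lam -> approximable D w' Lam.
Proof.
move=> ww [S [SL Sw]]; exists S; split => // t Dt n.
by rewrite -(ww t Dt n); exact: Sw.
Qed.

Lemma approximableS D D' w Lam : D' `<=` D -> approximable D w Lam -> approximable D' w Lam.
Proof. by move=> DD [S [SL Sw]]; exists S; split => // t /DD; exact: Sw. Qed.

Lemma bmeas_approximable D w Lam n : measurable D -> approximable D w Lam ->
  bmeas D (fun t => w t n).
Proof.
move=> mD wL; have [S [SL Sw]] := wL.
apply: (@bmeas_lim _ _ (fun j t => stepfun (S j) t n) _ Lam) => //.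
- by move=> j; exact: bmeas_stepfun.
- by move=> t Dt; exact: Sw.
- by move=> t Dt; exact: (FLle_coord hs hr _ (approximable_FLle wL Dt)).
Qed.

End StepFunctions.

(** * The space U^2 *)

Section StepAlgebra.
Variables (R : realType) (s : R) (r : \bar R) (gamma : R).
Hypotheses (hr : (1 <= r)%E) (hg : 1 / 2 < gamma).
Local Notation FLle := (FLle s r).
Local Notation bounded_step := (step_bounded s r gamma).

Definition step0 : step R := @Step R void [::] (fun=> 0) (fun=> 0) (fun=> 0) (fun=> 0).

Definition stepD (S S' : step R) : step R := @Step R (stidx S + stidx S')
  ([seq inl i | i <- stlist S] ++ [seq inr i | i <- stlist S'])
  (fun i => match i with inl i => stleft i | inr i => stleft i end)
  (fun i => match i with inl i => stright i | inr i => stright i end)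
  (fun i => match i with inl i => stval i | inr i => stval i end)
  (fun i => match i with inl i => stbound i | inr i => stbound i end).

Definition stepZ (c : R[i]) (S : step R) : step R := @Step R (stidx S) (stlist S)
  (@stleft R S) (@stright R S) (fun i n => c * stval i n) (fun i => normc c * stbound i).

Lemma stepfun0 t n : stepfun step0 t n = 0.
Proof. by rewrite /stepfun big_nil. Qed.

Lemma stepfunD S S' t n : stepfun (stepD S S') t n = stepfun S t n + stepfun S' t n.
Proof. by rewrite /stepfun/= big_cat !big_map. Qed.

Lemma stepfunZ c S t n : stepfun (stepZ c S) t n = c * stepfun S t n.
Proof. by rewrite /stepfun/= mulr_sumr; apply: eq_bigr => i _; rewrite mulrA. Qed.

Lemma step0_bounded : bounded_step step0 0.
Proof. by split=> [[]|[]|x y xy]; rewrite big_nil mul0r. Qed.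

Lemma stepD_bounded S S' L L' : bounded_step S L -> bounded_step S' L' ->
  bounded_step (stepD S S') (L + L').
Proof.
move=> [lr vb cut] [lr' vb' cut']; split; [by case|by case|].
by move=> x y xy; rewrite big_cat !big_map mulrDl/= lerD ?cut ?cut'.
Qed.

Lemma stepZ_bounded c S L : bounded_step S L -> bounded_step (stepZ c S) (normc c * L).
Proof.
move=> [lr vb cut]; split=> [//|i|x y xy]; first exact: FLle_scale.
rewrite -mulrA; apply: le_trans (ler_wpM2l (normc_ge0 _) (cut x y xy)).
by rewrite mulr_sumr/=; apply: ler_sum => i _; rewrite mulrA.
Qed.

Lemma step_bounded_le S L L' : L <= L' -> bounded_step S L -> bounded_step S L'.
Proof.
move=> LL [lr vb cut]; split=> // x y xy; apply: le_trans (cut x y xy) _.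
by rewrite ler_wpM2r// powR_ge0.
Qed.

Lemma sum_clamp (tt : nat -> R) (K : nat) x y : x <= y ->
  (forall k, (k < K)%N -> tt k <= tt k.+1) ->
  \sum_(k < K) (clamp x y (tt k.+1) - clamp x y (tt k)) <= y - x.
Proof.
move=> xy tmono; rewrite -(big_mkord xpredT (fun k => clamp x y (tt k.+1) - clamp x y (tt k))).
rewrite telescope_sumr//.
by have := clamp_ge x y (tt 0%N); have := clamp_le (tt K) xy; lra.
Qed.

(** Cauchy-Schwarz over the steps: this is where gamma > 1/2 meets the
    square summability of atoms. *)
Lemma square_summable_cut (tt b : nat -> R) (K : nat) x y : x <= y ->
  (forall k, (k < K)%N -> tt k <= tt k.+1) -> (forall k, 0 <= b k) ->
  \sum_(k < K) b k ^+ 2 <= 1 ->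
  \sum_(k < K) b k * (clamp x y (tt k.+1) - clamp x y (tt k)) `^ gamma <= (y - x) `^ gamma.
Proof.
move=> xy tmono b0 b1.
rewrite -[leRHS]mul1r.
pose len (k : 'I_K) := clamp x y (tt k.+1) - clamp x y (tt k).
have len0 k : 0 <= len k <= y - x by apply: clamp_len => //; exact: tmono.
have d0 : 0 <= y - x by rewrite subr_ge0.
apply: (@finite_hoelder R _ (index_enum 'I_K) xpredT b (fun k => len k `^ gamma) 2 2 1 ((y - x) `^ gamma)) => //.
- by field.
- exact: powR_ge0.
- by move=> k; exact: powR_ge0.
- by rewrite powR1; under eq_bigr do rewrite powR_mulrn//.
- have g2 : gamma * 2 = 1 + (gamma * 2 - 1) by ring.
  have g1 : 0 <= gamma * 2 - 1 by rewrite subr_ge0 -ler_pdivrMr// ltW.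
  rewrite -powRrM.
  apply: (@le_trans _ _ (\sum_(k < K) len k * (y - x) `^ (gamma * 2 - 1))).
    apply: ler_sum => k _; rewrite -powRrM [in leLHS]g2.
    have /andP[l0 l1] := len0 k.
    move: l0; rewrite le_eqVlt => /predU1P[<-|l0].
      by rewrite mul0r powR0// -g2 mulf_neq0// gt_eqF// (lt_trans _ hg)// divr_gt0.
    rewrite powRD; last by rewrite (gt_eqF l0) implybT.
    rewrite powRr1 ?(ltW l0)// ler_wpM2l ?(ltW l0)//.
    by apply: ge0_ler_powR => //; rewrite nnegrE ltW.
  rewrite -mulr_suml; apply: le_trans (ler_wpM2r (powR_ge0 _ _) (sum_clamp xy tmono)) _.
  move: d0; rewrite le_eqVlt => /predU1P[<-|d0]; first by rewrite mul0r powR_ge0.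
  by rewrite [in leRHS]g2 [leRHS]powRD ?powRr1 ?(ltW d0)// (gt_eqF d0) implybT.
Qed.

(** Atoms with values in P. Tracking P shows below that Hoelder functions with
    values in the closure of the trigonometric polynomials decompose into atoms
    with values in that closure. *)
Definition valued_atom (P : set (coefs R)) (a b : R) (U : R -> coefs R) : Prop :=
  exists (K : nat) (tt : nat -> R) (phi : nat -> coefs R),
    [/\ tt 0%N = a /\ tt K = b,
        (forall k, (k < K)%N -> tt k <= tt k.+1),
        (forall k, (k < K)%N -> in_FLT s r (phi k) /\ P (phi k)),
        (\sum_(k < K) FLT_norm s r (phi k) ^+ 2 <= 1)%E &
        U = fun t n => \sum_(k < K) (\1_(`[tt k, tt k.+1[%classic) t)%:C * phi k n].

Lemma valued_atom_U2 P a b U : valued_atom P a b U -> U2_atom s r a b U.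
Proof.
move=> [K [tt [phi [ab tm ph ph1 Ue]]]]; exists K, tt, phi; split=> // k kK.
by case: (ph k kK).
Qed.

Lemma U2_valued_atom a b U : U2_atom s r a b U -> valued_atom setT a b U.
Proof.
move=> [K [tt [phi [ab tm ph ph1 Ue]]]]; exists K, tt, phi; split=> // k kK.
by split=> //; exact: ph.
Qed.

Lemma fine_FLle u : in_FLT s r u -> FLle u (fine (FLT_norm s r u)).
Proof. by move=> uf; rewrite /FLle fineK// ge0_fin_numE// FLT_norm_ge0. Qed.

(** Outside the range k < K the data of an atom are arbitrary; they are replaced
    by zero so that the bounds hold for every index. *)
Lemma valued_atom_step P a b U : P (fun=> 0) -> valued_atom P a b U ->
  exists S : step R, [/\ bounded_step S 1, (forall t n, stepfun S t n = U t n),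
    (forall i : stidx S, P (stval i)) & (forall t, t < a -> forall n, U t n = 0)].
Proof.
move=> P0 [K [tt [phi [[ta tb] tm ph ph1 Ue]]]].
pose ph' k : coefs R := if (k < K)%N then phi k else fun=> 0.
pose tl k := if (k < K)%N then tt k else 0.
pose tr k := if (k < K)%N then tt k.+1 else 0.
pose b' k := if (k < K)%N then fine (FLT_norm s r (phi k)) else 0.
have b'0 k : 0 <= b' k by rewrite /b'; case: ifP => // _; rewrite fine_ge0// FLT_norm_ge0.
exists (@Step R nat (iota 0 K) tl tr ph' b'); split.
- split=> [k|k|x y xy] /=.
  + by rewrite /tl /tr; case: ifP => // /tm.
  + rewrite /ph' /b'; case: ifP => [/ph[kf _]|_]; [exact: fine_FLle|exact: FLle0].
  + rewrite mul1r; apply: le_trans (square_summable_cut (tt := tt) (b := b') (K := K) xy tm b'0 _).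
      rewrite -(big_mkord xpredT (fun k => b' k * (clamp x y (tt k.+1) - clamp x y (tt k)) `^ gamma)).
      rewrite /index_iota subn0 !big_seq; apply: ler_sum => k.
      by rewrite mem_iota add0n/= /tl /tr => ->.
    rewrite -lee_fin -sumEFin; apply: le_trans ph1; apply: lee_sum => k _.
    rewrite /b' ltn_ord; have [kf _] := ph k (ltn_ord k).
    by rewrite EFin_expe fineK// ge0_fin_numE// FLT_norm_ge0.
- move=> t n; rewrite Ue /stepfun/=.
  rewrite -(big_mkord xpredT (fun k => (\1_(`[tt k, tt k.+1[%classic) t)%:C * phi k n)).
  rewrite /index_iota subn0 !big_seq; apply: eq_bigr => k.
  by rewrite mem_iota add0n/= /step_indic/= /tl /tr /ph' => ->; rewrite mulrC.
- by move=> k /=; rewrite /ph'; case: ifP => // /ph[].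
- move=> t tlta n; rewrite Ue big1// => k _.
  have ak : a <= tt k.
    rewrite -ta; elim: (nat_of_ord k) (ltn_ord k) => [//|j IH] jK.
    by apply: le_trans (tm j (ltnW jK)); apply: IH; exact: ltnW.
  rewrite indicE memNset ?mul0r//= in_itv/= => /andP[kt _].
  by have := le_lt_trans (le_trans ak kt) tlta; rewrite ltxx.
Qed.

(** The triangle inequality: the cutting constants of the atoms, which are at most
    1, add up with the coefficients as weights. *)
Lemma atoms_step P a b (lam : nat -> R[i]) (A : nat -> R -> coefs R) (j0 J : nat) :
  P (fun=> 0) -> (forall c u, P u -> P (fun n => c * u n)) ->
  (forall j, valued_atom P a b (A j)) ->
  exists S : step R, [/\ bounded_step S (\sum_(j0 <= j < J) normc (lam j)),
    (forall t n, stepfun S t n = \sum_(j0 <= j < J) lam j * A j t n) &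
    (forall i : stidx S, P (stval i))].
Proof.
move=> P0 PZ hA.
elim: J => [|J [S [Sb Se SP]]].
  exists step0; split=> [|t n|[]]; first by rewrite big_geq//; exact: step0_bounded.
  by rewrite stepfun0 big_geq.
have [jJ|Jj] := leqP j0 J; last first.
  exists step0; split=> [|t n|[]]; first by rewrite big_geq//; exact: step0_bounded.
  by rewrite stepfun0 big_geq.
have [S' [S'b S'e S'P _]] := valued_atom_step P0 (hA J).
exists (stepD S (stepZ (lam J) S')); split=> [|t n|[i|i]].
- rewrite big_nat_recr//=; apply: stepD_bounded => //.
  by rewrite -[normc (lam J)]mulr1; exact: stepZ_bounded.
- by rewrite stepfunD stepfunZ Se S'e [RHS]big_nat_recr.
- exact: SP.
- exact/PZ/S'P.
Qed.

Lemma l1_norm_partial (lam : nat -> R[i]) (L : R) (j0 J : nat) : (l1_norm lam <= L%:E)%E ->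
  \sum_(j0 <= j < J) normc (lam j) <= L.
Proof.
move=> lL; rewrite -lee_fin -sumEFin; apply: le_trans lL.
apply: le_trans (nneseries_lim_ge (u_ := fun j => (normc (lam j))%:E) (P := xpredT) J _); last first.
  by move=> j _ _; rewrite lee_fin normc_ge0.
rewrite !sumEFin lee_fin.
have [jJ|/ltnW Jj] := leqP j0 J; last first.
  by rewrite big_geq// sumr_ge0// => j _; exact: normc_ge0.
by rewrite [leRHS](big_cat_nat _ (n := j0))//= lerDr sumr_ge0// => j _; exact: normc_ge0.
Qed.

Lemma U2_ccvg a b (U : R -> coefs R) lam A t n : 0 <= s ->
  U2_representation s r a b U lam A -> a <= t < b ->
  ccvg (fun J => \sum_(0 <= j < J) lam j * A j t n) (U t n).
Proof.
move=> hs [_ _ hU] tab.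
have hc : FLT_norm s r (fun n => U t n - \sum_(j < J) lam j * A j t n) @[J --> \oo] --> 0%E.
  by apply: hU; rewrite in_itv/=.
apply/cvgrPdist_lt => e0 e00.
have /fine_cvgP[_] := hc.
move=> /cvgrPdist_lt /(_ e0 e00).
have /fine_cvgP[+ _] := hc; move=> fin; apply: filterS2 fin => J fJ.
rewrite /= !sub0r !normrN => h.
rewrite ger0_norm ?normc_ge0//.
apply: le_lt_trans h; rewrite ger0_norm ?fine_ge0 ?FLT_norm_ge0//.
rewrite normc_sub big_mkord.
have := FLle_coord hs hr n (u := fun n => U t n - \sum_(j < J) lam j * A j t n)
  (B := fine (FLT_norm s r (fun n => U t n - \sum_(j < J) lam j * A j t n))).
by apply; rewrite /FLle fineK.
Qed.

(** The partial sums of the atomic decomposition are the approximating step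
    functions. *)
Lemma U2_approximable a b (U : R -> coefs R) lam A (L : R) : 0 <= s ->
  U2_representation s r a b U lam A -> (l1_norm lam <= L%:E)%E ->
  (forall t, t < a -> U t =1 (fun=> 0)) -> approximable s r gamma `]-oo, b[ U L.
Proof.
move=> hs rep lL U0; have [hA _ _] := rep.
have vA j : valued_atom setT a b (A j) by exact: U2_valued_atom.
have st J : {S : step R | bounded_step S L /\
    forall t n, stepfun S t n = \sum_(0 <= j < J) lam j * A j t n}.
  apply: cid; have [S [Sb Se _]] := @atoms_step setT a b lam A 0 J I (fun _ _ _ => I) vA.
  by exists S; split => //; apply: step_bounded_le Sb; exact: l1_norm_partial.
exists (fun J => projT1 (st J)); split=> [J|t]; first by case: (projT2 (st J)).
rewrite /= in_itv/= => tb n.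
have e J : stepfun (projT1 (st J)) t n = \sum_(0 <= j < J) lam j * A j t n.
  by case: (projT2 (st J)).
rewrite (_ : (fun J => _) = (fun J => \sum_(0 <= j < J) lam j * A j t n)); last exact/funext.
have [ta|ta] := ltP t a; last by apply: (U2_ccvg n hs rep); rewrite ta tb.
rewrite (U0 t ta) (_ : (fun J => _) = fun=> 0); first exact: ccvg_cst.
apply/funext => J; rewrite big1// => j _.
have [S [_ _ _ z]] := valued_atom_step (P := setT) I (vA j).
by rewrite z// mulr0.
Qed.

End StepAlgebra.

Section ApproximableAlgebra.
Variables (R : realType) (s : R) (r : \bar R) (gamma : R).
Hypotheses (hs : 0 <= s) (hr : (1 <= r)%E).
Implicit Types (D : set R) (w v : R -> coefs R).

Lemma approximable_sub D w v L L' :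
  approximable s r gamma D w L -> approximable s r gamma D v L' ->
  approximable s r gamma D (fun t n => w t n - v t n) (L + L').
Proof.
move=> [S [SL Sw]] [S' [SL' Sv]].
exists (fun j => stepD (S j) (stepZ (-1) (S' j))); split=> [j|t Dt n].
  apply: stepD_bounded => //; have := stepZ_bounded hr (-1) (SL' j).
  by rewrite normc_opp normc_real normr1 mul1r.
rewrite (_ : (fun j => _) = fun j => stepfun (S j) t n - stepfun (S' j) t n); last first.
  by apply/funext => j; rewrite stepfunD stepfunZ mulN1r.
by apply: ccvgB; [exact: Sw|exact: Sv].
Qed.

Lemma approximable_le D w L L' : L <= L' ->
  approximable s r gamma D w L -> approximable s r gamma D w L'.
Proof.
move=> LL [S [SL Sw]]; exists S; split=> // j.
exact: step_bounded_le (SL j).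
Qed.

End ApproximableAlgebra.

(** Hoelder continuous functions belong to U^2: decompose along the dyadic
    times. The increments of generation [l] have size 2^(-l gamma), there are
    2^l of them, and gamma > 1/2 makes their l^2 norms summable in [l]. *)
Section Hoelder.
Variables (R : realType) (s : R) (r : \bar R) (gamma : R).
Hypotheses (hr : (1 <= r)%E) (hg : 1 / 2 < gamma).
Local Notation FLle := (FLle s r).

(** The increments of generation l have size 2^(-l gamma) and there are 2^l of
    them, so this ratio to the power l is the size of their l^2 norm. *)
Definition dyadic_ratio : R := 2 `^ (2^-1 - gamma).
Local Notation th := dyadic_ratio.

Lemma dyadic_ratio_ge0 : 0 <= th. Proof. exact: powR_ge0. Qed.

Lemma dyadic_ratio_lt1 : th < 1.
Proof.
rewrite /th -opprB powRN invf_lt1 ?powR_gt0//.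
have : 1 `^ (gamma - 2^-1) < 2 `^ (gamma - 2^-1).
  by apply: gt0_ltr_powR; rewrite ?nnegrE ?ltr1n// subr_gt0 -div1r.
by rewrite powR1.
Qed.

Definition U2_const : R := (1 - th)^-1.

Lemma U2_const_gt0 : 0 < U2_const.
Proof. by rewrite invr_gt0 subr_gt0 dyadic_ratio_lt1. Qed.

Variables (a b : R) (w : R -> coefs R) (A0 B : R).
Hypotheses (ab : a < b) (A00 : 0 < A0) (B0 : 0 < B) (wa : FLle (w a) A0).
Hypothesis wB : forall t t', a <= t < b -> a <= t' < b ->
  FLle (fun n => w t n - w t' n) (B * `|t - t'| `^ gamma).
Variable P : set (coefs R).
Hypotheses (PZ : forall c u, P u -> P (fun n => c * u n))
  (PB : forall u v, P u -> P v -> P (fun n => u n - v n)).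
Hypothesis wP : forall t, a <= t < b -> P (w t).

Definition dyadic_time (l k : nat) : R := a + (b - a) * k%:R / 2 ^+ l.
Definition dyadic_index (l : nat) (t : R) : nat := Num.truncn (2 ^+ l * ((t - a) / (b - a))).
Definition dyadic_floor l t := dyadic_time l (dyadic_index l t).

Let ba0 : 0 < b - a. Proof. by rewrite subr_gt0. Qed.

Lemma dyadic_indexP l t k : a <= t ->
  (dyadic_index l t == k) = (dyadic_time l k <= t < dyadic_time l k.+1).
Proof.
move=> at0; have x0 : 0 <= 2 ^+ l * ((t - a) / (b - a)).
  by rewrite mulr_ge0 ?exprn_ge0// divr_ge0 ?subr_ge0// ltW.
rewrite /dyadic_index truncn_eq// /dyadic_time.
rewrite -!lerBrDl -!ltrBlDl.
have e j : ((b - a) * j%:R / 2 ^+ l <= t - a) = (j%:R <= 2 ^+ l * ((t - a) / (b - a))).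
  by rewrite ler_pdivrMr ?exprn_gt0// [(b - a) * _]mulrC -ler_pdivlMr// [2 ^+ l * _]mulrC mulrAC.
by rewrite e; congr andb; rewrite [RHS]ltNge e -ltNge.
Qed.

Lemma dyadic_index_half l t : a <= t -> dyadic_index l t = (dyadic_index l.+1 t)./2.
Proof.
move=> at0; apply/eqP; rewrite dyadic_indexP//.
have := @dyadic_indexP l.+1 t (dyadic_index l.+1 t) at0; rewrite eqxx => /esym.
set k := dyadic_index l.+1 t => /andP[k1 k2].
have hk : (k./2.*2 <= k)%N by rewrite -[leqRHS]odd_double_half leq_addl.
have hk' : (k.+1 <= k./2.+1.*2)%N by rewrite doubleS -[k in leqLHS]odd_double_half; case: (odd k).
have e j : dyadic_time l j = dyadic_time l.+1 j.*2.
  by rewrite /dyadic_time -muln2 natrM exprS; field; rewrite expf_neq0.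
have m j j' : (j <= j')%N -> dyadic_time l.+1 j <= dyadic_time l.+1 j'.
  move=> jj; rewrite lerD2l ler_wpM2r ?invr_ge0 ?exprn_ge0// ler_wpM2l ?ler_nat//.
  exact: ltW.
by rewrite !e (le_trans (m _ _ hk) k1) (lt_le_trans k2 (m _ _ hk')).
Qed.

Definition dyadic_atom_size (l : nat) : R := B * (b - a) `^ gamma * th ^+ l.

(** Generation 0 is the constant function with value w(a); later generations
    correct from one dyadic scale to the next. Dividing by [U2_coef] makes every
    block an atom. *)
Definition U2_coef (l : nat) : R := if l is _.+1 then dyadic_atom_size l else A0.

Definition U2_value (l k : nat) : coefs R := fun n => (U2_coef l)^-1%:C *
  (if l is l'.+1 then w (dyadic_time l k) n - w (dyadic_time l' k./2) n else w a n).

Definition U2_block (l : nat) (t : R) : coefs R := fun n =>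
  \sum_(k < 2 ^ l) (\1_(`[dyadic_time l k, dyadic_time l k.+1[%classic) t)%:C * U2_value l k n.

Lemma U2_coef_gt0 l : 0 < U2_coef l.
Proof. by case: l => // l; rewrite !mulr_gt0 ?powR_gt0// exprn_gt0// powR_gt0. Qed.

Lemma dyadic_time_in l k : (k < 2 ^ l)%N -> a <= dyadic_time l k < b.
Proof.
move=> kl; rewrite /dyadic_time lerDl divr_ge0 ?exprn_ge0 ?mulr_ge0 ?(ltW ba0)//=.
rewrite -ltrBrDl ltr_pdivrMr ?exprn_gt0// ltr_pM2l//.
by rewrite -natrX ltr_nat.
Qed.

Lemma dyadic_parent l k : (k < 2 ^ l.+1)%N -> (k./2 < 2 ^ l)%N.
Proof. by move=> kl; rewrite -ltn_double -[(2 ^ l).*2]mul2n -expnS (leq_ltn_trans _ kl)// -[leqRHS]odd_double_half leq_addl. Qed.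

Lemma FLle_U2_value l k : (k < 2 ^ l)%N -> FLle (U2_value l k) ((2 ^+ l) `^ (- 2^-1)).
Proof.
move=> kl; have c0 := U2_coef_gt0 l.
case: l => [|l] in kl c0 *.
  have := FLle_scale hr (U2_coef 0)^-1%:C wa.
  by rewrite normc_real ger0_norm ?invr_ge0 ?(ltW c0)// /= mulVf ?gt_eqF// expr0 powR1.
have h := wB (dyadic_time_in kl) (dyadic_time_in (dyadic_parent kl)).
have := FLle_scale hr (U2_coef l.+1)^-1%:C h.
rewrite normc_real ger0_norm ?invr_ge0 ?(ltW c0)//.
apply: FLle_le; rewrite ler_pdivrMl//.
have d : `|dyadic_time l.+1 k - dyadic_time l k./2| <= (b - a) / 2 ^+ l.+1.
  have -> : dyadic_time l.+1 k - dyadic_time l k./2 = (b - a) * (odd k)%:R / 2 ^+ l.+1.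
    rewrite /dyadic_time -{1}[k]odd_double_half natrD -muln2 natrM exprS.
    by field; rewrite expf_neq0.
  rewrite ger0_norm ?divr_ge0 ?exprn_ge0 ?mulr_ge0 ?(ltW ba0)//.
  by rewrite ler_wpM2r ?invr_ge0 ?exprn_ge0// ler_piMr ?(ltW ba0)// lern1; case: (odd k).
have g0 : 0 <= gamma by apply: ltW; apply: lt_trans hg; rewrite divr_gt0.
have := ge0_ler_powR g0 _ _ d; rewrite !nnegrE => /(_ (normr_ge0 _)).
rewrite divr_ge0 ?exprn_ge0 ?(ltW ba0)// => /(_ isT) => d'.
apply: le_trans (ler_wpM2l (ltW B0) d') _.
rewrite /= /dyadic_atom_size /th -!powR_mulrn ?powR_ge0// -!powRrM -!mulrA.
rewrite ler_wpM2l ?(ltW B0)// powRM ?invr_ge0 ?powR_ge0 ?(ltW ba0)// ler_wpM2l ?powR_ge0//.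
rewrite -powR_inv1 ?powR_ge0// -!powRrM -powRD ?pnatr_eq0 ?implybT//.
by apply: eq_ler; congr powR; ring.
Qed.

Lemma U2_block_atom l : valued_atom s r P a b (U2_block l).
Proof.
exists (2 ^ l)%N, (dyadic_time l), (U2_value l); split.
- rewrite /dyadic_time mulr0 mul0r addr0; split=> //.
  by rewrite natrX mulfK ?expf_neq0// addrC subrK.
- move=> k _; rewrite lerD2l ler_wpM2r ?invr_ge0 ?exprn_ge0// ler_wpM2l ?ler_nat//.
  exact: ltW.
- move=> k kl; split.
    by have := FLle_U2_value kl; rewrite /in_FLT /FLle => /le_lt_trans; apply; exact: ltry.
  rewrite /U2_value; case: l kl => [|l] kl; apply: PZ.
    by apply: wP; rewrite lexx ab.
  by apply: PB; apply: wP; apply: dyadic_time_in => //; exact: dyadic_parent.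
- apply: (@le_trans _ _ (\sum_(k < 2 ^ l) ((2 ^+ l)^-1)%:E)%E).
    apply: lee_sum => k _.
    have h := FLle_U2_value (ltn_ord k).
    rewrite -[(_ ^+ 2)%E]/(_ * _)%E; apply: le_trans (lee_pmul _ _ h h) _; rewrite ?FLT_norm_ge0//.
    rewrite -EFinM lee_fin -powRD; last by rewrite expf_neq0 ?implybT.
    have -> : - 2^-1 + - 2^-1 = -1 :> R by field.
    by rewrite powR_inv1 ?exprn_ge0.
  by rewrite sumEFin sumr_const card_ord lee_fin -[_ *+ _]mulr_natr natrX mulVf ?expf_neq0.
- by [].
Qed.

Lemma U2_blockE l t n : a <= t < b -> (U2_coef l)%:C * U2_block l t n =
  if l is l'.+1 then w (dyadic_floor l t) n - w (dyadic_floor l' t) n else w a n.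
Proof.
move=> /andP[at0 tb]; have c0 := U2_coef_gt0 l.
have il : (dyadic_index l t < 2 ^ l)%N.
  have x0 : 0 <= 2 ^+ l * ((t - a) / (b - a)).
    by rewrite mulr_ge0 ?exprn_ge0// divr_ge0 ?subr_ge0// ltW.
  rewrite /dyadic_index truncn_lt_nat// natrX gtr_pMr ?exprn_gt0//.
  by rewrite ltr_pdivrMr// mul1r ltrD2r.
have -> : U2_block l t n = U2_value l (dyadic_index l t) n.
  rewrite /U2_block (bigD1 (Ordinal il))//= big1 ?addr0; last first.
    move=> k /eqP ki; rewrite indicE memNset ?mul0r//= in_itv/= -dyadic_indexP//.
    by apply: contra_not ki => /eqP e; apply: val_inj.
  by rewrite indicE mem_set ?mul1r//= in_itv/= -dyadic_indexP.
rewrite /U2_value mulrA -mul_real_complex mulfV ?gt_eqF// mul1r.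
by case: l il c0 => // l il c0; rewrite /dyadic_floor -dyadic_index_half.
Qed.

Lemma dyadic_floor_le l t : a <= t < b -> a <= dyadic_floor l t < b /\
  `|t - dyadic_floor l t| <= (b - a) / 2 ^+ l.
Proof.
move=> /andP[at0 tb].
have := @dyadic_indexP l t (dyadic_index l t) at0; rewrite eqxx => /esym /andP[k1 k2].
split.
  rewrite (le_lt_trans k1 tb) andbT /dyadic_floor /dyadic_time lerDl.
  by rewrite divr_ge0 ?exprn_ge0 ?mulr_ge0 ?(ltW ba0).
rewrite ger0_norm ?subr_ge0// lerBlDl (le_trans (ltW k2))//.
rewrite /dyadic_floor /dyadic_time -[_.+1]addn1 natrD mulrDr mulr1 mulrDl addrA.
by [].
Qed.

(** The partial sums telescope to w evaluated at the largest dyadic time of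
    generation l before t, and the coefficients form a geometric series. *)
Lemma hoelder_U2 : U2_representation s r a b w (fun l => (U2_coef l)%:C) U2_block /\
  (l1_norm (fun l => (U2_coef l)%:C) <= (A0 + U2_const * (B * (b - a) `^ gamma))%:E)%E.
Proof.
have l1 : (l1_norm (fun l => (U2_coef l)%:C) <= (A0 + U2_const * (B * (b - a) `^ gamma))%:E)%E.
  apply: lime_le.
    by apply: is_cvg_nneseries => j _ _; rewrite lee_fin normc_ge0.
  apply: nearW => J; rewrite sumEFin lee_fin.
  have Bba : 0 <= B * (b - a) `^ gamma by rewrite mulr_ge0 ?powR_ge0 ?(ltW B0).
  under eq_bigr do rewrite normc_real ger0_norm ?(ltW (U2_coef_gt0 _))//.
  case: J => [|J]; first by rewrite big_geq// addr_ge0 ?(ltW A00)// mulr_ge0 ?(ltW U2_const_gt0).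
  rewrite big_nat_recl//= lerD2l /dyadic_atom_size -mulr_sumr mulrC ler_wpM2r//.
  apply: (@le_trans _ _ (\sum_(0 <= i < J.+1) th ^+ i)).
    by rewrite [leRHS]big_nat_recl//= expr0 lerDr.
  have e : (1 - th) * \sum_(0 <= i < J.+1) th ^+ i = 1 - th ^+ J.+1.
    by rewrite big_mkord -[1 - th]opprB mulNr -subrX1 opprB.
  rewrite -[leRHS]mul1r ler_pdivlMr ?subr_gt0 ?dyadic_ratio_lt1// mulrC e.
  by rewrite gerBl exprn_ge0// dyadic_ratio_ge0.
split=> //; split.
- by move=> l; apply: valued_atom_U2; exact: U2_block_atom.
- by apply: le_lt_trans l1 _; exact: ltry.
move=> t; rewrite in_itv/= => tab.
have e J n : \sum_(j < J.+1) (U2_coef j)%:C * U2_block j t n = w (dyadic_floor J t) n.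
  have S (F : nat -> R[i]) m : \sum_(j < m.+1) F j = \sum_(j < m) F j + F m.
    by rewrite big_ord_recr.
  elim: J => [|J IH].
    rewrite big_ord1 (U2_blockE 0 n tab).
    have d0 : dyadic_index 0 t = 0%N.
      apply/eqP; have /andP[at0 tb] := tab; rewrite dyadic_indexP//.
      by rewrite /dyadic_time mulr0 mul0r addr0 expr0 divr1 mulr1 addrC subrK at0.
    by rewrite /dyadic_floor d0 /dyadic_time mulr0 mul0r addr0.
  by rewrite (S (fun j => (U2_coef j)%:C * U2_block j t n)) IH (U2_blockE J.+1 n tab) addrC subrK.
have g0 : 0 < gamma by apply: lt_trans hg; rewrite divr_gt0.
rewrite -cvg_shiftS.
refine (squeeze_cvge (f := fun=> 0%E) (h := fun J =>
  (geometric (B * (b - a) `^ gamma) (2^-1 `^ gamma) J)%:E) (l := 0%E) _ _ _).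
- apply: nearW => J; rewrite FLT_norm_ge0/=.
  rewrite (_ : (fun n => _) = (fun n => w t n - w (dyadic_floor J t) n)); last first.
    by apply/funext => n; rewrite e.
  have [fl d] := dyadic_floor_le J tab.
  apply: FLle_le (wB tab fl); rewrite /= -mulrA ler_wpM2l ?(ltW B0)//.
  apply: le_trans (ge0_ler_powR (ltW g0) _ _ d) _; rewrite ?nnegrE//.
    by rewrite divr_ge0 ?exprn_ge0 ?(ltW ba0).
  rewrite powRM ?invr_ge0 ?exprn_ge0 ?(ltW ba0)// -exprVn.
  have -> x : 0 <= x -> (x ^+ J) `^ gamma = (x `^ gamma) ^+ J.
    by move=> x0; rewrite -powR_mulrn ?powR_ge0// -(powR_mulrn J x0) -!powRrM mulrC.
  - exact: lexx.
  - by rewrite invr_ge0.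
- exact: cvg_cst.
- apply/cvg_EFin; first exact: nearW.
  apply: cvg_geometric; rewrite ger0_norm ?powR_ge0//.
  have : 2^-1 < 1 :> R by rewrite invf_lt1 ?ltr1n.
  move=> /(gt0_ltr_powR g0); rewrite !nnegrE invr_ge0 powR1 => h.
  exact: h.
Qed.

End Hoelder.

(** * The interaction picture *)

(** In the interaction picture w(t) = e^{W_t L} u(t) the linear evolution
    disappears. *)
Section InteractionPicture.
Variables (R : realType) (s : R) (r : \bar R) (gamma rho : R) (W : R -> R).
Implicit Types (U : R -> coefs R) (u : coefs R).

Lemma FLT_norm_expL x u : FLT_norm s r (expL x u) = FLT_norm s r u.
Proof.
by rewrite /FLT_norm; congr Lnorm; apply/funext => n; rewrite normc_expiM.
Qed.

Lemma FLle_expL x u B : FLle s r (expL x u) B = FLle s r u B.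
Proof.
by rewrite /FLle FLT_norm_expL.
Qed.

Lemma expLK x u : expL (- x) (expL x u) = u.
Proof. by apply/funext => n; rewrite /expL mulrA -expiD mulNr opprK subrr expi0 mul1r. Qed.

Lemma expL_sub x u v : expL x (fun n => u n - v n) = fun n => expL x u n - expL x v n.
Proof. by apply/funext => n; rewrite /expL mulrBr. Qed.

End InteractionPicture.

(** * Hoelder classes *)

Section HoelderClass.
Variables (R : realType) (s : R) (r : \bar R) (gamma : R).
Hypotheses (hs : 0 <= s) (hr : (1 <= r)%E) (hg : 1 / 2 < gamma).
Local Notation FLle := (FLle s r).
Implicit Types (w : R -> coefs R) (u v : coefs R).

Lemma FLle_inf u B : (forall B', B < B' -> FLle u B') -> FLle u B.
Proof.
move=> h; apply/lee_addgt0Pr => e e0; rewrite -EFinD.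
by apply: h; rewrite ltrDl.
Qed.

Lemma FLle_eq0 u : FLle u 0 -> u =1 fun=> 0.
Proof.
move=> u0 n; have := FLle_coord hs hr n u0.
by move=> un; apply: eq0_normc; apply/eqP; rewrite eq_le un normc_ge0.
Qed.

Definition hoelder_on (a b : R) w (B : R) := forall t t', a <= t < b -> a <= t' < b ->
  FLle (fun n => w t n - w t' n) (B * `|t - t'| `^ gamma).

(** Norms do not see the sign, so increments forward in time suffice. *)
Lemma hoelder_forward a b w B :
  (forall t t', a <= t -> t <= t' -> t' < b ->
     FLle (fun n => w t' n - w t n) (B * (t' - t) `^ gamma)) -> hoelder_on a b w B.
Proof.
move=> h t t' /andP[t0 tb] /andP[t'0 t'b].
have [tt'|/ltW t't] := leP t t'; last by rewrite ger0_norm ?subr_ge0//; exact: h.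
rewrite distrC ger0_norm ?subr_ge0//.
apply: FLle_mono (h t t' t0 tt' t'b) => // n.
by rewrite normc_sub.
Qed.

Lemma hoelder_le a b w B B' : B <= B' -> hoelder_on a b w B -> hoelder_on a b w B'.
Proof.
move=> BB h t t' ht ht'; apply: FLle_le (h t t' ht ht').
by rewrite ler_wpM2r// powR_ge0.
Qed.

(** The infimum of the admissible constants is admissible: for fixed times the
    bound is a continuous function of the constant. *)
Lemma hoelder_inf a b w B : (forall B', B < B' -> hoelder_on a b w B') -> hoelder_on a b w B.
Proof.
move=> h t t' ht ht'; apply: FLle_inf => B' BB'.
have [tt'|tt'] := eqVneq t t'.
  apply: FLle_le (h (B + 1) _ t t' ht ht'); last by rewrite ltrDl.
  have g0 : gamma != 0 by rewrite gt_eqF// (lt_trans _ hg)// divr_gt0.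
  move: BB'; rewrite tt' subrr normr0 powR0// !mulr0.
  exact: ltW.
have p0 : 0 < `|t - t'| `^ gamma by rewrite powR_gt0// normr_gt0 subr_eq0.
apply: FLle_le (h (B' / `|t - t'| `^ gamma) _ t t' ht ht').
  by rewrite divfK// gt_eqF.
by rewrite ltr_pdivlMr.
Qed.

Lemma hoelder_sub a b w w' B B' : hoelder_on a b w B -> hoelder_on a b w' B' ->
  hoelder_on a b (fun t n => w t n - w' t n) (B + B').
Proof.
move=> h h' t t' ht ht'; rewrite mulrDl.
apply: FLle_mono (FLle_sub hr (h t t' ht ht') (h' t t' ht ht')) => // n.
apply: eq_ler; congr normc; ring.
Qed.

Lemma hoelder_norm a b w A0 B t : a < b -> hoelder_on a b w B -> FLle (w a) A0 -> a <= t < b ->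
  FLle (w t) (A0 + B * (t - a) `^ gamma).
Proof.
move=> ab h h0 tab; have /andP[at0 tb] := tab.
have haa : a <= a < b by rewrite lexx ab.
have := FLle_add hr h0 (h t a tab haa); rewrite ger0_norm ?subr_ge0//.
by apply: FLle_mono => // n; rewrite addrC subrK.
Qed.

Local Notation K := (U2_const gamma).

(** The decomposition requires positive constants; nonnegative ones are enlarged a
    little, at the price of a strict inequality. *)
Lemma hoelder_in_U2 a b w A0 B L : a < b -> 0 <= A0 -> 0 <= B ->
  FLle (w a) A0 -> hoelder_on a b w B -> A0 + K * (B * (b - a) `^ gamma) < L ->
  exists lam A, U2_representation s r a b w lam A /\ (l1_norm lam <= L%:E)%E.
Proof.
move=> ab A00 B0 h0 h hL.
have K0 := U2_const_gt0 hg.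
have p0 : 0 < (b - a) `^ gamma by rewrite powR_gt0// subr_gt0.
pose e := (L - (A0 + K * (B * (b - a) `^ gamma))) / 2.
have e0 : 0 < e by rewrite divr_gt0 ?subr_gt0.
pose e' := e / (K * (b - a) `^ gamma).
have e'0 : 0 < e' by rewrite divr_gt0// mulr_gt0.
have A1 : 0 < A0 + e by rewrite ltr_wpDl.
have B1 : 0 < B + e' by rewrite ltr_wpDl.
have h0' : FLle (w a) (A0 + e) by apply: FLle_le h0; rewrite lerDl ltW.
have h' : hoelder_on a b w (B + e') by apply: hoelder_le h; rewrite lerDl ltW.
have [rep l1] := hoelder_U2 hr hg ab A1 B1 h0' h' (P := setT) (fun _ _ _ => I) (fun _ _ _ _ => I) (fun _ _ => I).
eexists; eexists; split; first exact: rep.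
apply: le_trans l1 _; rewrite lee_fin.
have : K * (e' * (b - a) `^ gamma) = e.
  by rewrite /e'; field; rewrite !gt_eqF.
by rewrite /e; nra.
Qed.

Lemma U2_approximable_extend a b w lam A L : U2_representation s r a b w lam A ->
  (l1_norm lam <= L%:E)%E ->
  approximable s r gamma `]-oo, b[ (fun t n => if t < a then 0 else w t n) L.
Proof.
move=> [hA hl hw] lL.
apply: (U2_approximable hr hg hs (a := a) (lam := lam) (A := A)) => //; last by move=> t ->.
split=> // t ht; have := hw t ht; move: ht; rewrite in_itv/= => /andP[at0 _].
by rewrite ltNge at0.
Qed.

Lemma U2_approximable_itv a b w lam A L : U2_representation s r a b w lam A ->
  (l1_norm lam <= L%:E)%E -> approximable s r gamma `[a, b[ w L.
Proof.
move=> rep lL; have h := U2_approximable_extend rep lL.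
apply: eq_approximable (approximableS _ h); last by move=> t /=; rewrite !in_itv/= => /andP[].
by move=> t /=; rewrite in_itv/= => /andP[at0 _] n; rewrite ltNge at0.
Qed.

(** A function that vanishes before a and is Hoelder continuous from a on; the
    two pieces need not match at a, as step functions may jump. *)
Lemma hoelder_approximable a b w A0 B L : 0 <= a -> a < b -> 0 <= A0 -> 0 <= B ->
  (forall t, 0 <= t < a -> w t =1 fun=> 0) ->
  FLle (w a) A0 -> hoelder_on a b w B -> A0 + K * (B * (b - a) `^ gamma) < L ->
  approximable s r gamma `[0, b[ w L.
Proof.
move=> a0 ab A00 B0 w0 h0 h hL.
have [lam [A [rep lL]]] := hoelder_in_U2 ab A00 B0 h0 h hL.
have ha := U2_approximable_extend rep lL.
apply: eq_approximable (approximableS _ ha); last by move=> t /=; rewrite !in_itv/= => /andP[].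
move=> t /=; rewrite in_itv/= => /andP[t0 _] n; case: ltP => // ta.
by rewrite w0// t0.
Qed.

End HoelderClass.

(** * The closure of the trigonometric polynomials *)

Section Closure.
Variables (R : realType) (s : R) (r : \bar R) (gamma : R).
Hypotheses (hs : 0 <= s) (hr : (1 <= r)%E) (hg : 1 / 2 < gamma).
Local Notation FLle := (FLle s r).
Local Notation clos := (in_FLT_closure s r).
Implicit Types (u v : coefs R).

Definition finitely_supported u := finite_set [set n | u n != 0].

Lemma closureP u : clos u <-> forall e : R, 0 < e ->
  exists2 v, finitely_supported v & FLle (fun n => u n - v n) e.
Proof.
split=> h e e0.
  by have [v fv uv] := h e e0; exists v => //; exact: ltW.
have [v fv uv] := h (e / 2) (divr_gt0 e0 (ltr0Sn _ _)).
exists v => //; apply: le_lt_trans uv _.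
by rewrite lte_fin ltr_pdivrMr// ltr_pMr// ltr1n.
Qed.

Lemma finsupp_sub u v : finitely_supported u -> finitely_supported v -> finitely_supported (fun n => u n - v n).
Proof.
move=> fu fv; apply: (@sub_finite_set _ _ ([set n | u n != 0] `|` [set n | v n != 0])).
  move=> n /= nz; apply/orP; move: nz; apply: contraNT.
  by rewrite negb_or !negbK => /andP[/eqP -> /eqP ->]; rewrite subrr.
by rewrite finite_setU.
Qed.

Lemma finsupp_mul (c : int -> R[i]) u : finitely_supported u -> finitely_supported (fun n => c n * u n).
Proof. by apply: sub_finite_set => n /=; apply: contraNN => /eqP ->; rewrite mulr0. Qed.

Lemma closure_finsupp u : finitely_supported u -> clos u.
Proof.
move=> fu; apply/closureP => e e0; exists u => //.
rewrite (_ : (fun n => _) = fun=> 0); last by apply/funext => n; rewrite subrr.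
exact: FLle_le (ltW e0) (FLle0 s hr).
Qed.

Lemma closure_sub u v : clos u -> clos v -> clos (fun n => u n - v n).
Proof.
move=> /closureP cu /closureP cv; apply/closureP => e e0.
have e2 : 0 < e / 2 by exact: divr_gt0.
have [u' fu hu] := cu _ e2; have [v' fv hv] := cv _ e2.
exists (fun n => u' n - v' n); first exact: finsupp_sub.
apply: FLle_mono (FLle_le _ (FLle_sub hr hu hv)) => [//|n|]; last by rewrite -splitr.
by apply: eq_ler; congr normc; ring.
Qed.

Lemma closure_scale (c : R[i]) u : clos u -> clos (fun n => c * u n).
Proof.
move=> /closureP cu; apply/closureP => e e0.
have c1 : 0 < normc c + 1 by rewrite ltr_wpDl ?normc_ge0.
have [u' fu hu] := cu _ (divr_gt0 e0 c1).
exists (fun n => c * u' n); first exact: finsupp_mul.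
have := FLle_scale hr c hu; rewrite (_ : (fun n => c * (u n - u' n)) = fun n => c * u n - c * u' n); last first.
  by apply/funext => n; rewrite mulrBr.
apply: FLle_le; rewrite mulrA ler_pdivrMr// mulrC ler_wpM2l ?(ltW e0)//.
by rewrite lerDl.
Qed.

Lemma closure_lim u : (forall e : R, 0 < e -> exists2 v, clos v & FLle (fun n => u n - v n) e) ->
  clos u.
Proof.
move=> h; apply/closureP => e e0.
have e2 : 0 < e / 2 by exact: divr_gt0.
have [v /closureP cv huv] := h _ e2; have [v' fv hv] := cv _ e2.
exists v' => //.
apply: FLle_mono (FLle_le _ (FLle_add hr huv hv)) => [//|n|]; last by rewrite -splitr.
by rewrite addrA subrK.
Qed.

Lemma closure_expL x u : clos u -> clos (expL x u).
Proof.
move=> /closureP cu; apply/closureP => e e0; have [v fv huv] := cu e e0.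
exists (expL x v); first exact: finsupp_mul.
by rewrite -expL_sub FLle_expL.
Qed.

Lemma stepfun_finsupp (S : step R) : (forall i : stidx S, finitely_supported (stval i)) ->
  exists2 A, finite_set A & forall t n, ~ A n -> stepfun S t n = 0.
Proof.
move=> fS; rewrite /stepfun; elim: (stlist S) => [|i l [A fA hA]].
  by exists set0 => // t n _; rewrite big_nil.
exists (A `|` [set n | stval i n != 0]); first by rewrite finite_setU; split => //; exact: fS.
move=> t n /not_orP[An]; rewrite /= => /negP; rewrite negbK => /eqP i0.
by rewrite big_cons i0 mul0r add0r hA.
Qed.

Lemma approximable_step D (S : step R) L : step_bounded s r gamma S L ->
  approximable s r gamma D (stepfun S) L.
Proof. by move=> SL; exists (fun=> S); split=> // t _ n; exact: ccvg_cst. Qed.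

(** Each of the finitely many values is moved by a share e/N of the allowed error;
    the cutting constant of the perturbation is then at most e. *)
Lemma step_finsupp_approx (S : step R) L e : step_bounded s r gamma S L ->
  (forall i : stidx S, clos (stval i)) -> 0 < e ->
  exists S' : step R, [/\ step_bounded s r gamma S' (L + e),
    (forall i : stidx S', finitely_supported (stval i)) &
    forall D, approximable s r gamma D (fun t n => stepfun S' t n - stepfun S t n) e].
Proof.
move=> [lr vb cut] cS e0.
pose N : R := (size (stlist S))%:R + 1.
have N0 : 0 < N by rewrite ltr_wpDl.
have d0 : 0 < e / N by exact: divr_gt0.
have /choice[v hv] (i : stidx S) : exists v : coefs R, finitely_supported v /\ FLle (fun n => stval i n - v n) (e / N).
  by have /closureP/(_ _ d0)[v fv hv] := cS i; exists v.
have sumN (c : stidx S -> R) x y : (forall i, 0 <= c i <= (y - x) `^ gamma) ->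
    \sum_(i <- stlist S) e / N * c i <= e * (y - x) `^ gamma.
  move=> hc; apply: (@le_trans _ _ (\sum_(i <- stlist S) e / N * (y - x) `^ gamma)).
    by apply: ler_sum => i _; rewrite ler_wpM2l ?(ltW d0)//; case/andP: (hc i).
  rewrite big_const_seq count_predT iter_addr_0 -mulr_natr mulrAC ler_wpM2r ?powR_ge0//.
  by rewrite mulrAC ler_pdivrMr// ler_wpM2l ?(ltW e0)// lerDl.
have len x y i : x <= y ->
    0 <= (clamp x y (stright i) - clamp x y (@stleft R S i)) `^ gamma <= (y - x) `^ gamma.
  move=> xy; have /andP[l0 l1] := clamp_len xy (lr i); rewrite powR_ge0/=.
  have g0 : 0 <= gamma by rewrite (le_trans _ (ltW hg))// divr_ge0.
  by apply: ge0_ler_powR => //; rewrite nnegrE ?subr_ge0.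
exists (@Step R (stidx S) (stlist S) (@stleft R S) (@stright R S) v (fun i => stbound i + e / N)).
split=> [|i|D].
- split=> [//|i|x y xy] /=.
    have := FLle_sub hr (vb i) (hv i).2.
    by apply: FLle_mono => // n; rewrite opprB addrC subrK.
  under eq_bigr do rewrite mulrDl.
  rewrite big_split mulrDl; apply: lerD; first exact: cut.
  by apply: sumN => i; exact: len.
- exact: (hv i).1.
- pose S2 := @Step R (stidx S) (stlist S) (@stleft R S) (@stright R S)
    (fun i n => v i n - stval i n) (fun=> e / N).
  apply: (@eq_approximable _ _ _ _ _ (stepfun S2)).
    by move=> t _ n; rewrite /stepfun/= -sumrB; apply: eq_bigr => i _; rewrite mulrBl.
  apply: approximable_step; split=> [//|i|x y xy] /=.
    by apply: FLle_mono (hv i).2 => // n; rewrite normc_sub.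
  by apply: sumN => i; exact: len.
Qed.

(** The values of the atoms are differences of values of w, hence in the closure;
    finitely many atoms suffice up to an error of e/2, and the values of those are
    replaced by finitely supported ones. *)
Lemma hoelder_finsupp_approx (a b : R) (w : R -> coefs R) (A0 B : R) : a < b -> 0 <= A0 -> 0 <= B ->
  FLle (w a) A0 -> hoelder_on s r gamma a b w B -> (forall t, a <= t < b -> clos (w t)) ->
  exists2 L : R, 0 <= L & forall e, 0 < e -> exists S : step R,
    [/\ step_bounded s r gamma S L, (forall i : stidx S, finitely_supported (stval i)) &
        approximable s r gamma `[a, b[ (fun t n => w t n - stepfun S t n) e].
Proof.
move=> ab A00 B0 h0 hB cw.
have A1 : 0 < A0 + 1 by rewrite ltr_wpDl.
have B1 : 0 < B + 1 by rewrite ltr_wpDl.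
have h0' : FLle (w a) (A0 + 1) by apply: FLle_le h0; rewrite lerDl.
have h' : hoelder_on s r gamma a b w (B + 1) by apply: hoelder_le hB; rewrite lerDl.
have [rep l1] := hoelder_U2 hr hg ab A1 B1 h0' h' closure_scale closure_sub cw.
have hA := U2_block_atom hr hg ab A1 B1 h0' h' closure_scale closure_sub cw.
set lam := (fun l => _) in rep l1; set A := U2_block _ _ _ _ _ _ in rep hA.
set L := _ + _ in l1.
have L0 : 0 <= L.
  by rewrite addr_ge0 ?(ltW A1)// mulr_ge0 ?(ltW (U2_const_gt0 hg))// mulr_ge0 ?powR_ge0 ?(ltW B1).
exists (L + 1); first by rewrite addr_ge0.
move=> e e0.
have c0 : clos (fun=> 0).
  by apply: closure_finsupp; apply: (@sub_finite_set _ _ set0) => // n /=; rewrite eqxx.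
have lfin : (l1_norm lam < +oo)%E by exact: le_lt_trans l1 (ltry _).
have e2 : 0 < e / 2 by exact: divr_gt0.
have [J hJ] : exists J, (\sum_(J <= j <oo) (normc (lam j))%:E <= (e / 2)%:E)%E.
  have := nneseries_tail_cvg lfin (fun j _ => normc_ge0 _ : (0 <= (normc (lam j))%:E)%E).
  move=> /fine_cvgP[fin /cvgrPdist_lt /(_ _ e2) near].
  have [J [fJ]] := filter_ex (filterI fin near).
  rewrite sub0r normrN => /ltW hJ; exists J.
  by rewrite -(fineK fJ) lee_fin (le_trans (ler_norm _)).
have tail J' : \sum_(J <= j < J') normc (lam j) <= e / 2.
  rewrite -lee_fin -sumEFin; apply: le_trans hJ.
  by apply: (nneseries_lim_ge (u_ := fun j => (normc (lam j))%:E) (P := xpredT)) => j _ _; rewrite lee_fin normc_ge0.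
have [S [Sb Se SP]] := atoms_step hr hg lam 0 J c0 closure_scale hA.
pose e1 := Num.min 1 (e / 2).
have e10 : 0 < e1 by rewrite lt_min ltr01.
have [S' [S'b S'f S'a]] := step_finsupp_approx Sb SP e10.
exists S'; split=> //.
  by apply: step_bounded_le S'b; rewrite lerD ?ge_min ?lexx// l1_norm_partial.
have aT : approximable s r gamma `[a, b[ (fun t n => w t n - stepfun S t n) (e / 2).
  have /choice[Q hQ] J' : exists Q : step R, step_bounded s r gamma Q (e / 2) /\
      forall t n, stepfun Q t n = \sum_(J <= j < J') lam j * A j t n.
    have [Q [Qb Qe _]] := atoms_step hr hg lam J J' c0 closure_scale hA.
    by exists Q; split=> //; exact: step_bounded_le Qb.
  exists Q; split=> [j|t]; first exact: (hQ j).1.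
  rewrite /= in_itv/= => tab n.
  have c := ccvgB (U2_ccvg hr n hs rep tab) (ccvg_cst (stepfun S t n)).
  apply: cvg_trans c; apply: near_eq_cvg.
  exists J => // J' /= JJ'; rewrite (hQ J').2 Se.
  have -> : \sum_(0 <= j < J') lam j * A j t n =
      \sum_(0 <= j < J) lam j * A j t n + \sum_(J <= j < J') lam j * A j t n.
    by rewrite -big_cat_nat.
  by rewrite [_ + \sum_(J <= j < J') _]addrC addrK.
have aD := approximable_sub hr aT (S'a `[a, b[%classic).
apply: (@approximable_le _ _ _ _ _ _ (e / 2 + e1)).
  by rewrite [leRHS]splitr lerD2l ge_min lexx orbT.
by apply: eq_approximable aD => t _ n; rewrite opprB addrA subrK.
Qed.

End Closure.

(** * Continuity in time *)

(** A finite set whose sum is within e of the supremum works. *)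
Lemma finite_sums_tail (R : realType) (f : int -> R) (B : R) : (forall n, 0 <= f n) ->
  (forall F, uniq F -> \sum_(n <- F) f n <= B) -> forall e, 0 < e ->
  exists2 F, uniq F & forall G, uniq G -> {in G, forall n, n \notin F} -> \sum_(n <- G) f n <= e.
Proof.
move=> f0 fB e e0.
pose A := [set x | exists2 F : seq int, uniq F & x = \sum_(n <- F) f n].
have A0 : A !=set0 by exists 0, [::] => //; rewrite big_nil.
have ubA : has_ubound A by exists B => x [F uF ->]; exact: fB.
have [x [F uF ->] hx] := sup_adherent e0 (conj A0 ubA).
exists F => // G uG GF.
have u : uniq (F ++ G).
  rewrite cat_uniq uF uG andbT /=; apply/hasPn => n nG; exact: GF.
have := ub_le_sup ubA (ex_intro2 _ _ (F ++ G) u erefl).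
by rewrite big_cat/=; lra.
Qed.

Section Continuity.
Variables (R : realType) (s : R) (r : \bar R).
Hypotheses (hs : 0 <= s) (hr : (1 <= r)%E).
Local Notation FLle := (FLle s r).
Local Notation clos := (in_FLT_closure s r).

(** For finite exponents tails of the norm vanish. *)
Lemma closure_of_finite (u : coefs R) : r != +oo%E -> in_FLT s r u -> clos u.
Proof.
move=> roo uf; apply/closureP => e e0.
have [[p p1 rp]|rp] := exponent_cases hr; last by rewrite rp eqxx in roo.
have p0 : 0 < p by exact: lt_le_trans p1.
have hB := fine_FLle uf; have B0 := FLle_ge0 hB.
have h := (FLleP_fin s u p1 rp B0).1 hB.
have [|F uF hF] := finite_sums_tail _ h (powR_gt0 p e0); first by move=> n; exact: powR_ge0.
exists (restr F u).
  apply: (@sub_finite_set _ _ [set` F]); last exact: finite_seq.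
  by move=> n /=; rewrite /restr; case: ifP => //; rewrite eqxx.
apply/(FLleP_fin _ _ p1 rp (ltW e0)) => G uG.
rewrite (bigID (mem F))/= big1_seq ?add0r; last first.
  move=> n /andP[nF _]; rewrite /wmod /restr nF subrr normc0 mulr0 powR0//.
  by rewrite gt_eqF.
rewrite -big_filter.
have := hF [seq n <- G | n \notin F] (filter_uniq _ uG).
move=> /(_ _)/le_trans hh; apply: (le_trans _ (hF [seq n <- G | n \notin F] (filter_uniq _ uG) _)).
  apply: eq_ler; rewrite !big_filter; apply: eq_bigr => n nF.
  by rewrite /wmod /restr (negbTE nF) subr0.
by move=> n; rewrite mem_filter => /andP[].
Qed.

Lemma cvg_FLT_norm0 (F : set_system R) (V : R -> coefs R) : Filter F ->
  (forall e : R, 0 < e -> \forall t \near F, FLle (V t) e) ->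
  FLT_norm s r (V t) @[t --> F] --> 0%E.
Proof.
move=> FF h; apply/fine_cvgP; split.
  apply: filterS (h 1 ltr01) => t ht.
  by rewrite ge0_fin_numE ?FLT_norm_ge0// (le_lt_trans ht)// ltry.
apply/cvgrPdist_le => e e0; apply: filterS (h e e0) => t ht /=.
rewrite sub0r normrN ger0_norm ?fine_ge0 ?FLT_norm_ge0//.
rewrite -lee_fin fineK// ge0_fin_numE ?FLT_norm_ge0// (le_lt_trans ht)// ltry//.
Qed.

Variables (gamma T B : R) (W : R -> R) (w : R -> coefs R).
Hypotheses (g0 : 0 < gamma) (cW : continuous W) (B0 : 0 <= B) (hB : hoelder_on s r gamma 0 T w B).
Let U t : coefs R := expL (- W t) (w t).
Local Notation nbhsT t := (within `[0, T[%classic (nbhs t)).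

Lemma near_hoelder (t e : R) : 0 <= t < T -> 0 < e ->
  \forall t' \near nbhsT t, FLle (fun n => w t' n - w t n) e.
Proof.
move=> ht e0.
have B1 : 0 < B + 1 by rewrite ltr_wpDl.
pose d := (e / (B + 1)) `^ gamma^-1.
have d0 : 0 < d by rewrite powR_gt0// divr_gt0.
rewrite near_withinE; near=> t' => /=; rewrite in_itv/= => ht'.
apply: FLle_le (hB ht' ht).
have dist : `|t' - t| <= d.
  near: t'; rewrite near_simpl; apply/nbhs_ballP; exists d => //= x.
  by rewrite /ball/= distrC => /ltW.
apply: (@le_trans _ _ ((B + 1) * d `^ gamma)).
  apply: ler_pM => //; rewrite ?powR_ge0 ?lerDl//.
  by apply: ge0_ler_powR; rewrite ?nnegrE ?(ltW g0) ?(ltW d0).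
by rewrite -powRrM mulVf ?gt_eqF// powRr1 ?divr_ge0 ?(ltW e0) ?(ltW B1)// mulrC divfK ?gt_eqF.
Unshelve. all: by end_near.
Qed.

Lemma near_expi (t m e : R) : 0 < e ->
  \forall t' \near nbhsT t, normc (expi (- (- W t' * m)) - expi (- (- W t * m)) : R[i]) <= e.
Proof.
move=> e0.
have e2 : 0 < e / 2 by exact: divr_gt0.
have cm : {for t, continuous (fun t' => - (- W t' * m))}.
  by apply: continuousN; apply: continuousM; [apply: continuousN; exact: cW|exact: cst_continuous].
have cc : {for t, continuous (fun t' => cos (- (- W t' * m)))}.
  by apply: continuous_comp => //; exact: continuous_cos.
have cs : {for t, continuous (fun t' => sin (- (- W t' * m)))}.
  by apply: continuous_comp => //; exact: continuous_sin.
rewrite near_withinE.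
have /cvgrPdist_le/(_ _ e2) n1 := cc; have /cvgrPdist_le/(_ _ e2) n2 := cs.
apply: filterS2 n1 n2 => t' h1 h2 _.
apply: le_trans (normc_le_ReIm _) _.
by rewrite ReB ImB /= distrC [X in _ + X]distrC [leRHS]splitr lerD.
Qed.

(** The linear evolution is isometric, and strongly continuous on finitely
    supported sequences, hence on their closure. *)
Lemma closure_strongly_continuous : (forall t, 0 <= t < T -> clos (w t)) ->
  strongly_continuous s r T U.
Proof.
move=> cw t; rewrite in_itv/= => ht; apply: cvg_FLT_norm0 => e e0.
have e4 : 0 < e / 4 by exact: divr_gt0.
have /closureP/(_ _ e4)[v fv hv] := cw t ht.
pose F := fset_set [set n | v n != 0].
pose V t' : coefs R := fun n => expL (- W t') v n - expL (- W t) v n.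
have hV : \forall t' \near nbhsT t, FLle (V t') (e / 4).
  pose N : R := \sum_(n <- F) wmod s v n + 1.
  have N0 : 0 < N by rewrite ltr_wpDl// sumr_ge0// => n _; exact: wmod_ge0.
  have near1 n : \forall t' \near nbhsT t, normc (expi (- (- W t' * n%:~R ^+ 2)) - expi (- (- W t * n%:~R ^+ 2)) : R[i]) <= e / 4 / N.
    by apply: near_expi; exact: divr_gt0.
  have nearF (l : seq int) : \forall t' \near nbhsT t, {in l, forall n, normc (expi (- (- W t' * n%:~R ^+ 2)) - expi (- (- W t * n%:~R ^+ 2)) : R[i]) <= e / 4 / N}.
    elim: l => [|n l IH]; first exact: nearW.
    apply: filterS2 (near1 n) IH => t' h1 h2 m; rewrite inE => /predU1P[->//|].
    exact: h2.
  apply: filterS (nearF F) => t' ht'.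
  have hf : FLle (restr F (V t')) (\sum_(n <- F) wmod s (V t') n).
    by apply: FLle_fin_sum => //; exact: fset_uniq.
  apply: FLle_le (FLle_mono hr _ hf) => [|n].
    apply: (@le_trans _ _ (\sum_(n <- F) e / 4 / N * wmod s v n)).
      rewrite !big_seq; apply: ler_sum => n nF.
      rewrite /wmod /V /expL -mulrBl normc_mul mulrCA ler_wpM2r ?ht'//.
      by rewrite mulr_ge0 ?normc_ge0 ?powR_ge0.
    rewrite -mulr_sumr [X in _ * X](_ : _ = N - 1); last by rewrite /N addrK.
    by rewrite mulrBr divfK ?gt_eqF// gerBl mulr1 divr_ge0 ?(ltW e4) ?(ltW N0).
  rewrite /restr; case: ifPn => // nF.
  have : n \notin [set n | v n != 0].
    by move: nF; rewrite /F in_fset_set.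
  rewrite notin_setE/= => /negP; rewrite negbK => /eqP vn.
  by rewrite /V /expL vn !mulr0 subrr.
apply: filterS2 hV (near_hoelder ht e4) => t' h1 h2.
have h3 x : FLle (fun n => expL x (w t) n - expL x v n) (e / 4).
  by rewrite -expL_sub FLle_expL.
have h4 : FLle (fun n => expL (- W t') (w t') n - expL (- W t') (w t) n) (e / 4).
  by rewrite -expL_sub FLle_expL.
have := FLle_add hr (FLle_add hr h4 (FLle_sub hr (h3 (- W t')) (h3 (- W t)))) h1.
move=> h; apply: FLle_mono (FLle_le _ h) => [//|n|]; last by lra.
apply: eq_ler; congr normc; rewrite /U /V; ring.
Qed.

Lemma near_coefficient (t e : R) n : 0 <= t < T -> 0 < e ->
  \forall t' \near nbhsT t, normc (U t' n - U t n) <= e.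
Proof.
move=> ht e0; have e2 : 0 < e / 2 by exact: divr_gt0.
have c1 : 0 < normc (w t n) + 1 by rewrite ltr_wpDl ?normc_ge0.
have h1 := near_expi t (n%:~R ^+ 2) (divr_gt0 e2 c1).
apply: filterS2 h1 (near_hoelder ht e2) => t' h1 /(FLle_coord hs hr n) h2.
rewrite (_ : U t' n - U t n = expi (- (- W t' * n%:~R ^+ 2)) * (w t' n - w t n) +
  (expi (- (- W t' * n%:~R ^+ 2)) - expi (- (- W t * n%:~R ^+ 2))) * w t n); last first.
  by rewrite /U /expL; ring.
apply: le_trans (normc_triangle _ _) _; rewrite normc_expiM [leRHS]splitr lerD//.
rewrite normc_mul; apply: le_trans (ler_wpM2r (normc_ge0 _) h1) _.
by rewrite -mulrA ler_piMr ?(ltW e2)// mulrC ler_pdivrMr// mul1r lerDl.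
Qed.

(** Against a summable sequence only finitely many coefficients matter, and each
    coefficient is continuous in time. *)
Lemma bounded_weak_star_continuous : r = +oo%E -> FLle (w 0) B -> 0 < T -> T <= 1 ->
  weak_star_continuous s T U.
Proof.
move=> rp h0 T0 T1 v vf t; rewrite in_itv/= => ht e e0.
have wL x : 0 <= x < T -> FLle (w x) (2 * B).
  move=> hx; have /andP[x0 xT] := hx.
  apply: FLle_le (hoelder_norm hr T0 hB h0 hx).
  have : (x - 0) `^ gamma <= 1.
    have <- : 1 `^ gamma = 1 :> R by rewrite powR1.
    by rewrite subr0; apply: ge0_ler_powR; rewrite ?nnegrE ?(ltW g0) ?(le_trans (ltW xT) T1).
  by move=> /(ler_wpM2l B0); rewrite mulr1; lra.
pose a n := wmod (- s) v n.
have a0 n : 0 <= a n by exact: wmod_ge0.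
have hv := fine_FLle vf; set N := fine _ in hv.
have N0 := FLle_ge0 hv.
have aN F : uniq F -> \sum_(n <- F) a n <= N.
  move=> uF; have := (FLleP_fin (- s) v (lexx 1) erefl N0).1 hv F uF.
  by rewrite powRr1//; under eq_bigr do rewrite powRr1 ?wmod_ge0//.
have fa x n : 0 <= x < T -> normc ((U x n - U t n) * v n) <= 4 * B * a n.
  move=> hx; have UL y : 0 <= y < T -> wmod s (U y) n <= 2 * B.
    move=> hy; have : FLle (U y) (2 * B) by rewrite /U FLle_expL; exact: wL.
    by move/(FLleP_oo s _ _ rp).1.
  rewrite normc_mul /a /wmod.
  have w1 : 0 < weight s n by rewrite powR_gt0// (lt_le_trans ltr01)// japanese_ge1.
  have -> : weight (- s) n = (weight s n)^-1 by rewrite /weight powRN.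
  rewrite mulrA ler_wpM2r ?normc_ge0// ler_pdivlMr// mulrC.
  have := ler_wpM2l (ltW w1) (normc_triangle (U x n) (- U t n)); rewrite normc_opp mulrDr.
  by have := UL x hx; have := UL t ht; rewrite /wmod; lra.
have B4 : 0 < 4 * B + 1 by rewrite ltr_wpDl// mulr_ge0.
have e2 : 0 < e / 4 by exact: divr_gt0.
have [F uF tailF] := finite_sums_tail a0 aN (divr_gt0 e2 B4).
have nearF : \forall t' \near nbhsT t, \sum_(n <- F) normc ((U t' n - U t n) * v n) <= e / 4.
  pose V := \sum_(n <- F) normc (v n).
  have S0 : 0 < V + 1.
    by rewrite ltr_wpDl// sumr_ge0// => n _; exact: normc_ge0.
  have nearl (l : seq int) : \forall t' \near nbhsT t, {in l, forall n,
      normc (U t' n - U t n) <= e / 4 / (V + 1)}.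
    elim: l => [|n l IH]; first exact: nearW.
    apply: filterS2 (near_coefficient n ht (divr_gt0 e2 S0)) IH => t' h1 h2 m.
    by rewrite inE => /predU1P[->//|]; exact: h2.
  apply: filterS (nearl F) => t' h.
  apply: (@le_trans _ _ (\sum_(n <- F) e / 4 / (V + 1) * normc (v n))).
    rewrite !big_seq; apply: ler_sum => n nF.
    by rewrite normc_mul ler_wpM2r ?normc_ge0// h.
  rewrite -mulr_sumr -/V -mulrA ler_piMr ?(ltW e2)// mulrC ler_pdivrMr// mul1r lerDl//.
have nearT : \forall t' \near nbhsT t, 0 <= t' < T.
  by rewrite near_withinE; near=> t'; rewrite /= in_itv.
apply: filterS2 nearF nearT => t' hF ht'.
pose f n := (U t' n - U t n) * v n.
have cs : csummable setT f (4 * B * N).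
  move=> A _; apply: (@le_trans _ _ (\sum_(n <- fset_set A) 4 * B * a n)).
    by apply: ler_sum => n _; exact: fa.
  by rewrite -mulr_sumr ler_wpM2l ?mulr_ge0// aN// fset_uniq.
exists (csum setT f); first exact: csumP cs.
have part j : normc (\sum_(n <- exhaustion int j | n \in [set: int]) f n) <= e / 2.
  apply: le_trans (normc_sum _ _ _) _.
  rewrite (eq_bigl xpredT); last by move=> n; rewrite in_setT.
  rewrite (bigID (mem F))/= [leRHS](_ : _ = e / 4 + e / 4); last by field.
  apply: lerD.
    apply: le_trans hF; rewrite -big_filter; apply: (ler_sum_inj (h := id)) => //.
    - by rewrite filter_uniq// exhaustion_uniq.
    - by move=> n; exact: normc_ge0.
    - by move=> n _; rewrite mem_filter => /andP[].
  pose G := [seq n <- exhaustion int j | n \notin F]; rewrite -big_filter -/G.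
  apply: (@le_trans _ _ (\sum_(n <- G) 4 * B * a n)).
    by apply: ler_sum => n _; exact: fa.
  rewrite -mulr_sumr.
  have : \sum_(n <- G) a n <= e / 4 / (4 * B + 1).
    by apply: tailF; [rewrite filter_uniq// exhaustion_uniq|move=> n; rewrite mem_filter => /andP[]].
  move=> /(ler_wpM2l (mulr_ge0 (ler0n R 4) B0)) h; apply: le_trans h _.
  rewrite mulrCA ler_piMr ?(ltW e2)// ler_pdivrMr// mul1r.
  by rewrite lerDl.
have cl := ccvg_norm (ccvg_csum (csumP cs)).
apply: (@le_lt_trans _ _ (e / 2)); last by rewrite ltr_pdivrMr// ltr_pMr// ltr1n.
rewrite -(cvg_lim (@Rhausdorff R) cl); apply: limr_le; [exact: cvgP cl|exact: nearW].
Unshelve. all: by end_near.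
Qed.

End Continuity.

(** * The trilinear estimate in time *)

Section ModulatedEquation.
Variables (R : realType) (s : R) (r : \bar R) (gamma rho : R) (W : R -> R).
Hypotheses (hs : 0 <= s) (hr : (1 <= r)%E) (cW : continuous W) (hg : 1 / 2 < gamma).
Local Notation FLle := (FLle s r).
Local Notation clos := (in_FLT_closure s r).
Local Notation hoelder := (hoelder_on s r gamma).
Local Notation freq := (int * int * int)%type.
Local Notation K := (U2_const gamma).
Variables (C0 C1 : R).
Hypotheses (C00 : 0 < C0) (C10 : 0 < C1).
Hypothesis oscB : forall x y xi, 0 <= x -> x <= y -> y <= 1 ->
  normc (osc W xi x y) <= C0 * (y - x) `^ gamma * japanese xi `^ (- rho).
Hypothesis triB : forall F f g h A B D, uniq F -> FLle f A -> FLle g B -> FLle h D ->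
  FLle (trisum rho F f g h) (C1 * (A * B * D)).
Local Notation Cc := (C0 * C1).

Let Cc0 : 0 < Cc. Proof. exact: mulr_gt0. Qed.
Let K0 : 0 < K. Proof. exact: U2_const_gt0. Qed.
Let g0 : 0 < gamma. Proof. by apply: lt_trans hg; rewrite divr_gt0. Qed.

Section TimeEstimate.
Implicit Types (k : freq) (w : R -> coefs R).

(** The contribution of the frequencies [k] to the Duhamel integral over
    [x, y), in the interaction picture. *)
Definition tint k w1 w2 w3 (x y : R) : R[i] := cintegral `[x, y[ (fun t =>
  expi (phase R k * W t) * (w1 t k.1.1 * conjc (w2 t k.1.2) * w3 t k.2)).

(** The moduli are summed, so that a bound uniform in F gives absolute convergence
    of the frequency sum. *)
Definition absint (F : seq freq) w1 w2 w3 x y : coefs R := fun n =>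
  (\sum_(k <- F | interacts n k) normc (tint k w1 w2 w3 x y))%:C.

(** Iterated cutting reduces the trilinear integral of step functions to
    oscillatory integrals over subintervals. *)
Lemma tint_step (S1 S2 S3 : step R) k x y :
  tint k (stepfun S1) (stepfun S2) (stepfun S3) x y =
  \sum_(i3 <- stlist S3) stval i3 k.2 *
  \sum_(i2 <- stlist S2) conjc (stval i2 k.1.2) *
  \sum_(i1 <- stlist S1) stval i1 k.1.1 *
    (let x3 := clamp x y (stleft i3) in let y3 := clamp x y (stright i3) in
     let x2 := clamp x3 y3 (stleft i2) in let y2 := clamp x3 y3 (stright i2) in
     osc W (phase R k) (clamp x2 y2 (stleft i1)) (clamp x2 y2 (stright i1))).
Proof.
set e := fun t => expi (phase R k * W t) : R[i].
have me D : bmeas D e by exact: bmeas_osc.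
have m1 a b : bmeas `[a, b[ (fun t => e t * stepfun S1 t k.1.1).
  by apply: bmeasM => //; apply: bmeas_stepfun; exact: measurable_itv.
have cE t : conjc (stepfun S2 t k.1.2) =
    \sum_(i2 <- stlist S2) conjc (stval i2 k.1.2) * (step_indic i2 t)%:C.
  rewrite /stepfun conjc_sum.
  by apply: eq_bigr => i _; rewrite -mul_conjc conjc_real.
have m2 a b : bmeas `[a, b[ (fun t => e t * stepfun S1 t k.1.1 * conjc (stepfun S2 t k.1.2)).
  apply: bmeasM => //; apply: bmeas_conj.
  by apply: bmeas_stepfun; exact: measurable_itv.
rewrite /tint.
transitivity (cintegral `[x, y[ (fun t =>
   e t * stepfun S1 t k.1.1 * conjc (stepfun S2 t k.1.2) * stepfun S3 t k.2)).
  by apply: eq_cintegral => t _; rewrite !mulrA.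
rewrite cintegral_step//; apply: eq_bigr => i3 _; congr (_ * _) => /=.
transitivity (cintegral `[clamp x y (stleft i3), clamp x y (stright i3)[ (fun t =>
   e t * stepfun S1 t k.1.1 *
   \sum_(i2 <- stlist S2) conjc (stval i2 k.1.2) * (step_indic i2 t)%:C)).
  by apply: eq_cintegral => t _; rewrite cE.
rewrite cintegral_step//; apply: eq_bigr => i2 _; congr (_ * _).
by rewrite cintegral_step.
Qed.

(** Each insertion of a step function costs its cutting constant, so three
    insertions turn the bound on the oscillatory integrals into a bound for
    the trilinear integral. *)
Lemma absint_step F (S1 S2 S3 : step R) L1 L2 L3 x y : uniq F ->
  step_bounded s r gamma S1 L1 -> step_bounded s r gamma S2 L2 -> step_bounded s r gamma S3 L3 ->
  0 <= x -> x <= y -> y <= 1 ->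
  FLle (absint F (stepfun S1) (stepfun S2) (stepfun S3) x y)
       (C0 * C1 * (L1 * L2 * L3) * (y - x) `^ gamma).
Proof.
move=> uF h1 h2 h3 x0 xy y1.
have [lr1 v1 cut1] := h1; have [lr2 v2 cut2] := h2; have [lr3 v3 cut3] := h3.
have [L10 [L20 L30]] := (step_bounded_ge0 h1, (step_bounded_ge0 h2, step_bounded_ge0 h3)).
(* [x, y) is cut by S3, the pieces by S2, and those by S1 *)
pose x3 (i3 : stidx S3) := clamp x y (stleft i3).
pose y3 (i3 : stidx S3) := clamp x y (stright i3).
pose x2 i3 (i2 : stidx S2) := clamp (x3 i3) (y3 i3) (stleft i2).
pose y2 i3 (i2 : stidx S2) := clamp (x3 i3) (y3 i3) (stright i2).
pose x1 i3 i2 (i1 : stidx S1) := clamp (x2 i3 i2) (y2 i3 i2) (stleft i1).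
pose y1' i3 i2 (i1 : stidx S1) := clamp (x2 i3 i2) (y2 i3 i2) (stright i1).
have xy3 i3 : x3 i3 <= y3 i3 by exact: clamp_mono.
have xy2 i3 i2 : x2 i3 i2 <= y2 i3 i2 by exact: clamp_mono.
have xy1 i3 i2 i1 : x1 i3 i2 i1 <= y1' i3 i2 i1 by exact: clamp_mono.
have xge i3 i2 i1 : 0 <= x1 i3 i2 i1.
  apply: le_trans (clamp_ge _ _ _); apply: le_trans (clamp_ge _ _ _).
  by apply: le_trans (clamp_ge _ _ _).
have yle i3 i2 i1 : y1' i3 i2 i1 <= 1.
  apply: le_trans (clamp_le _ (xy2 _ _)) _; apply: le_trans (clamp_le _ (xy3 _)) _.
  exact: le_trans (clamp_le _ xy) _.
pose len i3 i2 i1 := (y1' i3 i2 i1 - x1 i3 i2 i1) `^ gamma.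
pose u : coefs R := fun n => \sum_(i3 <- stlist S3) \sum_(i2 <- stlist S2) \sum_(i1 <- stlist S1)
  (C0 * len i3 i2 i1)%:C * trisum rho F (stval i1) (stval i2) (stval i3) n.
apply: (@FLle_mono _ _ _ hr _ u).
  move=> n.
  have e : u n = (\sum_(i3 <- stlist S3) \sum_(i2 <- stlist S2) \sum_(i1 <- stlist S1)
     C0 * len i3 i2 i1 * \sum_(k <- F | interacts n k)
       decay rho k * (normc (stval i1 k.1.1) * normc (stval i2 k.1.2) * normc (stval i3 k.2)))%:C.
    rewrite /u (raddf_sum (real_complex R)); apply: eq_bigr => i3 _.
    rewrite (raddf_sum (real_complex R)); apply: eq_bigr => i2 _.
    rewrite (raddf_sum (real_complex R)); apply: eq_bigr => i1 _.
    by rewrite [RHS]mul_real_complex.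
  rewrite e /absint !normc_real ger0_norm; last by apply: sumr_ge0 => k _; exact: normc_ge0.
  apply: le_trans (ler_norm _).
  apply: (@le_trans _ _ (\sum_(k <- F | interacts n k)
     \sum_(i3 <- stlist S3) \sum_(i2 <- stlist S2) \sum_(i1 <- stlist S1)
       C0 * len i3 i2 i1 * (decay rho k * (normc (stval i1 k.1.1) * normc (stval i2 k.1.2) * normc (stval i3 k.2))))).
    apply: ler_sum => k _; rewrite tint_step.
    apply: le_trans (normc_sum _ _ _) _; apply: ler_sum => i3 _.
    rewrite normc_mul; apply: le_trans (ler_wpM2l (normc_ge0 _) (normc_sum _ _ _)) _.
    rewrite mulr_sumr; apply: ler_sum => i2 _.
    rewrite normc_mul normc_conj mulrCA.
    apply: le_trans (ler_wpM2l (normc_ge0 _) (ler_wpM2l (normc_ge0 _) (normc_sum _ _ _))) _.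
    rewrite !mulr_sumr; apply: ler_sum => i1 _.
    rewrite normc_mul /=.
    have := oscB (phase R k) (xge i3 i2 i1) (xy1 i3 i2 i1) (yle i3 i2 i1).
    rewrite -/(len i3 i2 i1) -/(decay rho k) => hosc.
    have n0 := @normc_ge0 R.
    have := ler_wpM2l (mulr_ge0 (n0 (stval i2 k.1.2)) (mulr_ge0 (n0 (stval i3 k.2)) (n0 (stval i1 k.1.1)))) hosc.
    rewrite /x1 /y1' /x2 /y2 /x3 /y3 => hh.
    have -> : forall a b c d : R, a * (b * (c * d)) = a * (b * c) * d by move=> *; ring.
    by apply: le_trans hh _; apply: eq_ler; ring.
  rewrite exchange_big/=; apply: ler_sum => i3 _.
  rewrite exchange_big/=; apply: ler_sum => i2 _.
  rewrite exchange_big/=; apply: ler_sum => i1 _.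
  by rewrite mulr_sumr.
pose b i3 i2 i1 := C0 * len i3 i2 i1 * (C1 * (stbound i1 * stbound i2 * stbound i3)).
have l0 i3 i2 i1 : 0 <= C0 * len i3 i2 i1 by rewrite mulr_ge0 ?powR_ge0 ?(ltW C00).
apply: (@FLle_le _ _ _ _ (\sum_(i3 <- stlist S3) \sum_(i2 <- stlist S2) \sum_(i1 <- stlist S1) b i3 i2 i1)); last first.
  rewrite /u; apply: (FLle_sum (s := s) hr _ (f := fun i3 n => \sum_(i2 <- stlist S2) \sum_(i1 <- stlist S1)
    (C0 * len i3 i2 i1)%:C * trisum rho F (stval i1) (stval i2) (stval i3) n)) => i3 _.
  apply: (FLle_sum (s := s) hr _ (f := fun i2 n => \sum_(i1 <- stlist S1)
    (C0 * len i3 i2 i1)%:C * trisum rho F (stval i1) (stval i2) (stval i3) n)) => i2 _.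
  apply: (FLle_sum (s := s) hr _ (f := fun i1 n =>
    (C0 * len i3 i2 i1)%:C * trisum rho F (stval i1) (stval i2) (stval i3) n)) => i1 _.
  have := FLle_scale hr (C0 * len i3 i2 i1)%:C (triB uF (v1 i1) (v2 i2) (v3 i3)).
  by rewrite normc_real ger0_norm.
have C010 : 0 <= C0 * C1 := ltW Cc0.
have B2 i3 i2 : \sum_(i1 <- stlist S1) b i3 i2 i1 <=
    C0 * C1 * L1 * stbound i3 * (stbound i2 * (y2 i3 i2 - x2 i3 i2) `^ gamma).
  have := cut1 _ _ (xy2 i3 i2).
  move=> /(ler_wpM2l (mulr_ge0 C010 (mulr_ge0 (stbound_ge0 i2 h2) (stbound_ge0 i3 h3)))).
  rewrite mulr_sumr => hh; apply: le_trans (le_trans _ hh) _.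
    by apply: eq_ler; apply: eq_bigr => i1 _; rewrite /b /len /x1 /y1'; ring.
  by apply: eq_ler; ring.
have B3 i3 : \sum_(i2 <- stlist S2) \sum_(i1 <- stlist S1) b i3 i2 i1 <=
    C0 * C1 * L1 * L2 * (stbound i3 * (y3 i3 - x3 i3) `^ gamma).
  apply: le_trans (ler_sum _ (fun i2 _ => B2 i3 i2)) _.
  rewrite -mulr_sumr.
  have := cut2 _ _ (xy3 i3).
  move=> /(ler_wpM2l (mulr_ge0 (mulr_ge0 C010 L10) (stbound_ge0 i3 h3))) hh.
  apply: le_trans hh _.
  by apply: eq_ler; ring.
apply: le_trans (ler_sum _ (fun i3 _ => B3 i3)) _.
rewrite -mulr_sumr.
have := cut3 _ _ xy => /(ler_wpM2l (mulr_ge0 (mulr_ge0 C010 L10) L20)) hh.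
apply: le_trans hh _.
by apply: eq_ler; ring.
Qed.

Section Approximable.
Variable T : R.
Hypothesis T1 : T <= 1.
Local Notation approx := (approximable s r gamma `[0, T[).

Variables (w1 w2 w3 : R -> coefs R) (L1 L2 L3 : R).
Hypotheses (a1 : approx w1 L1) (a2 : approx w2 L2) (a3 : approx w3 L3).

Let sub x y : 0 <= x -> y <= T -> `[x, y[%classic `<=` `[0, T[%classic.
Proof.
by move=> x0 yT t /=; rewrite !in_itv/= => /andP[? ?]; apply/andP; split; lra.
Qed.

Lemma bmeas_tint k x y : 0 <= x -> y <= T -> bmeas `[x, y[ (fun t =>
  expi (phase R k * W t) * (w1 t k.1.1 * conjc (w2 t k.1.2) * w3 t k.2)).
Proof.
move=> x0 yT; have mD : measurable `[x, y[%classic by exact: measurable_itv.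
apply: bmeasM; first exact: bmeas_osc.
apply: bmeasM; last by apply: (bmeas_approximable hs hr _ mD (approximableS (sub x0 yT) a3)).
apply: bmeasM; first by apply: (bmeas_approximable hs hr _ mD (approximableS (sub x0 yT) a1)).
by apply: bmeas_conj; apply: (bmeas_approximable hs hr _ mD (approximableS (sub x0 yT) a2)).
Qed.

Lemma tint_split k x y z : 0 <= x -> x <= y -> y <= z -> z <= T ->
  tint k w1 w2 w3 x z = tint k w1 w2 w3 x y + tint k w1 w2 w3 y z.
Proof. by move=> x0 xy yz zT; apply: cintegral_split => //; exact: bmeas_tint. Qed.

(** Bounded convergence and Fatou's lemma extend the bound to limits. *)
Lemma absint_le F x y : uniq F -> 0 <= x -> x <= y -> y <= T ->
  FLle (absint F w1 w2 w3 x y) (C0 * C1 * (L1 * L2 * L3) * (y - x) `^ gamma).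
Proof.
move=> uF x0 xy yT.
have [[S1 [b1 c1]] [[S2 [b2 c2]] [S3 [b3 c3]]]] := (a1, (a2, a3)).
apply: (FLle_lim hr (uj := fun j => absint F (stepfun (S1 j)) (stepfun (S2 j)) (stepfun (S3 j)) x y)).
  by move=> j; apply: absint_step => //; exact: le_trans T1.
have n0 := @normc_ge0 R.
have [L10 [L20 L30]] := (approximable_ge0 a1, (approximable_ge0 a2, approximable_ge0 a3)).
have tl k : ccvg (fun j => tint k (stepfun (S1 j)) (stepfun (S2 j)) (stepfun (S3 j)) x y)
    (tint k w1 w2 w3 x y).
  have mD : measurable `[x, y[%classic by exact: measurable_itv.
  apply: (@cintegral_cvg _ _ mD (leb_itv_lty true true x y) _ _ (L1 * L2 * L3)).
  - move=> j; apply: bmeasM; first exact: bmeas_osc.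
    apply: bmeasM; last exact: bmeas_stepfun.
    by apply: bmeasM; [exact: bmeas_stepfun|apply: bmeas_conj; exact: bmeas_stepfun].
  - move=> j t _; rewrite normc_expiM !normc_mul normc_conj.
    have H S L n : step_bounded s r gamma S L -> normc (stepfun S t n) <= L.
      by move=> SL; exact: (FLle_coord hs hr _ (step_bounded_FLle hr t SL)).
    by apply: ler_pM; rewrite ?mulr_ge0 ?n0 ?H//; apply: ler_pM; rewrite ?n0 ?H.
  - move=> t /(sub x0 yT) Dt; apply: ccvgM; first exact: ccvg_cst.
    apply: ccvgM; last exact: c3.
    by apply: ccvgM; [exact: c1|apply: ccvg_conj; exact: c2].
move=> n; rewrite /absint /ccvg.
have -> : (fun j => normc ((\sum_(k <- F | interacts n k) normc (tint k (stepfun (S1 j)) (stepfun (S2 j)) (stepfun (S3 j)) x y))%:C -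
   (\sum_(k <- F | interacts n k) normc (tint k w1 w2 w3 x y))%:C)) =
   (fun j => `|\sum_(k <- F | interacts n k) (normc (tint k (stepfun (S1 j)) (stepfun (S2 j)) (stepfun (S3 j)) x y)
      - normc (tint k w1 w2 w3 x y))|).
  by apply/funext => j; rewrite -raddfB normc_real -sumrB.
rewrite -[X in _ --> X](normr0 R); apply: cvg_norm.
rewrite (_ : (fun j => _) = (fun j => \sum_(k <- F) if interacts n k then
    normc (tint k (stepfun (S1 j)) (stepfun (S2 j)) (stepfun (S3 j)) x y)
      - normc (tint k w1 w2 w3 x y) else 0)); last by apply/funext => j; rewrite big_mkcond.
apply: (@cvg_sum0 R _ F (fun k j => if interacts n k then
    normc (tint k (stepfun (S1 j)) (stepfun (S2 j)) (stepfun (S3 j)) x y)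
      - normc (tint k w1 w2 w3 x y) else 0)) => k.
have [_|_] := boolP (interacts n k); last exact: cvg_cst.
by apply/subr_cvg0; exact: ccvg_norm.
Qed.

End Approximable.
End TimeEstimate.

(** * The Duhamel integral *)

Section Duhamel.
Implicit Types (k : freq) (w : R -> coefs R).

(** The integral over [x, y) of the Wick-ordered nonlinearity in the interaction
    picture; the frequencies are summed after the time integration, whose
    oscillations make the sum absolutely convergent. *)
Definition wickint w1 w2 w3 x y : coefs R := fun n =>
  csum (nonresonant n) (fun k => tint k w1 w2 w3 x y) - tint (n, n, n) w1 w2 w3 x y.

Lemma nonresonant_interacts n k : nonresonant n k -> interacts n k.
Proof. by case=> h1 h2 h3; rewrite /interacts h1 eqxx h2 h3. Qed.

Lemma resonant_interacts n : interacts n (n, n, n).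
Proof. by rewrite /interacts/= subrr add0r !eqxx. Qed.

Variable T : R.
Hypothesis T1 : T <= 1.
Local Notation approx := (approximable s r gamma `[0, T[).

Section Fixed.
Variables (w1 w2 w3 : R -> coefs R) (L1 L2 L3 : R).
Hypotheses (a1 : approx w1 L1) (a2 : approx w2 L2) (a3 : approx w3 L3).
Variables (x y : R).
Hypotheses (x0 : 0 <= x) (xy : x <= y) (yT : y <= T).

Local Notation bound := (C0 * C1 * (L1 * L2 * L3) * (y - x) `^ gamma).

Lemma csummable_tint n : csummable (nonresonant n) (fun k => tint k w1 w2 w3 x y) bound.
Proof.
move=> B [fB BD].
have h := absint_le T1 a1 a2 a3 (fset_uniq (fset_set B)) x0 xy yT.
have := FLle_coord hs hr n h; rewrite /absint normc_real.
rewrite ger0_norm ?sumr_ge0//; last by move=> k _; exact: normc_ge0.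
move=> h'; apply: le_trans h'; rewrite [leRHS]big_mkcond !big_seq; apply: ler_sum => k.
by rewrite in_fset_set// => /set_mem /BD /nonresonant_interacts ->.
Qed.

Lemma has_csum_tint n : has_csum (nonresonant n) (fun k => tint k w1 w2 w3 x y)
  (wickint w1 w2 w3 x y n + tint (n, n, n) w1 w2 w3 x y).
Proof. by rewrite /wickint subrK; apply: csumP; exact: csummable_tint. Qed.

(** The nonresonant sum and the resonant term run over disjoint sets of triples, so
    a single sum of moduli bounds both. *)
Lemma FLle_wickint : FLle (wickint w1 w2 w3 x y) bound.
Proof.
pose F j : seq freq := undup (exhaustion freq j ++ [seq (n, n, n) | n <- exhaustion int j]).
pose G k := tint k w1 w2 w3 x y.
apply: (FLle_lim hr (uj := fun j n => if n \in exhaustion int j then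
  \sum_(k <- exhaustion freq j | k \in nonresonant n) G k - G (n, n, n) else 0)); last first.
  move=> n.
  have : ccvg (fun j => \sum_(k <- exhaustion freq j | k \in nonresonant n) G k - G (n, n, n))
      (wickint w1 w2 w3 x y n).
    apply: ccvgB; last exact: ccvg_cst.
    by apply: ccvg_csum; apply: csumP; exact: csummable_tint.
  move=> h; apply: cvg_trans h; apply: near_eq_cvg.
  have /filterS := @exhaustion_cofinal int [set n] (finite_set1 n).
  by apply=> j /(_ n erefl) /= ->.
move=> j.
have h := absint_le T1 a1 a2 a3 (undup_uniq _ : uniq (F j)) x0 xy yT.
apply: FLle_mono h => // n; rewrite /absint normc_real ger0_norm ?sumr_ge0//; last first.
  by move=> k _; exact: normc_ge0.
case: ifPn => [nj|_]; last by rewrite normc0 sumr_ge0// => k _; exact: normc_ge0.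
have rF : (n, n, n) \in F j by rewrite mem_undup mem_cat map_f ?orbT.
rewrite [leRHS]big_mkcond (bigD1_seq (n, n, n) rF (undup_uniq _)) resonant_interacts addrC.
apply: le_trans (normc_triangle _ _) _; rewrite normc_opp; apply: lerD; first exact: lexx.
apply: le_trans (normc_sum _ _ _) _.
rewrite -big_mkcondr -[leRHS]big_filter.
apply: (ler_sum_inj (h := id)) => //; first exact: exhaustion_uniq.
- exact/filter_uniq/undup_uniq.
- by move=> k; exact: normc_ge0.
move=> k /set_mem nk kj; rewrite mem_filter nonresonant_interacts//=.
rewrite mem_undup mem_cat kj/= !andbT.
by apply/eqP => kn; move: nk; rewrite kn => -[_ /=]; rewrite eqxx.
Qed.

End Fixed.

Lemma wickint_split w1 w2 w3 L1 L2 L3 x y z n :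
  approx w1 L1 -> approx w2 L2 -> approx w3 L3 ->
  0 <= x -> x <= y -> y <= z -> z <= T ->
  wickint w1 w2 w3 x z n = wickint w1 w2 w3 x y n + wickint w1 w2 w3 y z n.
Proof.
move=> a1 a2 a3 x0 xy yz zT.
have y0 : 0 <= y by exact: le_trans xy.
have yT : y <= T by exact: le_trans zT.
have xz : x <= z by exact: le_trans yz.
have hD := has_csumD (has_csum_tint a1 a2 a3 x0 xy yT n) (has_csum_tint a1 a2 a3 y0 yz zT n).
have e k : tint k w1 w2 w3 x z = tint k w1 w2 w3 x y + tint k w1 w2 w3 y z.
  exact: (tint_split a1 a2 a3).
have h := eq_has_csum (fun k _ => esym (e k)) hD.
have := has_csum_unique (has_csum_tint a1 a2 a3 x0 xz zT n) h.
have cancel (a b c p q : R[i]) : a + (p + q) = b + p + (c + q) -> a = b + c.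
  by move=> E; apply: (addIr (p + q)); rewrite E addrACA.
by rewrite e; exact: cancel.
Qed.

Lemma wickint_sub w v L M D x y n : approx w L -> approx v M ->
  approx (fun t m => w t m - v t m) D -> 0 <= x -> x <= y -> y <= T ->
  let d := fun t m => w t m - v t m in
  wickint w w w x y n - wickint v v v x y n =
  wickint d w w x y n + wickint v d w x y n + wickint v v d x y n.
Proof.
move=> aw av ad x0 xy yT d.
have mD : measurable `[x, y[%classic by exact: measurable_itv.
have fD := leb_itv_lty true true x y.
have e k : tint k d w w x y + tint k v d w x y + tint k v v d x y
    + tint k v v v x y = tint k w w w x y.
  have m1 := bmeas_tint ad aw aw k x0 yT.
  have m2 := bmeas_tint av ad aw k x0 yT.
  have m3 := bmeas_tint av av ad k x0 yT.
  have m4 := bmeas_tint av av av k x0 yT.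
  have s1 := cintegralD mD fD m1 m2.
  have s2 := cintegralD mD fD (bmeasD m1 m2) m3.
  have s3 := cintegralD mD fD (bmeasD (bmeasD m1 m2) m3) m4.
  rewrite /tint -s1 -s2 -s3.
  apply: eq_cintegral => t _; rewrite -!mulrDr; congr (_ * _).
  have -> : conjc (d t k.1.2) = conjc (w t k.1.2) - conjc (v t k.1.2).
    by rewrite /d; case: (w t k.1.2) (v t k.1.2) => p q [p' q'] /=; rewrite !opprD.
  by rewrite /d; ring.
have hD := has_csumD (has_csumD (has_csumD (has_csum_tint ad aw aw x0 xy yT n)
  (has_csum_tint av ad aw x0 xy yT n)) (has_csum_tint av av ad x0 xy yT n))
  (has_csum_tint av av av x0 xy yT n).
have h := eq_has_csum (fun k _ => e k) hD.
have := has_csum_unique (has_csum_tint aw aw aw x0 xy yT n) h.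
have cancel (a a' b c b' p q p' q' : R[i]) :
    a + (p + q + p' + q') = b + p + (c + q) + (b' + p') + (a' + q') -> a - a' = b + c + b'.
  move=> E; apply: (addIr (p + q + p' + q' + a')).
  have -> : a - a' + (p + q + p' + q' + a') = a + (p + q + p' + q') by ring.
  by rewrite E; ring.
by rewrite -e; exact: cancel.
Qed.

Lemma FLle_wickint_sub w v L M D x y : approx w L -> approx v M ->
  approx (fun t m => w t m - v t m) D -> 0 <= x -> x <= y -> y <= T ->
  FLle (fun n => wickint w w w x y n - wickint v v v x y n)
    (C0 * C1 * (D * (L ^+ 2 + L * M + M ^+ 2)) * (y - x) `^ gamma).
Proof.
move=> aw av ad x0 xy yT.
have -> : (fun n => wickint w w w x y n - wickint v v v x y n) = (fun n =>
   wickint (fun t m => w t m - v t m) w w x y n + wickint v (fun t m => w t m - v t m) w x y n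
   + wickint v v (fun t m => w t m - v t m) x y n).
  by apply/funext => n; rewrite (wickint_sub n aw av ad).
have h := FLle_add hr (FLle_add hr (FLle_wickint ad aw aw x0 xy yT)
  (FLle_wickint av ad aw x0 xy yT)) (FLle_wickint av av ad x0 xy yT).
apply: FLle_le h.
by apply: eq_ler; ring.
Qed.

End Duhamel.

Section MildSolution.
Variable T : R.
Hypothesis T1 : T <= 1.

(** Conjugating each factor by the linear evolution collects all oscillations in
    the phase. *)
Lemma duhamel_tint U w L t n k : approximable s r gamma `[0, T[ w L ->
  (forall t, 0 <= t < T -> U t = expL (- W t) (w t)) ->
  0 <= t < T -> k.1.1 - k.1.2 + k.2 = n ->
  duhamel W t n (fun tau => trilinear (U tau) k) =
  expi (W t * n%:~R ^+ 2) * tint k w w w 0 t.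
Proof.
move=> aw Uw /andP[t0 tT] kn.
have sub : `[0, t]%classic `<=` `[0, T[%classic.
  by move=> x /=; rewrite !in_itv/= => /andP[-> /le_lt_trans]; apply.
have mD : measurable `[0, t]%classic by exact: measurable_itv.
have aw' := approximableS sub aw.
have m : bmeas `[0, t] (fun tau => expi (phase R k * W tau) *
    (w tau k.1.1 * conjc (w tau k.1.2) * w tau k.2)).
  apply: bmeasM; first exact: bmeas_osc.
  apply: bmeasM; last exact: (bmeas_approximable hs hr _ mD aw').
  apply: bmeasM; first exact: (bmeas_approximable hs hr _ mD aw').
  by apply: bmeas_conj; exact: (bmeas_approximable hs hr _ mD aw').
rewrite /tint -cintegral_closed// -cintegralZ//; last exact: leb_itv_lty.
apply: eq_cintegral => tau; rewrite /= in_itv/= => /andP[tau0 taut].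
rewrite /trilinear Uw ?tau0 ?(le_lt_trans taut)// /expL -mul_conjc conj_expi.
rewrite [expi (W t * _) * _]mulrA -expiD.
rewrite (_ : W t * n%:~R ^+ 2 + phase R k * W tau = (W t - W tau) * n%:~R ^+ 2 +
  (- (- W tau * k.1.1%:~R ^+ 2) + - - (- W tau * k.1.2%:~R ^+ 2) + - (- W tau * k.2%:~R ^+ 2))); last first.
  by rewrite /phase kn; ring.
rewrite !expiD.
by ring.
Qed.

(** Hence the mild formulation is a fixed point equation without linear
    evolution. *)
Lemma mild_wickint sgn u0 U w L : approximable s r gamma `[0, T[ w L ->
  (forall t, 0 <= t < T -> U t = expL (- W t) (w t)) ->
  (mild_solution sgn W T u0 U <->
   forall t, 0 <= t < T -> forall n,
     w t n = expL (W 0) u0 n - (-1) ^+ sgn * (0 +i* 1) * wickint w w w 0 t n).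
Proof.
move=> aw Uw; split=> [mU t tT n|hw t tT n].
- have [S hS] := mU t tT n.
  have /andP[t0 /ltW tT'] := tT.
  have hS' := has_csumZ (expi (- (W t * n%:~R ^+ 2))) hS.
  have e k : nonresonant n k -> expi (- (W t * n%:~R ^+ 2)) *
      duhamel W t n (fun tau => trilinear (U tau) k) = tint k w w w 0 t.
    by case=> kn _ _; rewrite (duhamel_tint aw Uw tT kn) mulrA -expiD addrC subrr expi0 mul1r.
  have hS2 := eq_has_csum e hS'.
  have := has_csum_unique (has_csum_tint T1 aw aw aw (lexx 0) t0 tT' n) hS2.
  move=> E.
  rewrite /resonant (duhamel_tint aw Uw tT)/=; last by rewrite subrr add0r.
  rewrite Uw// /expL => h.
  have -> : w t n = expi (- (W t * n%:~R ^+ 2)) * (expi (- (- W t * n%:~R ^+ 2)) * w t n).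
    by rewrite mulrA -expiD mulNr opprK addrC subrr expi0 mul1r.
  have -> : wickint w w w 0 t n = expi (- (W t * n%:~R ^+ 2)) * S - tint (n, n, n) w w w 0 t.
    by rewrite -E addrK.
  rewrite h.
  have e1 : expi (- (W t * n%:~R ^+ 2)) * expi (- (- (W t - W 0) * n%:~R ^+ 2)) = expi (- (W 0 * n%:~R ^+ 2)).
    by rewrite -expiD; congr expi; ring.
  have e2 : expi (- (W t * n%:~R ^+ 2)) * expi (W t * n%:~R ^+ 2) = 1.
    by rewrite -expiD addrC subrr expi0.
  rewrite mulrBr mulrA e1; congr (_ - _).
  by rewrite mulrCA mulrBr [_ * (_ * tint _ _ _ _ _ _)]mulrA e2 mul1r.
- have /andP[t0 /ltW tT'] := tT.
  have hS := has_csum_tint T1 aw aw aw (lexx 0) t0 tT' n.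
  have hS' := has_csumZ (expi (W t * n%:~R ^+ 2)) hS.
  eexists.
    apply: eq_has_csum hS' => k [kn _ _].
    by rewrite (duhamel_tint aw Uw tT kn).
  rewrite /resonant (duhamel_tint aw Uw tT)/=; last by rewrite subrr add0r.
  rewrite -mulrBr addrK Uw// /expL hw//.
  have e1 : expi (- (- (W t - W 0) * n%:~R ^+ 2)) = expi (- (- W t * n%:~R ^+ 2)) * expi (- (W 0 * n%:~R ^+ 2)).
    by rewrite -expiD; congr expi; ring.
  rewrite e1 mulNr opprK /expL.
  by ring.
Qed.

End MildSolution.

(** * The Picard map *)

Section Picard.
Implicit Types (u : coefs R).

Variable T : R.
Hypotheses (T0 : 0 < T) (T1 : T <= 1).
Local Notation approx := (approximable s r gamma `[0, T[).
Variable sgn : bool.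

Let sg : R[i] := (-1) ^+ sgn * (0 +i* 1).

Lemma normc_sg : normc sg = 1.
Proof.
rewrite /sg normc_mul (_ : normc (0 +i* 1) = 1 :> R); last first.
  by rewrite /= expr0n/= expr1n add0r sqrtr1.
by rewrite mulr1; case: sgn; rewrite ?expr1 ?expr0 ?normc_opp normc_real normr1.
Qed.

Definition picard (w0 : coefs R) (w : R -> coefs R) : R -> coefs R := fun t n => w0 n - sg * wickint w w w 0 t n.

Lemma picard_incr w0 w L t t' n : approx w L -> 0 <= t -> t <= t' -> t' < T ->
  picard w0 w t' n - picard w0 w t n = - sg * wickint w w w t t' n.
Proof.
move=> aw t0 tt' t'T; rewrite /picard.
rewrite (wickint_split T1 n aw aw aw (lexx 0) t0 tt' (ltW t'T)).
by ring.
Qed.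

Lemma picard_hoelder w0 w L : approx w L -> hoelder 0 T (picard w0 w) (Cc * L ^+ 3).
Proof.
move=> aw; apply: hoelder_forward => // t t' t0 tt' t'T.
have h := FLle_wickint T1 aw aw aw t0 tt' (ltW t'T).
apply: FLle_mono => [//|n|]; last first.
  apply: FLle_le h; apply: eq_ler; rewrite !exprS expr0; ring.
by rewrite (picard_incr w0 n aw)// normc_mul normc_opp normc_sg mul1r.
Qed.

Lemma picard0 w0 w L : approx w L -> picard w0 w 0 =1 w0.
Proof.
move=> aw n; rewrite /picard.
have := FLle_wickint T1 aw aw aw (lexx 0) (lexx 0) (ltW T0).
rewrite subrr powR0 ?gt_eqF// mulr0 => /(FLle_eq0 hs hr) ->.
by rewrite mulr0 subr0.
Qed.

(** The basic difference estimate, localized to a time interval [a, b) before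
    which the two arguments agree: the Picard map gains a power of the length
    of the interval on the Hoelder constant of the difference. *)
Lemma picard_diff_hoelder w0 v0 w v L M a b d B : approx w L -> approx v M ->
  0 <= a -> a < b -> b <= T -> 0 <= B -> 0 <= d ->
  (forall t, 0 <= t < a -> w t =1 v t) ->
  FLle (fun n => w a n - v a n) d ->
  hoelder a b (fun t n => w t n - v t n) B ->
  hoelder a b (fun t n => picard w0 w t n - picard v0 v t n)
    (Cc * (L ^+ 2 + L * M + M ^+ 2) * (d + K * (B * (b - a) `^ gamma))).
Proof.
move=> aw av a0 ab bT B0 d0 wv hd hB.
have L0 := approximable_ge0 aw; have M0 := approximable_ge0 av.
have Q0 : 0 <= Cc * (L ^+ 2 + L * M + M ^+ 2).
  by rewrite mulr_ge0 ?(ltW Cc0)// !addr_ge0 ?exprn_ge0 ?mulr_ge0.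
set Q := Cc * _ in Q0 *.
have b1 : b <= 1 by exact: le_trans T1.
have subb : `[0, b[%classic `<=` `[0, T[%classic.
  by move=> t /=; rewrite !in_itv/= => /andP[-> /lt_le_trans]; apply.
have aw' := approximableS subb aw; have av' := approximableS subb av.
have hD L' : d + K * (B * (b - a) `^ gamma) < L' ->
    hoelder a b (fun t n => picard w0 w t n - picard v0 v t n) (Q * L').
  move=> hL'; apply: hoelder_forward => // t t' ta tt' t'b.
  have ad : approximable s r gamma `[0, b[ (fun t n => w t n - v t n) L'.
    apply: (hoelder_approximable hs hr hg a0 ab d0 B0) hL' => // tau htau n.
    by rewrite wv// subrr.
  have t0 : 0 <= t by exact: le_trans ta.
  have h := FLle_wickint_sub b1 aw' av' ad t0 tt' (ltW t'b).
  apply: FLle_mono => [//|n|]; last first.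
    apply: FLle_le h; apply: eq_ler; rewrite /Q; ring.
  rewrite (_ : _ - _ = (picard w0 w t' n - picard w0 w t n) - (picard v0 v t' n - picard v0 v t n)); last by ring.
  have t'T : t' < T by exact: lt_le_trans t'b bT.
  by rewrite (picard_incr w0 n aw)// (picard_incr v0 n av)// -mulrBr normc_mul normc_opp normc_sg mul1r.
apply: (hoelder_inf hg) => B' hB'.
have [Qe|Qn] := eqVneq Q 0.
  apply: hoelder_le (hD (d + K * (B * (b - a) `^ gamma) + 1) _); last by rewrite ltrDl.
  by rewrite Qe mul0r; move: hB'; rewrite Qe mul0r => /ltW.
have Qp : 0 < Q by rewrite lt_neqAle eq_sym Qn.
apply: hoelder_le (hD (B' / Q) _); first by rewrite mulrC divfK.
by rewrite ltr_pdivlMr// mulrC.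
Qed.

(** Iterating the difference estimate, each time with half of the previous excess,
    removes the a priori Hoelder constant B of the difference. *)
Lemma fixed_points_diff w0 v0 w v L M a b d B : approx w L -> approx v M ->
  (forall t, 0 <= t < T -> w t =1 picard w0 w t) ->
  (forall t, 0 <= t < T -> v t =1 picard v0 v t) ->
  0 <= a -> a < b -> b <= T -> 0 <= B -> 0 <= d ->
  (forall t, 0 <= t < a -> w t =1 v t) ->
  FLle (fun n => w a n - v a n) d ->
  hoelder a b (fun t n => w t n - v t n) B ->
  Cc * (L ^+ 2 + L * M + M ^+ 2) * K * (b - a) `^ gamma <= 2^-1 ->
  hoelder a b (fun t n => w t n - v t n) (2 * (Cc * (L ^+ 2 + L * M + M ^+ 2)) * d).
Proof.
move=> aw av fw fv a0 ab bT B0 d0 wv hd hB small.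
have L0 := approximable_ge0 aw; have M0 := approximable_ge0 av.
have Q0 : 0 <= Cc * (L ^+ 2 + L * M + M ^+ 2).
  by rewrite mulr_ge0 ?(ltW Cc0)// !addr_ge0 ?exprn_ge0 ?mulr_ge0.
set Q := Cc * _ in Q0 small *.
have Qd : 0 <= 2 * Q * d by apply: mulr_ge0 => //; apply: mulr_ge0.
have h j : hoelder a b (fun t n => w t n - v t n) (2 * Q * d + B * 2^-1 ^+ j).
  elim: j => [|j IH]; first by apply: hoelder_le hB; rewrite expr0 mulr1 lerDr.
  have B'0 : 0 <= 2 * Q * d + B * 2^-1 ^+ j by rewrite addr_ge0// mulr_ge0// exprn_ge0// invr_ge0.
  have := picard_diff_hoelder w0 v0 aw av a0 ab bT B'0 d0 wv hd IH.
  rewrite -/Q => h t t' ht ht'.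
  have e x : a <= x < b -> 0 <= x < T.
    by move=> /andP[ax xb]; rewrite (le_trans a0 ax) (lt_le_trans xb bT).
  have := h t t' ht ht'.
  have -> : (fun n => picard w0 w t n - picard v0 v t n - (picard w0 w t' n - picard v0 v t' n)) =
     (fun n => w t n - v t n - (w t' n - v t' n)).
    by apply/funext => n; rewrite !fw ?fv ?e.
  apply: FLle_le; rewrite ler_wpM2r ?powR_ge0//.
  move: B'0; set B' := (2 * Q * d + _) => B'0.
  apply: (@le_trans _ _ (Q * d + 2^-1 * B')).
    rewrite mulrDr lerD2l.
    by have := ler_wpM2r B'0 small; rewrite !mulrA -!mulrA [B' * _]mulrC.
  by rewrite /B' exprS; lra.
apply: (hoelder_inf hg) => B' hB'.
have e0 : 0 < (B' - 2 * Q * d) by rewrite subr_gt0.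
have : (fun j => B * 2^-1 ^+ j) @ \oo --> (0 : R).
  by apply: cvg_geometric; rewrite ger0_norm ?invr_ge0// invf_lt1 ?ltr1n.
move=> /cvgrPdist_lt /(_ _ e0) [j _ /(_ j (leqnn j))] /=.
rewrite sub0r normrN ger0_norm; last by rewrite mulr_ge0 ?exprn_ge0 ?invr_ge0.
move=> hj; apply: hoelder_le (h j).
by rewrite -lerBrDl ltW.
Qed.

End Picard.

Section WickClosure.
Variable T : R.
Hypotheses (T0 : 0 < T) (T1 : T <= 1).
Local Notation approx := (approximable s r gamma `[0, T[).

(** Finitely many input frequencies have finitely many outputs n1 - n2 + n3. *)
Lemma finsupp_wickint (S : step R) L x y : step_bounded s r gamma S L ->
  (forall i : stidx S, finitely_supported (stval i)) -> 0 <= x -> x <= y -> y <= T ->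
  finitely_supported (wickint (stepfun S) (stepfun S) (stepfun S) x y).
Proof.
move=> SL fS x0 xy yT.
have [A fA hA] := stepfun_finsupp fS.
have aS : approx (stepfun S) L by exact: approximable_step.
pose A3 := (fun k : int * int * int => k.1.1 - k.1.2 + k.2) @` (A `*` A `*` A).
apply: (@sub_finite_set _ _ A3); last by apply: finite_image; do 2 apply: finite_setX => //.
move=> n /=; apply: contraNP => nA.
have z k : k.1.1 - k.1.2 + k.2 = n -> tint k (stepfun S) (stepfun S) (stepfun S) x y = 0.
  move=> kn.
  have mD : measurable `[x, y[%classic by exact: measurable_itv.
  have := cintegralZ mD (leb_itv_lty true true x y) 0 (bmeas_cst `[x, y[%classic 0).
  rewrite [RHS]mul0r => e; rewrite -[RHS]e; apply: eq_cintegral => t _; rewrite mul0r.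
  have [/hA ->|k1] := pselect (~ A k.1.1); first by rewrite !mul0r mulr0.
  have [/hA ->|k2] := pselect (~ A k.1.2); first by rewrite conjc0 mulr0 mul0r mulr0.
  have [/hA ->|k3] := pselect (~ A k.2); first by rewrite !mulr0.
  case: nA; exists k => //; split; [split|]; exact: contrapT.
have h := has_csum_tint T1 aS aS aS x0 xy yT n.
(* all terms vanish, so the sum is 0 times itself *)
have e k : nonresonant n k -> 0 * tint k (stepfun S) (stepfun S) (stepfun S) x y =
    tint k (stepfun S) (stepfun S) (stepfun S) x y.
  by case=> /z -> _ _; rewrite mulr0.
have := has_csum_unique h (eq_has_csum e (has_csumZ 0 h)).
by rewrite mul0r z/= ?addr0 => [->|]//; rewrite subrr add0r.
Qed.

(** The Duhamel integral preserves the closure of the trigonometric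
    polynomials: it is continuous with respect to the approximation by step
    functions with finitely supported values. *)
Lemma closure_wickint w A0 B L x y : 0 <= A0 -> 0 <= B -> FLle (w 0) A0 ->
  hoelder 0 T w B -> (forall t, 0 <= t < T -> clos (w t)) -> approx w L ->
  0 <= x -> x <= y -> y <= T -> clos (wickint w w w x y).
Proof.
move=> A00 B0 h0 hB cw aw x0 xy yT.
have [M M0 hM] := hoelder_finsupp_approx hs hr hg T0 A00 B0 h0 hB cw.
have L0 := approximable_ge0 aw.
apply: (closure_lim hr) => e e0.
pose Q := Cc * (L ^+ 2 + L * M + M ^+ 2) * (y - x) `^ gamma + 1.
have Q0 : 0 < Q.
  by rewrite ltr_wpDl// mulr_ge0 ?powR_ge0// mulr_ge0 ?mulr_ge0 ?(ltW C00) ?(ltW C10)// !addr_ge0 ?exprn_ge0 ?mulr_ge0.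
have [S [SM Sf Sa]] := hM (e / Q) (divr_gt0 e0 Q0).
exists (wickint (stepfun S) (stepfun S) (stepfun S) x y).
  by apply: closure_finsupp => //; exact: (finsupp_wickint SM Sf x0 xy yT).
have aS : approx (stepfun S) M by exact: approximable_step.
have h := FLle_wickint_sub T1 aw aS Sa x0 xy yT.
apply: FLle_le h.
rewrite [leLHS](_ : _ = e / Q * (Q - 1)); last by rewrite /Q; ring.
by rewrite mulrBr divfK ?gt_eqF// gerBl mulr1 divr_ge0 ?(ltW e0) ?(ltW Q0).
Qed.

End WickClosure.

(** * Fixed points of the Picard map *)

Section FixedPoints.
Variable T : R.
Hypotheses (T0 : 0 < T) (T1 : T <= 1).
Local Notation approx := (approximable s r gamma `[0, T[).
Variable sgn : bool.
Local Notation picard := (picard sgn).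

Let at0 : 0 <= (0 : R) < T. Proof. by rewrite lexx T0. Qed.

Definition picard_fixed (w0 : coefs R) (w : R -> coefs R) := forall t : R, 0 <= t < T -> w t =1 picard w0 w t.

Lemma powR_le1 (x : R) : 0 <= x -> x <= 1 -> x `^ gamma <= 1.
Proof.
move=> x0 x1; have <- : 1 `^ gamma = 1 :> R by rewrite powR1.
by apply: ge0_ler_powR; rewrite ?nnegrE ?(ltW g0).
Qed.

Lemma hoelder_vanishing w B t : 0 <= B -> hoelder 0 T w B -> w 0 =1 (fun=> 0) -> 0 <= t < T ->
  FLle (w t) B.
Proof.
move=> B0 hB w0 ht; have h0 : FLle (w 0) 0.
  by have /funext -> := w0; exact: FLle0.
have := hoelder_norm hr T0 hB h0 ht; apply: FLle_le.
have /andP[t0 tT] := ht; rewrite add0r subr0 ler_piMr// powR_le1// (le_trans (ltW tT))//.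
Qed.

Lemma fixed_hoelder w0 w L : approx w L -> picard_fixed w0 w -> hoelder 0 T w (Cc * L ^+ 3).
Proof.
move=> aw fw t t' ht ht'.
have := picard_hoelder T1 sgn w0 aw ht ht'.
by have /funext <- := fw t ht; have /funext <- := fw t' ht'.
Qed.

Lemma fixed0 w0 w L : approx w L -> picard_fixed w0 w -> w 0 =1 w0.
Proof.
move=> aw fw n; rewrite (fw 0 at0).
exact: (picard0 T0 T1 sgn w0 aw).
Qed.

(** Uniqueness: two fixed points agree on a short time interval whose length
    depends only on their sizes, hence step by step on all of [0, T). *)
Lemma fixed_unique w0 w v L M : approx w L -> approx v M ->
  picard_fixed w0 w -> picard_fixed w0 v -> forall t, 0 <= t < T -> w t =1 v t.
Proof.
move=> aw av fw fv.
have L0 := approximable_ge0 aw; have M0 := approximable_ge0 av.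
pose Q := Cc * (L ^+ 2 + L * M + M ^+ 2).
have Q0 : 0 <= Q.
  by rewrite mulr_ge0 ?(ltW Cc0)// !addr_ge0 ?exprn_ge0 ?mulr_ge0.
have QK : 0 <= Q * K by exact: mulr_ge0 (ltW K0).
(* on intervals of length at most h the difference estimate contracts *)
pose h := (2 * (Q * K) + 1)^-1 `^ gamma^-1.
have c0 : 0 < 2 * (Q * K) + 1 by rewrite ltr_wpDl// mulr_ge0.
have h0 : 0 < h by rewrite powR_gt0// invr_gt0.
have hh : h `^ gamma = (2 * (Q * K) + 1)^-1.
  by rewrite -powRrM mulVf ?gt_eqF// powRr1// invr_ge0 ltW.
have small x : 0 <= x -> x <= h -> Q * K * x `^ gamma <= 2^-1.
  move=> x0 xh; apply: (@le_trans _ _ (Q * K * h `^ gamma)).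
    by rewrite ler_wpM2l// ge0_ler_powR ?nnegrE ?(ltW g0)// ltW.
  by rewrite hh ler_pdivrMr//; lra.
have hw := fixed_hoelder aw fw; have hv := fixed_hoelder av fv.
have B0 : 0 <= Cc * L ^+ 3 + Cc * M ^+ 3.
  by rewrite addr_ge0 ?mulr_ge0 ?exprn_ge0 ?(ltW C00) ?(ltW C10).
have hD := hoelder_sub hr hw hv.
(* steps of length h / 2 keep t inside the half-open interval [a, a + h) *)
have main m : forall t : R, 0 <= t < T -> t <= h / 2 * m%:R -> w t =1 v t.
  elim: m => [|m IH] t ht tm n.
    have -> : t = 0 by apply/le_anti; case/andP: ht => -> _; rewrite (le_trans tm)// mulr0.
    by rewrite (fixed0 aw fw) (fixed0 av fv).
  pose a := h / 2 * m%:R.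
  have [ta|ta] := leP t a; first exact: IH.
  have /andP[t0 tT] := ht.
  have a0 : 0 <= a by rewrite mulr_ge0// divr_ge0// ltW.
  have aT : a < T by exact: lt_trans tT.
  pose b := Num.min T (a + h).
  have ab : a < b by rewrite lt_min aT ltrDl h0.
  have bT : b <= T by rewrite ge_min lexx.
  have tb : t < b.
    rewrite lt_min tT /= (le_lt_trans tm)// -[m.+1]addn1 natrD mulrDr mulr1 ltrD2l.
    by rewrite ltr_pdivrMr// ltr_pMr// ltr1n.
  have wv tau : 0 <= tau < a -> w tau =1 v tau.
    by move=> /andP[tau0 taua]; apply: IH (ltW taua); rewrite tau0 (lt_trans taua).
  have ea : w a =1 v a by apply: IH; rewrite ?a0.
  have ha : FLle (fun n => w a n - v a n) 0.
    rewrite (_ : (fun n => _) = fun=> 0); last by apply/funext => k; rewrite ea subrr.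
    exact: FLle0.
  have hab : hoelder a b (fun t n => w t n - v t n) (Cc * L ^+ 3 + Cc * M ^+ 3).
    move=> x y /andP[ax xb] /andP[ay yb]; apply: hD.
      by rewrite (le_trans a0 ax) (lt_le_trans xb bT).
    by rewrite (le_trans a0 ay) (lt_le_trans yb bT).
  have bah : b - a <= h by rewrite lerBlDl ge_min lexx orbT.
  have ba0 : 0 <= b - a by rewrite subr_ge0 ltW.
  have := fixed_points_diff T1 aw av fw fv a0 ab bT B0 (lexx 0) wv ha hab (small _ ba0 bah).
  rewrite mulr0 => /(_ t a); rewrite mul0r lexx ab (ltW ta) tb => /(_ isT isT) /(FLle_eq0 hs hr) /(_ n) /=.
  by rewrite ea subrr subr0 => /eqP; rewrite subr_eq0 => /eqP.
move=> t ht; have /andP[t0 _] := ht.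
have x0 : 0 <= t / (h / 2) by rewrite divr_ge0// divr_ge0// ltW.
apply: (main (Num.bound (t / (h / 2)))) => //.
have := archi_boundP x0; rewrite ltr_pdivrMr ?divr_gt0// => /ltW.
by rewrite mulrC.
Qed.

Variable M : R.
(** For two functions of size 2M the difference estimate has the constant
    12 Cc K M^2 T^gamma; with 48 it is at most 1/4. *)
Hypotheses (M0 : 0 < M) (small : 48 * K * Cc * M ^+ 2 * T `^ gamma <= 1).

Local Notation B := (Cc * (2 * M) ^+ 3).

Let B0 : 0 < B. Proof. by rewrite !mulr_gt0// exprn_gt0// mulr_gt0. Qed.
Let contraction :
  Cc * ((2 * M) ^+ 2 + 2 * M * (2 * M) + (2 * M) ^+ 2) * K * (T - 0) `^ gamma <= 2^-1.
Proof.
rewrite subr0 [leLHS](_ : _ = 4^-1 * (48 * K * Cc * M ^+ 2 * T `^ gamma)); last by field.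
by have half (z : R) : z <= 1 -> 4^-1 * z <= 2^-1; [move=> hz; lra|exact: half].
Qed.

Lemma ball_approximable w0 w : FLle w0 M -> w 0 =1 w0 -> hoelder 0 T w B -> approx w (2 * M).
Proof.
move=> h0 /funext ww hB.
apply: (hoelder_approximable hs hr hg (a := 0) (A0 := M) (B := B)) => //; rewrite ?(ltW M0) ?(ltW B0)//.
- by move=> t /andP[/le_lt_trans h /h]; rewrite ltxx.
- by rewrite ww.
rewrite subr0 [ltLHS](_ : _ = M + M * (6^-1 * (48 * K * Cc * M ^+ 2 * T `^ gamma))); last by field.
have sixth (z : R) : z <= 1 -> M + M * (6^-1 * z) < 2 * M.
  move=> hz; rewrite -[2]/(1 + 1) mulrDl mul1r ltrD2l -[ltRHS]mulr1 ltr_pM2l//.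
  by lra.
exact: sixth.
Qed.

Lemma fixed_lipschitz w0 v0 w v d : approx w (2 * M) -> approx v (2 * M) ->
  picard_fixed w0 w -> picard_fixed v0 v -> 0 <= d -> FLle (fun n => w0 n - v0 n) d ->
  hoelder 0 T (fun t n => w t n - v t n) (24 * Cc * M ^+ 2 * d).
Proof.
move=> aw av fw fv d0 hd.
have hD := hoelder_sub hr (fixed_hoelder aw fw) (fixed_hoelder av fv).
rewrite (_ : 24 * Cc * M ^+ 2 * d = 2 * (Cc * ((2 * M) ^+ 2 + 2 * M * (2 * M) + (2 * M) ^+ 2)) * d); last by ring.
have B20 : 0 <= B + B by rewrite addr_ge0 ?ltW.
apply: (fixed_points_diff T1 aw av fw fv (lexx 0) T0 (lexx T) B20 d0 _ _ hD contraction).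
  by move=> t /andP[/le_lt_trans h /h]; rewrite ltxx.
apply: FLle_mono hd => // n.
by rewrite (fixed0 aw fw) (fixed0 av fv).
Qed.

(** The set on which the Picard map contracts. Preservation of the closure of the
    trigonometric polynomials is carried along, so that it passes to the limit. *)
Definition ball_candidate w0 w := [/\ w 0 =1 w0, hoelder 0 T w B &
  clos w0 -> forall t, 0 <= t < T -> clos (w t)].

Lemma picard_ball w0 w : FLle w0 M -> ball_candidate w0 w -> ball_candidate w0 (picard w0 w).
Proof.
move=> h0 [ww hB cw]; have aw := ball_approximable h0 ww hB.
split.
- exact: (picard0 T0 T1 sgn w0 aw).
- exact: (picard_hoelder T1 sgn w0 aw).
move=> c0 t /andP[t0 /ltW tT].
apply: (closure_sub hr c0); apply: (closure_scale hr).
have w00 : FLle (w 0) M by have /funext -> := ww.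
exact: (closure_wickint T0 T1 (ltW M0) (ltW B0) w00 hB (cw c0) aw).
Qed.

Lemma picard_contraction w0 w v b : FLle w0 M -> ball_candidate w0 w -> ball_candidate w0 v ->
  0 <= b -> hoelder 0 T (fun t n => w t n - v t n) b ->
  hoelder 0 T (fun t n => picard w0 w t n - picard w0 v t n) (b / 2).
Proof.
move=> h0 [ww wB _] [vv vB _] b0 hb.
have aw := ball_approximable h0 ww wB; have av := ball_approximable h0 vv vB.
have hd : FLle (fun n => w 0 n - v 0 n) 0.
  rewrite (_ : (fun n => _) = fun=> 0); last by apply/funext => k; rewrite ww vv subrr.
  exact: FLle0.
have z t : 0 <= t < 0 -> w t =1 v t by move=> /andP[/le_lt_trans h /h]; rewrite ltxx.
have := picard_diff_hoelder T1 sgn w0 w0 aw av (lexx 0) T0 (lexx T) b0 (lexx 0) z hd hb.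
apply: hoelder_le; rewrite add0r.
have := ler_wpM2r b0 contraction.
by rewrite [_^-1 * b]mulrC => /(le_trans _); apply; apply: eq_ler; ring.
Qed.

(** The iterates start from the constant function w0, their increments have Hoelder
    constants decreasing geometrically, and Hoelder bounds pass to coefficientwise
    limits. *)
Lemma picard_solution w0 : FLle w0 M -> exists w, [/\ approx w (2 * M), picard_fixed w0 w,
  w 0 =1 w0 & (clos w0 -> forall t, 0 <= t < T -> clos (w t))].
Proof.
move=> h0.
pose w j := iter j (picard w0) (fun=> w0).
have wj j : ball_candidate w0 (w j).
  elim: j => [|j IH]; last exact: picard_ball.
  split=> // t t' _ _ /=; rewrite (_ : (fun n => _) = fun=> 0).
    by apply: FLle_le (FLle0 s hr); rewrite mulr_ge0 ?powR_ge0 ?(ltW B0).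
  by apply/funext => n; rewrite subrr.
have p2 j : 0 <= 2^-1 ^+ j :> R by rewrite exprn_ge0// invr_ge0.
have d j : hoelder 0 T (fun t n => w j.+1 t n - w j t n) (2 * B * 2^-1 ^+ j).
  elim: j => [|j IH].
    have [[_ h1 _] [_ h2 _]] := (wj 1%N, wj 0%N).
    by have := hoelder_sub hr h1 h2; apply: hoelder_le; rewrite expr0 mulr1; lra.
  have B2 : 0 <= 2 * B * 2^-1 ^+ j by rewrite mulr_ge0// mulr_ge0// ltW.
  have := picard_contraction h0 (wj j.+1) (wj j) B2 IH.
  apply: hoelder_le; rewrite [2^-1 ^+ j.+1]exprSr [leRHS]mulrA.
  exact: lexx.
have v0 (w1 w2 : R -> coefs R) : w1 0 =1 w0 -> w2 0 =1 w0 ->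
    (fun n => w1 0 n - w2 0 n) =1 fun=> 0.
  by move=> e1 e2 n; rewrite e1 e2 subrr.
have w0j j : w j 0 =1 w0 by case: (wj j).
have lim t n : exists z, 0 <= t < T -> ccvg (fun j => w j t n) z.
  have [tT|tT] := boolP (0 <= t < T); last by exists 0.
  have [|z hz] := @ccvg_geometric R (fun j => w j t n) (2 * B); last by exists z.
  move=> j.
  have := hoelder_vanishing (mulr_ge0 (mulr_ge0 (ler0n _ 2) (ltW B0)) (p2 j)) (d j) (v0 _ _ (w0j _) (w0j _)) tT.
  exact: FLle_coord.
have /choice[wl hwl] t : exists wt : coefs R, forall n, 0 <= t < T -> ccvg (fun j => w j t n) (wt n).
  by have /choice[wt hwt] := lim t; exists wt.
have wl0 : wl 0 =1 w0.
  move=> n; apply: ccvg_unique (hwl 0 n at0) _.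
  by rewrite (_ : (fun j => _) = fun=> w0 n); [exact: ccvg_cst|apply/funext => j; rewrite w0j].
have wlB : hoelder 0 T wl B.
  move=> t t' ht ht'; apply: (FLle_lim hr (uj := fun j n => w j t n - w j t' n)).
    by move=> j; case: (wj j) => _ h _; exact: h.
  by move=> n; apply: ccvgB; exact: hwl.
(* the remaining increments sum to twice the first one *)
have dd j i : hoelder 0 T (fun t n => w j t n - w (j + i)%N t n) (4 * B * 2^-1 ^+ j * (1 - 2^-1 ^+ i)).
  elim: i => [|i IH].
    move=> t t' _ _; rewrite expr0 subrr mulr0 mul0r addn0 (_ : (fun n => _) = fun=> 0); first exact: FLle0.
    by apply/funext => n; rewrite !subrr.
  have := hoelder_sub hr IH (d (j + i)%N).
  rewrite (_ : (fun t n => _) = (fun t n => w j t n - w (j + i.+1)%N t n)); last first.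
    by apply/funext => t; apply/funext => n; rewrite addnS; ring.
  apply: hoelder_le; rewrite exprD [2^-1 ^+ i.+1]exprS.
  by apply: eq_ler; field.
have b4 j : 0 <= 4 * B * 2^-1 ^+ j by rewrite mulr_ge0// mulr_ge0// ltW.
have dl j : hoelder 0 T (fun t n => w j t n - wl t n) (4 * B * 2^-1 ^+ j).
  move=> t t' ht ht'.
  apply: (FLle_lim hr (uj := fun i n => w j t n - w (j + i)%N t n - (w j t' n - w (j + i)%N t' n))).
    move=> i; apply: FLle_le (dd j i t t' ht ht'); rewrite ler_wpM2r ?powR_ge0//.
    by rewrite ler_piMr// gerBl.
  have sh t1 n : 0 <= t1 < T -> ccvg (fun i => w (j + i)%N t1 n) (wl t1 n).
    move=> ht1; have := hwl t1 n ht1; rewrite /ccvg => h.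
    rewrite (_ : (fun i => _) = (fun i => normc (w (i + j)%N t1 n - wl t1 n))); last first.
      by apply/funext => i; rewrite addnC.
    by rewrite (cvg_shiftn j (fun i => normc (w i t1 n - wl t1 n))).
  by move=> n; apply: ccvgB; apply: ccvgB; [exact: ccvg_cst|exact: sh|exact: ccvg_cst|exact: sh].
have geo : (fun j => 4 * B * 2^-1 ^+ j) @ \oo --> (0 : R).
  by apply: cvg_geometric; rewrite ger0_norm ?invr_ge0// invf_lt1 ?ltr1n.
have wlc : clos w0 -> forall t, 0 <= t < T -> clos (wl t).
  move=> c0 t ht; apply: (closure_lim hr) => e e0.
  have [j _ /(_ j (leqnn j))] := (cvgrPdist_lt _ _).1 geo e e0.
  rewrite sub0r normrN ger0_norm// => hj.
  exists (w j t); first by case: (wj j) => _ _ /(_ c0 t ht).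
  have := hoelder_vanishing (b4 j) (dl j) (v0 _ _ (w0j _) wl0) ht.
  move=> h; apply: FLle_mono (FLle_le (ltW hj) h) => // n.
  by rewrite normc_sub.
have gl : ball_candidate w0 wl by split.
exists wl; split=> //; first exact: ball_approximable h0 wl0 wlB.
move=> t ht n.
apply: ccvg_unique (hwl t n ht) _.
have : ccvg (fun j => w j.+1 t n) (picard w0 wl t n).
  apply: ccvg_squeeze geo => j.
  have b42 : 0 <= 4 * B * 2^-1 ^+ j / 2 by rewrite divr_ge0.
  have hc := picard_contraction h0 (wj j) gl (b4 j) (dl j).
  have p1 := picard_ball h0 (wj j); have p3 := picard_ball h0 gl.
  have [[e1 _ _] [e2 _ _]] := (p1, p3).
  have := hoelder_vanishing b42 hc (v0 _ _ e1 e2) ht.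
  move=> /(FLle_coord hs hr n) /le_trans; apply.
  by rewrite ler_pdivrMr// ler_peMr// ler1n.
by rewrite /ccvg -[X in _ -> X]cvg_shiftS.
Qed.

End FixedPoints.

(** * Well-posedness *)

Section LocalWellPosedness.
Variable T : R.
Hypotheses (T0 : 0 < T) (T1 : T <= 1).
Local Notation approx := (approximable s r gamma `[0, T[).
Variable sgn : bool.
Variable M : R.
Hypotheses (M0 : 0 < M) (small : 48 * K * Cc * M ^+ 2 * T `^ gamma <= 1).
Implicit Types (u : coefs R).

Local Notation fixed := (picard_fixed T sgn).
Local Notation B := (Cc * (2 * M) ^+ 3).

Let B0 : 0 < B. Proof. by rewrite !mulr_gt0// exprn_gt0// mulr_gt0. Qed.
Lemma expLVK x u : expL x (expL (- x) u) = u.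
Proof. by rewrite -{1}[x]opprK expLK. Qed.

(** Fixed points in the ball, transported back by the inverse of the linear
    evolution. *)
Definition constructed u (U : R -> coefs R) := exists w, [/\ approx w (2 * M),
  fixed (expL (W 0) u) w, (clos u -> forall t, 0 <= t < T -> clos (w t)) &
  U = fun t => expL (- W t) (w t)].

Lemma constructed_exists u : FLle u M -> exists U, constructed u U.
Proof.
move=> hu; have h0 : FLle (expL (W 0) u) M by rewrite FLle_expL.
have [w [aw fw w0 cw]] := picard_solution T0 T1 sgn M0 small h0.
exists (fun t => expL (- W t) (w t)); exists w; split=> // cu.
by apply: cw; exact: closure_expL.
Qed.

Lemma fixed_initial u w : FLle u M -> approx w (2 * M) -> fixed (expL (W 0) u) w ->
  FLle (w 0) M.
Proof.
move=> hu aw fw.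
have /funext -> := fixed0 T0 T1 aw fw.
by rewrite FLle_expL.
Qed.

Lemma constructed_solution u U : FLle u M -> constructed u U -> solution sgn W s r T u U.
Proof.
move=> hu [w [aw fw cw ->]].
have hB := fixed_hoelder T1 aw fw.
have w0 := fixed_initial hu aw fw.
have wf t : t \in `[0, T[ -> in_FLT s r (w t).
  by move=> ht; apply: le_lt_trans (approximable_FLle hr aw ht) (ltry _).
split.
- split=> [t ht|]; first by rewrite /in_FLT FLT_norm_expL; exact: wf.
  case: eqP => [rp|/eqP rp].
    have B'0 : 0 <= B + M by rewrite addr_ge0 ?(ltW B0) ?(ltW M0).
    apply: (bounded_weak_star_continuous hs hr g0 cW B'0) => //.
      by apply: hoelder_le hB; rewrite lerDl ltW.
    by apply: FLle_le w0; rewrite lerDr ltW.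
  apply: (closure_strongly_continuous hr g0 cW (ltW B0) hB) => t ht.
  by apply: closure_of_finite => //; apply: wf; rewrite in_itv.
- rewrite /in_X (_ : (fun t => _) = w); last by apply/funext => t; rewrite expLVK.
  have [lam [A [rep _]]] := hoelder_in_U2 hr hg T0 (ltW M0) (ltW B0) w0 hB (ltr_pwDr ltr01 (lexx _)).
  by exists lam, A.
- by apply/(mild_wickint T1 sgn _ aw).
Qed.

(** Any solution in X lies in U^2 in the interaction picture and is therefore
    approximable, with a constant that may be large; uniqueness of fixed points
    holds for constants of any size. *)
Lemma constructed_unique u U V : constructed u U -> solution sgn W s r T u V ->
  forall t, t \in `[0, T[ -> V t = U t.
Proof.
move=> [w [aw fw _ ->]] [_ [lam [A rep]] mV] t ht.
have [_ lfin _] := rep.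
have l0 : (0 <= l1_norm lam)%E by apply: nneseries_ge0 => j _ _; rewrite lee_fin normc_ge0.
have lL : (l1_norm lam <= (fine (l1_norm lam))%:E)%E by rewrite fineK// ge0_fin_numE.
have av := U2_approximable_itv hs hr hg rep lL.
have Ve t' : V t' = expL (- W t') (expL (W t') (V t')) by rewrite expLK.
have fv := (mild_wickint T1 sgn u av (fun t' _ => Ve t')).1 mV.
have ht' : 0 <= t < T by move: ht; rewrite in_itv.
have /funext e := fixed_unique T0 T1 av aw fv fw ht'.
by rewrite Ve e.
Qed.

Lemma constructed_closure u U : constructed u U -> clos u ->
  strongly_continuous s r T U.
Proof.
move=> [w [aw fw cw ->]] cu.
have hB := fixed_hoelder T1 aw fw.
exact: (closure_strongly_continuous hr g0 cW (ltW B0) hB (cw cu)).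
Qed.

(** The difference of two fixed points is Hoelder continuous with a constant
    proportional to the distance d of the data; that bounds both its supremum and
    its U^2 norm. *)
Lemma constructed_lipschitz u v U V : FLle u M -> FLle v M -> constructed u U -> constructed v V ->
  (CX_dist W s r T U V <= (2 + 24 * Cc * M ^+ 2 * (1 + K))%:E * FLT_norm s r (fun n => u n - v n)%R)%E.
Proof.
move=> hu hv [w [aw fw _ ->]] [z [az fz _ ->]].
have huv := FLle_sub hr hu hv.
pose d := fine (FLT_norm s r (fun n => u n - v n)).
have de : FLT_norm s r (fun n => u n - v n) = d%:E.
  by rewrite fineK// ge0_fin_numE ?FLT_norm_ge0// (le_lt_trans huv (ltry _)).
have d0 : 0 <= d by rewrite -lee_fin -de FLT_norm_ge0.
have hd : FLle (fun n => u n - v n) d by rewrite /FLle de.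
have hd0 : FLle (fun n => expL (W 0) u n - expL (W 0) v n) d by rewrite -expL_sub FLle_expL.
have hD := fixed_lipschitz T0 T1 M0 small aw az fw fz d0 hd0.
set b := 24 * Cc * M ^+ 2 * d in hD.
have b0 : 0 <= b by rewrite !mulr_ge0 ?exprn_ge0 ?(ltW C00) ?(ltW C10) ?(ltW M0).
have hD0 : FLle (fun n => w 0 n - z 0 n) d.
  have /funext -> := fixed0 T0 T1 aw fw.
  by have /funext -> := fixed0 T0 T1 az fz.
rewrite de -EFinM.
apply: (@le_trans _ _ ((d + b)%:E + (d + K * b)%:E)%E); last first.
  by rewrite -EFinD lee_fin /b; apply: eq_ler; ring.
apply: leeD.
  apply: ge_ereal_sup => _ [t ht <-].
  rewrite -expL_sub FLT_norm_expL.
  have ht' : 0 <= t < T by move: ht; rewrite /= in_itv.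
  apply: FLle_le (hoelder_norm hr T0 hD hD0 ht'); rewrite lerD2l ler_piMr//.
  have /andP[t0 /ltW tT] := ht'.
  by rewrite subr0 powR_le1// (le_trans tT).
apply/lee_addgt0Pr => e e0.
have hL : d + K * (b * (T - 0) `^ gamma) < d + K * b + e.
  rewrite subr0 ltr_pwDr// lerD2l ler_wpM2l ?(ltW (U2_const_gt0 hg))//.
  by rewrite ler_piMr// powR_le1// ltW.
have [lam [A [rep lL]]] := hoelder_in_U2 hr hg T0 d0 b0 hD0 hD hL.
apply: le_trans lL; apply: ereal_inf_lbound; exists lam => //; exists A.
rewrite (_ : (fun t => _) = (fun t n => w t n - z t n))//.
by apply/funext => t; rewrite expL_sub !expLVK.
Qed.

End LocalWellPosedness.

End ModulatedEquation.

(** The power -2/gamma is chosen so that T^gamma compensates the factor M^2 of the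
    contraction constant. *)
Lemma time_of_existence (R : realType) (gamma A c M : R) : 0 < gamma -> 0 < A -> 0 < c ->
  c <= 1 -> c <= A^-1 `^ gamma^-1 ->
  let T := c * japanese M `^ (- (2 / gamma)) in
  [/\ 0 < T, T <= 1 & A * M ^+ 2 * T `^ gamma <= 1].
Proof.
move=> g0 A0 c0 c1 cA T.
have j1 := japanese_ge1 M; have j0 : 0 < japanese M by exact: lt_le_trans j1.
have p0 : 0 < japanese M `^ (- (2 / gamma)) by exact: powR_gt0.
split; first exact: mulr_gt0.
  apply: mulr_ile1; rewrite ?(ltW c0) ?(ltW p0)//.
  rewrite powRN invf_le1 ?powR_gt0//.
  have p20 : 0 <= 2 / gamma by rewrite divr_ge0 ?(ltW g0).
  by have := ge0_ler_powR p20 _ _ j1; rewrite powR1; apply; rewrite nnegrE// ltW.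
have jj : japanese M ^+ 2 = 1 + M ^+ 2.
  by rewrite /japanese sqr_sqrtr// addr_ge0// sqr_ge0.
have cg : c `^ gamma <= A^-1.
  have -> : A^-1 = (A^-1 `^ gamma^-1) `^ gamma.
    by rewrite -powRrM mulVf ?gt_eqF// powRr1// invr_ge0 ltW.
  by apply: ge0_ler_powR; rewrite ?nnegrE ?powR_ge0 ?(ltW g0) ?(ltW c0).
have -> : T `^ gamma = c `^ gamma * (japanese M ^+ 2)^-1.
  rewrite /T powRM ?(ltW c0) ?(ltW p0)//; congr (_ * _).
  by rewrite -powRrM mulNr divfK ?gt_eqF// powRN powR_mulrn// ltW.
rewrite jj mulrACA; apply: mulr_ile1.
- by rewrite mulr_ge0 ?powR_ge0 ?(ltW A0).
- by rewrite mulr_ge0 ?sqr_ge0// invr_ge0 addr_ge0 ?sqr_ge0.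
- by have := ler_wpM2l (ltW A0) cg; rewrite mulfV ?gt_eqF.
- by rewrite ler_pdivrMr ?mul1r ?lerDr// ltr_wpDr ?sqr_ge0.
Qed.

Theorem theorem1p13 (R : realType) (s : R) (r : \bar R)
  (W : R -> R) (L : R -> R -> R) (gamma rho : R) (sgn : bool)
  (hs : 0 <= s) (hr : (1 <= r)%E)
  (hW : continuous W)
  (hac : forall I : interval R,
     occupation W [set` I] `<< (@lebesgue_measure R))
  (hL : is_local_time W L)
  (hgamma : 1 / 2 < gamma)
  (hrho : ((hoelder_conjugate r)^-1 < rho%:E)%E)
  (hhol : holder_FLR gamma rho +oo%E L) :
  exists (T : R -> R) (C : R), 0 < C /\
    forall M : R, 0 < M ->
    [/\ 0 < T M,
        C^-1 * japanese M `^ (- (2 / gamma)) <= T M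
          <= C * japanese M `^ (- (2 / gamma)) &
        exists Phi : coefs R -> R -> coefs R,
          (forall u0, (FLT_norm s r u0 <= M%:E)%E ->
             [/\ solution sgn W s r (T M) u0 (Phi u0),
                 (forall V, solution sgn W s r (T M) u0 V ->
                    forall t, t \in `[0, T M[ -> V t = Phi u0 t) &
                 (in_FLT_closure s r u0 ->
                    strongly_continuous s r (T M) (Phi u0))]) /\
          locally_lipschitz_flow W s r (T M)
            [set u0 | (FLT_norm s r u0 <= M%:E)%E] Phi].
Proof.
have g0 : 0 < gamma by apply: lt_trans hgamma; rewrite divr_gt0.
have [c0 c00 osc0] := osc_bound hW hL hhol.
have [c1 c10 tri0] := FLle_trisum hs hr hrho.
pose C0 := c0 + 1; pose C1 := c1 + 1.
have C00 : 0 < C0 by rewrite ltr_wpDl.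
have C10 : 0 < C1 by rewrite ltr_wpDl.
have oscB x y xi : 0 <= x -> x <= y -> y <= 1 ->
    normc (osc W xi x y) <= C0 * (y - x) `^ gamma * japanese xi `^ (- rho).
  move=> x0 xy y1; apply: le_trans (osc0 x y xi x0 xy y1) _.
  by rewrite ler_wpM2r ?powR_ge0// ler_wpM2r ?powR_ge0// lerDl.
have triB F f g h A B D : uniq F -> FLle s r f A -> FLle s r g B -> FLle s r h D ->
    FLle s r (trisum rho F f g h) (C1 * (A * B * D)).
  move=> uF hf hg hh; apply: FLle_le (tri0 F f g h A B D uF hf hg hh).
  by rewrite ler_wpM2r ?lerDl// !mulr_ge0 ?(FLle_ge0 hf) ?(FLle_ge0 hg) ?(FLle_ge0 hh).
pose A := 48 * U2_const gamma * (C0 * C1).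
have A0 : 0 < A by rewrite mulr_gt0 ?mulr_gt0// U2_const_gt0.
pose c := Num.min 1 (A^-1 `^ gamma^-1).
have cp : 0 < c by rewrite lt_min ltr01 powR_gt0// invr_gt0.
have cle1 : c <= 1 by rewrite ge_min lexx.
have cleA : c <= A^-1 `^ gamma^-1 by rewrite ge_min lexx orbT.
exists (fun M => c * japanese M `^ (- (2 / gamma))), c^-1.
split=> [|M M0]; first by rewrite invr_gt0.
have [T0 T1 small] := time_of_existence M g0 A0 cp cle1 cleA.
set T := c * _ in T0 T1 small *.
split=> //.
  rewrite invrK lexx/= ler_wpM2r ?powR_ge0//.
  by rewrite (le_trans cle1)// invf_ge1.
have small' : 48 * U2_const gamma * (C0 * C1) * M ^+ 2 * T `^ gamma <= 1 by exact: small.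
pose Phi u := xget (fun=> fun=> 0) [set U | constructed s r gamma W T sgn M u U].
have PhiP u : FLle s r u M -> constructed s r gamma W T sgn M u (Phi u).
  move=> hu; have [U hU] := constructed_exists hs hr hW hgamma C00 C10 oscB triB T0 T1 sgn M0 small' hu.
  exact: (xgetPex (fun=> fun=> 0) (ex_intro _ U hU)).
exists Phi; split.
  move=> u hu; have hP := PhiP u hu; split.
  - exact: (constructed_solution hs hr hW hgamma C00 C10 oscB triB T0 T1 M0 hu hP).
  - by move=> V; apply: (constructed_unique hs hr hW hgamma C00 C10 oscB triB T0 T1 hP).
  - exact: (constructed_closure hs hr hW hgamma C00 C10 oscB triB T1 M0 hP).
move=> u hu; exists 1, (2 + 24 * (C0 * C1) * M ^+ 2 * (1 + U2_const gamma)); split=> // v z hv hz _ _.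
exact: (constructed_lipschitz hs hr hW hgamma C00 C10 oscB triB T0 T1 M0 small' hv hz (PhiP v hv) (PhiP z hz)).
Qed.
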